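(* Let $P_{\ge0}\subset\mathbb{R}^2\subset\mathbb{P}^2(\mathbb{R})$ be a convex $k$-gon with $k\ge4$, with edges $E_1,\dots,E_k$ labelled cyclically around its boundary and with $C_i\subset\mathbb{P}^2$ the Zariski closure of $E_i$ (indices modulo $k$). Let $A_P$ be its adjoint curve. Then $A_P$ is hyperbolic with respect to every point $e\in P_{\ge0}$. Moreover, it is strictly hyperbolic, i.e., it does not have any real singularities. More precisely, $A_P$ has $\lfloor\frac{k-3}{2}\rfloor$ disjoint nested ovals. If $k$ is even, there is additionally a pseudoline contained in the region in the complement of the ovals that is not simply connected. In this case, the intersection point of $C_i$ and $C_{i+k/2}$ lies on the pseudoline component, for every $i$. In general, for $k$ even or odd, the intersection point of $C_i$ and $C_{i+1+m}$, for a positive integer $m<\frac{k}{2}-1$, lies on the $m$-th oval counting from the inside (that is, from $P_{\ge0}$ outwards).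
   Context: The residual points of the convex $k$-gon are the intersection points $C_i\cap C_j$ in $\mathbb{P}^2$ of pairs of lines spanned by non-adjacent edges (i.e. all pairwise intersection points of the lines $C_1,\dots,C_k$ that are not vertices of the polygon). The adjoint curve $A_P$ is the unique plane curve of degree $k-3$ in $\mathbb{P}^2$ passing through all residual points. A real plane curve $A$ is hyperbolic with respect to a point $e\in\mathbb{P}^2(\mathbb{R})$ not on $A$ if every real line through $e$ meets $A$ only in real points. For a smooth real algebraic curve $X\subset\mathbb{P}^2$, a pseudoline of $X$ is a connected component $S$ of $X(\mathbb{R})$ such that $\mathbb{P}^2(\mathbb{R})\setminus S$ is connected; an oval of $X$ is a connected component $S$ of $X(\mathbb{R})$ such that $\mathbb{P}^2(\mathbb{R})\setminus S$ has two connected components (one contractible, the other a Möbius strip). An oval $S_1$ is nested in another oval $S_2$ if $S_1$ is contained in the contractible component of $\mathbb{P}^2(\mathbb{R})\setminus S_2$. *)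

(* Defs.v *)
From HB Require Import structures.
(* mpoly comes first and without its notations, which clash with those of
   mathcomp-analysis. *)
From mathcomp Require Import -(notations) mpoly.
From mathcomp Require Import all_boot all_order all_algebra generic_quotient.
From mathcomp Require Import all_classical all_reals topology normedtype.
From mathcomp Require Import complex.

Set Implicit Arguments.
Unset Strict Implicit.
Unset Printing Implicit Defensive.

Import Order.TTheory GRing.Theory Num.Theory numFieldNormedType.Exports.
Local Open Scope classical_set_scope.
Local Open Scope ring_scope.
Local Open Scope quotient_scope.

(** ** Generalities on topological spaces *)

Definition component (T : topologicalType) (A S : set T) : Prop :=
  exists2 x, A x & S = connected_component A x.

Definition homeomorphic (T U : topologicalType) (A : set T) (B : set U) : Prop :=
  exists (f : T -> U) (g : U -> T),
    [/\ {within A, continuous f}, {within B, continuous g},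
        forall x, A x -> B (f x) /\ g (f x) = x
      & forall y, B y -> A (g y) /\ f (g y) = y].

Definition contractible (R : realType) (T : topologicalType) (U : set T) : Prop :=
  exists2 x0, U x0 & exists H : T * R -> T,
    [/\ {within U `*` `[0, 1]%classic, continuous H},
        forall x t, U x -> t \in `[0, 1] -> U (H (x, t)),
        forall x, U x -> H (x, 0) = x
      & forall x, U x -> H (x, 1) = x0].

Definition path_in (R : realType) (T : topologicalType) (U : set T)
    (x y : T) (g : R -> T) : Prop :=
  [/\ {within `[0, 1]%classic, continuous g},
      forall t, t \in `[0, 1] -> U (g t), g 0 = x & g 1 = y].

Definition simply_connected (R : realType) (T : topologicalType) (U : set T) :
    Prop :=
  [/\ U !=set0,
      forall x y, U x -> U y -> exists g : R -> T, path_in U x y g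
    & forall x (g : R -> T), path_in U x x g -> exists H : R * R -> T,
        [/\ {within `[0, 1]%classic `*` `[0, 1]%classic, continuous H},
            forall s t, s \in `[0, 1] -> t \in `[0, 1] -> U (H (s, t)),
            forall t, t \in `[0, 1] -> H (0, t) = g t /\ H (1, t) = x
          & forall s, s \in `[0, 1] -> H (s, 0) = x /\ H (s, 1) = x]].

(** ** The real projective plane *)

(* A subtype, carrying the subspace topology. *)
Definition nzvec (R : realType) : Type := [set v : 'rV[R]_3 | v != 0].
HB.instance Definition _ (R : realType) := Topological.on (nzvec R).

Section P2.
Variable R : realType.

(* [(u == v)%MS] is equality of the spanned lines. *)
Definition proportional (u v : nzvec R) : bool := (val u == val v)%MS.

Lemma proportional_refl : reflexive proportional.
Proof. by move=> u; rewrite /proportional submx_refl. Qed.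

Lemma proportional_sym : symmetric proportional.
Proof. by move=> u v; rewrite /proportional andbC. Qed.

Lemma proportional_trans : transitive proportional.
Proof.
move=> v u w /andP[uv vu] /andP[vw wv].
by apply/andP; split; [exact: submx_trans vw | exact: submx_trans vu].
Qed.

Canonical proportional_equiv :=
  EquivRel proportional proportional_refl proportional_sym proportional_trans.

Definition P2 : Type := quotient_topology {eq_quot proportional}.
HB.instance Definition _ := Topological.on P2.
HB.instance Definition _ := Quotient.on P2.

(* Homogeneous coordinates, defined only up to a nonzero factor. *)
Definition hc (x : P2) : 'rV[R]_3 := val (repr x : nzvec R).

Definition homogenize (p : 'rV[R]_2) : 'rV[R]_3 := row_mx p (1%:M : 'M_1).

Lemma homogenize_neq0 p : homogenize p \in [set v : 'rV[R]_3 | v != 0].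
Proof.
rewrite inE /=; apply/eqP => h.
have := row_mxEr p (1%:M : 'M_1) 0 0; rewrite (h : row_mx p 1%:M = 0) !mxE.
by move=> /eqP; rewrite eq_sym oner_eq0.
Qed.

(* The inclusion of R^2, (x, y) |-> [x : y : 1]. *)
Definition affine (p : 'rV[R]_2) : P2 :=
  \pi_P2 (exist _ (homogenize p) (homogenize_neq0 p)).

(** ** The open Moebius strip *)

(* The quotient of the plane R x R by the glide reflection
   (x, t) |-> (x + 1, - t). *)
Definition glide (a b : R * R) : bool :=
  `[< exists n : int, b = (a.1 + n%:~R, (-1) ^ n * a.2) >].

Lemma glide_refl : reflexive glide.
Proof. by move=> [x t]; apply/asboolP; exists 0; rewrite addr0 expr0z mul1r. Qed.

Lemma glide_sym : symmetric glide.
Proof.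
suff h a b : glide a b -> glide b a by move=> a b; apply/idP/idP; exact: h.
move=> /asboolP[n ->]; apply/asboolP; exists (- n); case: a => x t /=.
by rewrite mulrNz addrK mulrA -expfzDr ?oppr_eq0 ?oner_eq0 // addNr expr0z mul1r.
Qed.

Lemma glide_trans : transitive glide.
Proof.
move=> b a c /asboolP[n ->] /asboolP[m ->]; apply/asboolP; exists (n + m).
by rewrite /= mulrzDr addrA mulrA -expfzDr ?oppr_eq0 ?oner_eq0 // (addrC m n).
Qed.

Canonical glide_equiv := EquivRel glide glide_refl glide_sym glide_trans.

Definition mobius : Type := quotient_topology {eq_quot glide}.
HB.instance Definition _ := Topological.on mobius.

(** ** Real plane curves *)

Section Curve.
Variables (d : nat) (F : dhomog 3 R d).

Definition eval_at (v : 'rV[R]_3) : R := meval (fun i => v 0 i) F.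

Definition evalC_at (z : 'rV[R[i]]_3) : R[i] :=
  meval (fun i => z 0 i) (map_mpoly (real_complex R) F).

(* As F is homogeneous, this does not depend on the homogeneous coordinates. *)
Definition real_locus : set P2 := [set x | eval_at (hc x) = 0].

Definition hyperbolic (e : P2) : Prop :=
  ~ real_locus e /\
  forall l : 'cV[R]_3, l != 0 -> hc e *m l = 0 ->
  forall z : 'rV[R[i]]_3, z != 0 -> z *m map_mx (real_complex R) l = 0 ->
    evalC_at z = 0 ->
    exists2 w : 'rV[R]_3, w != 0 & (z == map_mx (real_complex R) w)%MS.

Definition real_singularity (x : P2) : Prop :=
  real_locus x /\
  forall i, meval (fun j => hc x 0 j) (mderiv i F) = 0.

Definition pseudoline (S : set P2) : Prop :=
  component real_locus S /\ connected (~` S).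

Definition oval (S : set P2) : Prop :=
  component real_locus S /\
  exists D M : set P2,
    [/\ D <> M, forall U, component (~` S) U <-> U = D \/ U = M,
        contractible R D & homeomorphic M [set: mobius]].

End Curve.

(* Lying in the contractible, respectively in the Moebius, component of the
   complement of the oval [S]. *)
Definition inside (A S : set P2) : Prop :=
  exists D : set P2, [/\ component (~` S) D, contractible R D & A `<=` D].

Definition outside (A S : set P2) : Prop :=
  exists M : set P2, [/\ component (~` S) M, homeomorphic M [set: mobius] & A `<=` M].

(** ** Convex polygons *)

Section Polygon.
Variables (k : nat) (v : 'I_k -> 'rV[R]_2).

(* Twice the signed area of the triangle p q r. *)
Definition orientation (p q r : 'rV[R]_2) : R :=
  \det (\matrix_(i < 3) nth 0
    [:: homogenize p; homogenize q; homogenize r] i).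

(* Each segment [v_i, v_(i+1)] is an edge of the convex hull: all the other
   vertices lie strictly on one side of the line that it spans.  For k >= 3
   this says that the v_i are the vertices of a convex k-gon, listed cyclically
   in one of the two directions. *)
Definition convex_gon : Prop :=
  forall i j l : 'I_k, j != i -> j != ordS i -> l != i -> l != ordS i ->
    0 < orientation (v i) (v (ordS i)) (v j) *
        orientation (v i) (v (ordS i)) (v l).

Definition polygon : set 'rV[R]_2 :=
  [set p | exists w : 'I_k -> R,
    [/\ forall i, 0 <= w i, \sum_i w i = 1 & p = \sum_i w i *: v i]].

Definition edge_line (i : 'I_k) : set P2 :=
  [set x | (hc x <= homogenize (v i) + homogenize (v (ordS i)))%MS].

Definition residual_point (x : P2) : Prop :=
  exists i j : 'I_k, [/\ i != j, j != ordS i, i != ordS j,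
    edge_line i x & edge_line j x].

(* The residual points determine the form F up to a scalar; uniqueness is a
   consequence and is not part of the definition. *)
Definition adjoint_curve (F : dhomog 3 R (k - 3)) : Prop :=
  F != 0 /\ forall x, residual_point x -> real_locus F x.

End Polygon.
End P2.

(* Main.v *)
(* On the line C_i the adjoint form F vanishes at k - 3 residual points, so that
   there it is a constant c_i times the product of the linear forms of the edges
   not adjacent to E_i; comparing values at the vertices shows that all the c_i
   have the same sign.  On a line through an interior point e of the polygon this
   gives the sign of F at each of the crossings with C_1, ..., C_k (and of the
   derivative of F at a residual point), and these signs alternate often enough to
   produce k - 3 simple real roots.  In coordinates (a, b, 0) + s e the roots are
   functions rho_0 < ... < rho_(k-4) of (a, b), continuous and positively
   homogeneous, with rho_j (- a, - b) = - rho_(k-4-j) (a, b).  Hence the real locus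
   is the union of the graphs s = rho_j (a, b), where the graphs of index j and
   k - 4 - j are the same curve of P2.  If j and k - 4 - j differ, this curve bounds
   a region that is star-shaped about e, hence contractible, and its exterior is a
   bundle of open intervals over the circle of directions, twisted into a Moebius
   strip; the curve of index j = k - 4 - j meets every line through e once, and is
   the pseudoline.  A residual point lies on the graph whose index is one less than
   the number of edge forms that are positive there.  For e on the boundary of the
   polygon, hyperbolicity follows by a limit argument. *)
Require Import Defs.
From mathcomp Require Import -(notations) mpoly.
From mathcomp Require Import all_boot all_order all_algebra generic_quotient.
From mathcomp Require Import all_classical all_reals topology normedtype.
From mathcomp Require Import complex.
From mathcomp Require Import sequences derive exp trigo realfun polyrcf.
From mathcomp Require Import ring lra zify.

Set Implicit Arguments.
Unset Strict Implicit.
Unset Printing Implicit Defensive.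

Import Order.TTheory GRing.Theory Num.Theory numFieldNormedType.Exports.
Local Open Scope classical_set_scope.
Local Open Scope ring_scope.

(** * Restriction of a form to a line *)

(** Of the $k$ crossings of a line through the centre, the two extreme ones are where it meets the
    boundary of the polygon. At each of the $k-2$ others the two edges adjacent to the crossed one
    have opposite signs, so the sign of the form is governed by the number of negative edge forms.
    This number drops by one from a crossing to the next: there are $k-2$ alternating values, one
    more than the degree. The first obstacle is that the line may pass through vertices or residual
    points, where crossings coincide. Never more than two do, because the normals of the edges are
    again in convex position. A residual point is then a zero of the form, and the sign of the
    derivative supplies values on both sides of it. The second obstacle is topological: neither
    homogeneous coordinates nor an angle can be chosen continuously on the whole plane. Regions are
    therefore described by gauges on vectors, tested at both [v] and [- v], and continuity is
    checked on vectors through the open quotient map. *)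

Section LinePolynomial.
Variables (n : nat) (S : comNzRingType).
Implicit Types (p q : mpoly n S) (a b : 'rV[S]_n).

Definition line_poly p a b : {poly S} :=
  mmap polyC (fun i => (a 0 i)%:P + b 0 i *: 'X) p.

Lemma horner_line_poly p a b s :
  (line_poly p a b).[s] = meval (fun i => (a + s *: b) 0 i) p.
Proof.
rewrite /line_poly /meval /mmap horner_sum; apply: eq_bigr => m _.
rewrite !hornerE /mmap1 horner_prod; congr (_ * _); apply: eq_bigr => i _.
by rewrite !(hornerE, mxE) mulrC.
Qed.

(** [d] only bounds the degree and [c] may vanish: unlike the leading coefficient, this pair is
    multiplicative even with zero divisors. It shows below that the coefficient of degree [d] along
    a line is the value of the form at the direction [b], the point at infinity of the line. *)
Let top_coef (d : nat) (f : {poly S}) (c : S) := (size f <= d.+1)%N /\ f`_d = c.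

Let top_coefM d1 d2 f g c1 c2 :
  top_coef d1 f c1 -> top_coef d2 g c2 -> top_coef (d1 + d2) (f * g) (c1 * c2).
Proof.
move=> [sf <-] [sg <-]; split.
  by apply: (leq_trans (size_polyMleq _ _)); lia.
rewrite coefM (bigD1 (inord d1)) //= inordK ?ltnS ?leq_addr // addKn big1 ?addr0 //.
move=> i; rewrite -val_eqE /= inordK ?ltnS ?leq_addr // => ni.
case: (ltnP d1 i) => h; first by rewrite nth_default ?mul0r // (leq_trans sf).
by rewrite [X in _ * X]nth_default ?mulr0 // (leq_trans sg) //; lia.
Qed.

Let top_coefX d f c k : top_coef d f c -> top_coef (d * k) (f ^+ k) (c ^+ k).
Proof.
move=> h; elim: k => [|k IHk].
  by rewrite muln0 !expr0; split; rewrite ?size_poly1 // coef1.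
by rewrite mulnS !exprS; apply: top_coefM.
Qed.

Let top_coef_line_poly d p a b :
  p \is ishomog1 d mdeg -> top_coef d (line_poly p a b) (meval (fun i => b 0 i) p).
Proof.
move=> /dhomogP hp; rewrite /line_poly /meval /mmap.
have mon m : m \in msupp p -> top_coef d (mmap1 (fun i => (a 0 i)%:P + b 0 i *: 'X) m)
    (mmap1 (fun i => b 0 i) m).
  move=> hm; have -> : d = (\sum_i m i)%N by rewrite -mdegE -(hp m hm).
  rewrite /mmap1.
  elim: (index_enum _) => [|i s IHs].
    by rewrite !big_nil; split; rewrite ?size_poly1 // coef1.
  rewrite !big_cons; apply: top_coefM => //; rewrite -[m i in X in top_coef X]mul1n.
  apply: top_coefX; split; last by rewrite coefD coefC coefZ coefX /= add0r mulr1.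
  apply: (leq_trans (size_polyD _ _)); rewrite geq_max (leq_trans (size_polyC_leq1 _)) //=.
  by apply: (leq_trans (size_scale_leq _ _)); rewrite size_polyX.
split.
  apply: (leq_trans (size_sum _ _ _)); apply/bigmax_leqP_seq => m hm _.
  by rewrite mul_polyC (leq_trans (size_scale_leq _ _)) //; case: (mon m hm).
rewrite coef_sum big_seq [RHS]big_seq; apply: eq_bigr => m hm.
by rewrite coefCM; case: (mon m hm) => _ ->.
Qed.

Lemma size_line_poly d p a b :
  p \is ishomog1 d mdeg -> (size (line_poly p a b) <= d.+1)%N.
Proof. by move=> /(top_coef_line_poly a b)[]. Qed.

Lemma coef_line_poly d p a b :
  p \is ishomog1 d mdeg -> (line_poly p a b)`_d = meval (fun i => b 0 i) p.
Proof. by move=> /(top_coef_line_poly a b)[]. Qed.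

Lemma meval_homog d p a c : p \is ishomog1 d mdeg ->
  meval (fun i => (c *: a) 0 i) p = c ^+ d * meval (fun i => a 0 i) p.
Proof.
move=> /dhomogP hp; rewrite !mevalE big_distrr /= big_seq [RHS]big_seq.
apply: eq_bigr => m hm; have -> : d = (\sum_i m i)%N by rewrite -mdegE -(hp m hm).
rewrite mulrCA; congr (_ * _); rewrite -prodrXr -big_split /=.
by apply: eq_bigr => i _; rewrite mxE exprMn.
Qed.

Lemma deriv_line_poly p a b s :
  (line_poly p a b)^`().[s] =
  \sum_i b 0 i * meval (fun j => (a + s *: b) 0 j) (mderiv i p).
Proof.
pose L q := line_poly q a b.
have LM : {morph L : x y / x * y} by move=> x y; rewrite /L /line_poly rmorphM.
have LD : {morph L : x y / x + y} by move=> x y; rewrite /L /line_poly mmapD.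
(* The chain rule is stable under sums and products, so it only has to be checked on constants and
   variables. *)
pose P q := (L q)^`() = \sum_i b 0 i *: L (mderiv i q).
have PD x y : P x -> P y -> P (x + y).
  rewrite /P => hx hy; rewrite LD derivD hx hy -big_split /=; apply: eq_bigr => i _.
  by rewrite -scalerDr -LD -mderivD.
have PM x y : P x -> P y -> P (x * y).
  rewrite /P => hx hy; rewrite LM derivM hx hy mulr_suml mulr_sumr -big_split /=.
  apply: eq_bigr => i _.
  by rewrite mderivM LD !LM scalerDr scalerAl scalerAr.
have PC c : P (mpolyC n c).
  rewrite /P /L /line_poly mmapC derivC big1 // => i _.
  by rewrite mderivC mmap0 scaler0.
have PX i : P (mpolyX S (mnm1 i)).
  rewrite /P /L /line_poly mmapX mmap1U derivD derivC derivZ derivX add0r.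
  have U0 : mnm_sub (mnm1 i) (mnm1 i) = mnm0 by apply/mnmP => j; rewrite mnmBE subnn mnm0E.
  rewrite (bigD1 i) //= mderivX mnm1E eqxx scale1r U0 big1 ?addr0.
  - by rewrite mmapX mmap11 alg_polyC ?alg_mpolyC.
  - move=> j; rewrite eq_sym => /negbTE ne; rewrite mderivX mnm1E ne scale0r mmap0 scaler0 //.
have PXn x k : P x -> P (x ^+ k).
  move=> Px; elim: k => [|k IHk]; first exact: (PC 1).
  by rewrite exprS; apply: PM.
have PXm m : P (mpolyX S m).
  rewrite mpolyXE_id; elim: (index_enum _) => [|i r IHr].
    by rewrite big_nil; apply: (PC 1).
  rewrite big_cons; apply: PM => //; apply: PXn; apply: PX.
have : P p.
  rewrite (mpolyE p); elim: (msupp p) => [|m r IHr].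
    rewrite big_nil; exact: (PC 0).
  by rewrite big_cons; apply: PD => //; rewrite -mul_mpolyC; apply: PM.
rewrite /P /L => ->; rewrite horner_sum; apply: eq_bigr => i _.
by rewrite hornerZ horner_line_poly.
Qed.

End LinePolynomial.

Lemma map_line_poly (n : nat) (S S' : comNzRingType) (f : {rmorphism S -> S'})
    (p : mpoly n S) (a b : 'rV[S]_n) :
  map_poly f (line_poly p a b) = line_poly (map_mpoly f p) (map_mx f a) (map_mx f b).
Proof.
pose P q := map_poly f (line_poly q a b) =
  line_poly (map_mpoly f q) (map_mx f a) (map_mx f b).
have PD x y : P x -> P y -> P (x + y).
  by rewrite /P /line_poly /map_mpoly !mmapD rmorphD /= => -> ->.
have P0 : P 0 by rewrite /P /line_poly /map_mpoly !mmap0 rmorph0.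
suff : P p by [].
rewrite (mpolyE p); elim: (msupp p) => [|m r IHr]; first by rewrite big_nil.
rewrite big_cons; apply: PD; last exact: IHr.
rewrite /P /line_poly /map_mpoly !mmapZ !mmapX rmorphM /= map_polyC rmorphM /= mmapC; congr (_ * _).
rewrite /mmap1 !rmorph_prod /=; apply: eq_bigr => i _; rewrite !rmorphXn /=.
rewrite mmapX mmap1U; congr (_ ^+ _).
by rewrite rmorphD /= map_polyC map_polyZ map_polyX !mxE.
Qed.

Lemma poly_eq0_of_horner (K : numDomainType) (p : {poly K}) :
  (forall x, p.[x] = 0) -> p = 0.
Proof.
move=> h; apply/eqP/negPn/negP => p0.
have := max_poly_roots (rs := [seq i%:R | i <- iota 0 (size p)]) p0 _ _.
rewrite size_map size_iota ltnn; move=> H; suff: false by []; apply: H.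
  by apply/allP => x _; rewrite /root h.
rewrite map_inj_in_uniq ?iota_uniq // => i j _ _ /eqP.
by rewrite eqr_nat => /eqP.
Qed.

(* Kronecker substitution: by homogeneity, (x, x^(d+1), 1) separates the
   monomials. *)
Lemma homog3_eq0 (K : numDomainType) (d : nat) (p : mpoly 3 K) :
  p \is ishomog1 d mdeg -> (forall v : 'rV[K]_3, meval (fun i => v 0 i) p = 0) ->
  p = 0.
Proof.
move=> /dhomogP hp h0.
pose h (i : 'I_3) : {poly K} := nth 1 [:: 'X; 'X^(d.+1)] i.
have hE (m : multinom 3) : mmap1 h m = 'X^(m ord0 + d.+1 * m (inord 1)).
  rewrite /mmap1 !big_ord_recl big_ord0 /h /= expr1n !mulr1 -exprM -exprD.
  by congr ('X^(_ + d.+1 * m _)); apply: val_inj; rewrite /= inordK.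
have dE (m : multinom 3) : m \in msupp p -> (m ord0 + m (inord 1) + m (inord 2))%N = d.
  move=> hm; transitivity (mdeg m); last exact: hp.
  rewrite mdegE !big_ord_recl big_ord0 addn0 addnA.
  by congr (_ + m _ + m _)%N; apply: val_inj; rewrite /= inordK.
have P0 : mmap polyC h p = 0.
  apply: poly_eq0_of_horner => x.
  rewrite -[RHS](h0 (\row_i (h i).[x])) /mmap /meval /mmap horner_sum.
  apply: eq_bigr => m _; rewrite hornerM hornerC /mmap1 horner_prod; congr (_ * _).
  by apply: eq_bigr => i _; rewrite mxE horner_exp.
apply/mpolyP => m; rewrite mcoeff0; case: (boolP (m \in msupp p)); last first.
  by move=> /memN_msupp_eq0.
move=> hm; move: (congr1 (fun q : {poly K} => q`_(m ord0 + d.+1 * m (inord 1))) P0).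
rewrite coef0 /mmap coef_sum (bigD1_seq m) ?msupp_uniq //= hE coefCM coefXn eqxx mulr1.
rewrite big_seq_cond big1 ?addr0 // => m' /andP[hm' ne].
rewrite coefCM hE coefXn; case: eqP => [E|]; last by rewrite mulr0.
have [d1 d2] := (dE m hm, dE m' hm').
have E1 : m (inord 1) = m' (inord 1) by nia.
have E0 : m ord0 = m' ord0 by nia.
have E2 : m (inord 2) = m' (inord 2) by lia.
case/eqP: ne; apply/mnmP => -[[|[|[|//]]] hi].
- by rewrite (_ : Ordinal hi = ord0) //; apply: val_inj.
- by rewrite (_ : Ordinal hi = inord 1) //; apply: val_inj; rewrite /= inordK.
- by rewrite (_ : Ordinal hi = inord 2) //; apply: val_inj; rewrite /= inordK.
Qed.

(** * Linear algebra in dimension three *)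

Section Vec3.
Variable R : comNzRingType.
Implicit Types x y z w : 'rV[R]_3.

Definition row3 (a b c : R) : 'rV[R]_3 := \row_(i < 3) nth 0 [:: a; b; c] i.

Definition dot x y : R :=
  x 0 0 * y 0 0 + x 0 1 * y 0 1 + x 0 ord_max * y 0 ord_max.

Definition cross x y : 'rV[R]_3 :=
  row3 (x 0 1 * y 0 ord_max - x 0 ord_max * y 0 1)
       (x 0 ord_max * y 0 0 - x 0 0 * y 0 ord_max)
       (x 0 0 * y 0 1 - x 0 1 * y 0 0).

Definition det3 x y z : R := dot (cross x y) z.

Lemma row3E0 a b c : row3 a b c 0 0 = a. Proof. by rewrite mxE. Qed.
Lemma row3E1 a b c : row3 a b c 0 1 = b. Proof. by rewrite mxE. Qed.
Lemma row3E2 a b c : row3 a b c 0 ord_max = c. Proof. by rewrite mxE. Qed.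
Definition row3E := (row3E0, row3E1, row3E2).

Lemma row3P x y :
  x 0 0 = y 0 0 -> x 0 1 = y 0 1 -> x 0 ord_max = y 0 ord_max -> x = y.
Proof.
move=> h0 h1 h2; apply/rowP => -[[|[|[|//]]] hi].
- by rewrite (_ : Ordinal hi = 0) //; apply: val_inj.
- by rewrite (_ : Ordinal hi = 1) //; apply: val_inj.
- by rewrite (_ : Ordinal hi = ord_max) //; apply: val_inj.
Qed.

Lemma dotDr x y z : dot x (y + z) = dot x y + dot x z.
Proof. by rewrite /dot !mxE; ring. Qed.
Lemma dotZr x c y : dot x (c *: y) = c * dot x y.
Proof. by rewrite /dot !mxE; ring. Qed.
Lemma dotZl x c y : dot (c *: x) y = c * dot x y.
Proof. by rewrite /dot !mxE; ring. Qed.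
Lemma dot0r x : dot x 0 = 0.
Proof. by rewrite /dot !mxE; ring. Qed.
Lemma dotNr x y : dot x (- y) = - dot x y.
Proof. by rewrite /dot !mxE; ring. Qed.
Lemma dotC x y : dot x y = dot y x.
Proof. by rewrite /dot; ring. Qed.

Lemma det3_rot x y z : det3 x y z = det3 y z x.
Proof. by rewrite /det3 /dot /cross !row3E; ring. Qed.

Lemma det3_swap x y z : det3 x y z = - det3 y x z.
Proof. by rewrite /det3 /dot /cross !row3E; ring. Qed.

Lemma det3xx x y : det3 x y x = 0 /\ det3 x y y = 0.
Proof. by rewrite /det3 /dot /cross !row3E; split; ring. Qed.

Lemma cramer3 x y z w :
  det3 x y z *: w = det3 w y z *: x + det3 x w z *: y + det3 x y w *: z.
Proof. by apply: row3P; rewrite !mxE /det3 /dot /cross !row3E; ring. Qed.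

Lemma cramer3_dual x y z w :
  det3 x y z *: w = dot x w *: cross y z + dot y w *: cross z x + dot z w *: cross x y.
Proof. by apply: row3P; rewrite !mxE /det3 /dot /cross ?row3E /=; ring. Qed.

(** The Grassmann-Pluecker relation between four vectors modulo [a]; it propagates positivity among
    triples that contain [a]. *)
Lemma pluecker a x y z w :
  det3 a x z * det3 a y w = det3 a x y * det3 a z w + det3 a x w * det3 a y z.
Proof. by rewrite /det3 /dot /cross !row3E; ring. Qed.

(** The lines [ux] and [xy] meet at [x], so their vector product is a multiple of [x], at which the
    third line is evaluated. This converts orientations of edge lines into orientations of
    vertices. *)
Lemma det3_cross u x y z w :
  det3 (cross u x) (cross x y) (cross z w) = det3 u x y * det3 z w x.
Proof. by rewrite /det3 /dot /cross !row3E; ring. Qed.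

End Vec3.

Lemma orientationE (R : realType) (p q r : 'rV[R]_2) :
  orientation p q r = det3 (homogenize p) (homogenize q) (homogenize r).
Proof.
rewrite /orientation; move: (homogenize p) (homogenize q) (homogenize r) => P Q S.
(* Entries are renamed by natural numbers, so that ordinals differing only by their proofs become
   one atom for [ring]. *)
have E (A : 'rV[R]_3) : exists a : nat -> R, forall i : 'I_3, A 0 i = a i.
  by exists (fun i => A 0 (inord i)) => i; rewrite inord_val.
have [[p' hP] [q' hQ] [r' hS]] := And3 (E P) (E Q) (E S).
rewrite /det3 /dot /cross !row3E (expand_det_row _ 0) !big_ord_recl big_ord0 /cofactor.
rewrite !(expand_det_row _ 0) !big_ord_recl !big_ord0 /cofactor !det_mx11 !mxE /=.
rewrite !hP !hQ !hS /= /bump /= ?addn0 ?add0n; ring.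
Qed.

(** * Edges and vertices of a convex polygon *)

(** Induction on [c]. The relation [pluecker] for [a], [a.+1], [b], [c], [c.+1] writes the wanted
    determinant, times a positive one, as a sum of products of positive ones. *)
Lemma det3_chain (R : realDomainType) (k : nat) (m : nat -> 'rV[R]_3) :
  (forall h c, (h.+1 < k)%N -> (c < k)%N -> c != h -> c != h.+1 ->
     0 < det3 (m h) (m h.+1) (m c)) ->
  forall a b c, (a < b)%N -> (b < c)%N -> (c < k)%N -> 0 < det3 (m a) (m b) (m c).
Proof.
move=> H a b c; elim: c b => // c IHc b ab; rewrite ltnS leq_eqVlt => /orP[/eqP <- ck|bc ck].
  by rewrite det3_rot; apply: H; lia.
have Ibc := IHc b ab bc (ltnW ck).
move: ab; rewrite leq_eqVlt => /orP[/eqP E|ab]; first by rewrite -E; apply: H; lia.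
have H1 d : (a.+1 < d)%N -> (d < k)%N -> 0 < det3 (m a) (m a.+1) (m d).
  by move=> ad dk; apply: H; lia.
have Hc : 0 < det3 (m a) (m c) (m c.+1) by rewrite det3_rot; apply: H; lia.
have Hac : 0 < det3 (m a) (m a.+1) (m c) by apply: H1; lia.
rewrite -(pmulr_rgt0 _ Hac) pluecker addr_gt0 // mulr_gt0 //; apply: H1; lia.
Qed.

(* V lists homogeneous coordinates of the vertices and [dot (N i)] is the linear
   form cutting out the i-th edge, normalized by the sign sg so as to be
   nonnegative on the polygon. *)
Definition gon (R : realType) (k : nat) (sg : R) (N V : 'I_k -> 'rV[R]_3) : Prop :=
  [/\ forall i j : 'I_k, j != i -> j != ordS i -> 0 < dot (N i) (V j),
      forall i, dot (N i) (V i) = 0 /\ dot (N i) (V (ordS i)) = 0,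
      forall i x, dot (N i) x = sg * det3 (V i) (V (ordS i)) x,
      sg \is a GRing.unit
    & forall a b c : 'I_k, (a < b)%N -> (b < c)%N -> 0 < sg * det3 (N a) (N b) (N c)].

Lemma val_ordS k (i : 'I_k) :
  nat_of_ord (ordS i) = if (i.+1 < k)%N then i.+1 else 0.
Proof.
rewrite /=; case: ifP => [h|]; first by rewrite modn_small.
have := ltn_ord i; move=> h1 /negbT; rewrite -leqNgt => h2.
by rewrite (_ : i.+1 = k) ?modnn //; lia.
Qed.

Lemma val_iter_ordS k (i : 'I_k) n : (n < k)%N ->
  nat_of_ord (iter n (@ordS k) i) = if (i + n < k)%N then (i + n)%N else (i + n - k)%N.
Proof.
have ik := ltn_ord i; elim: n => [|n IHn] nk; first by rewrite /= addn0 ik.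
by rewrite iterS val_ordS IHn ?(ltnW nk) //; do ?[case: ifP]; lia.
Qed.

(** [convex_gon] fixes one sign for each edge; consecutive edges share the triangle of three
    consecutive vertices, which carries the sign around the boundary. The value [s i0] of one such
    triangle serves as [sg], without being normalized to plus or minus one. The last clause of [gon]
    says that the normals are in convex position too; [det3_chain] reduces it to two consecutive
    edges and a third. *)
Lemma convex_gonP (R : realType) (k : nat) (v : 'I_k -> 'rV[R]_2) :
  (4 <= k)%N -> convex_gon v ->
  exists (sg : R) N, gon sg N (fun i => homogenize (v i)).
Proof.
case: k v => // k v k4 cv; set V := fun i => homogenize (v i).
pose o i j := det3 (V i) (V (ordS i)) (V j).
have cvo i j l : j != i -> j != ordS i -> l != i -> l != ordS i -> 0 < o i j * o i l.
  by move=> *; rewrite /o -!orientationE; apply: cv.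
have neS (i : 'I_k.+1) : [/\ ordS i != i, ordS (ordS i) != i, ordS (ordS i) != ordS i,
    ordS (ordS (ordS i)) != ordS i & ordS (ordS (ordS i)) != ordS (ordS i)].
  have lk := ltn_ord i.
  by split; apply/eqP => /(congr1 (@nat_of_ord k.+1)); rewrite !val_ordS; do ?[case: ifP]; lia.
pose s i := o i (ordS (ordS i)).
have sS i : 0 < s i * s (ordS i).
  have [h1 h2 h3 h4 h5] := neS i.
  have -> : s i = o (ordS i) i by exact: det3_rot.
  by apply: cvo => //; rewrite eq_sym.
pose i0 : 'I_k.+1 := Ordinal (leq_trans (isT : (0 < 4)%N) k4).
have sk i : 0 < s i0 * s i.
  have [n nk] : exists n, i = iter n (@ordS k.+1) i0.
    by exists i; apply: val_inj; rewrite /= val_iter_ordS //= add0n ltn_ord.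
  rewrite {}nk; elim: n => [|n IHn].
    have [h1 h2 h3 h4 h5] := neS i0; apply: cvo => //.
  rewrite iterS; have := sS (iter n (@ordS k.+1) i0); move: IHn.
  set a := s i0; set b := s _; set c := s _ => h1 h2.
  have b2 : 0 < b ^+ 2 by rewrite exprn_even_gt0 //=; apply: contraTneq h1 => ->; rewrite mulr0 ltxx.
  by rewrite -(pmulr_rgt0 _ b2); have := mulr_gt0 h1 h2; rewrite (_ : a * b * (b * c) = b ^+ 2 * (a * c)); last by ring.
have o_sg i j : j != i -> j != ordS i -> 0 < s i0 * o i j.
  move=> h1 h2; have [h3 h4 h5 h6 h7] := neS i; have := cvo i (ordS (ordS i)) j h4 h5 h1 h2.
  have := sk i; rewrite -/(s i).
  set a := s i0; set b := s _; set c := o _ _ => p1 p2.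
  have b2 : 0 < b ^+ 2 by rewrite exprn_even_gt0 //=; apply: contraTneq p1 => ->; rewrite mulr0 ltxx.
  by rewrite -(pmulr_rgt0 _ b2); have := mulr_gt0 p1 p2; rewrite (_ : a * b * (b * c) = b ^+ 2 * (a * c)); last by ring.
exists (s i0), (fun i => s i0 *: cross (V i) (V (ordS i))); split.
- by move=> i j h1 h2; rewrite dotZl; apply: o_sg.
- by move=> i; rewrite !dotZl -!/(det3 _ _ _) !(proj1 (det3xx _ _), proj2 (det3xx _ _)) !mulr0.
- by move=> i x; rewrite dotZl.
- by rewrite unitfE; apply: contraTneq (sk i0) => ->; rewrite mul0r ltxx.
move=> a b c ab bc.
have -> (A B C : 'rV[R]_3) : det3 (s i0 *: A) (s i0 *: B) (s i0 *: C) = s i0 ^+ 3 * det3 A B C.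
  by rewrite /det3 /dot /cross !row3E !mxE; ring.
rewrite mulrA -exprS pmulr_rgt0; last first.
  by rewrite (exprM _ 2 2) exprn_even_gt0 //= expf_eq0 /=; apply: contraTneq (sk i0) => ->; rewrite mul0r ltxx.
pose m (h : nat) := cross (V (inord h)) (V (ordS (inord h))).
have mE (i : 'I_k.+1) : cross (V i) (V (ordS i)) = m i by rewrite /m inord_val.
rewrite !mE; apply: (det3_chain (k := k.+1)) => // {a b c ab bc} h c hk ck ch chS.
have E : ordS (inord h) = inord h.+1 :> 'I_k.+1.
  by apply: ord_inj; rewrite val_ordS !inordK ?hk //; lia.
rewrite /m E det3_cross.
have p1 : 0 < s i0 * det3 (V (inord h)) (V (inord h.+1)) (V (ordS (inord h.+1))).
  have : 0 < s i0 * o (inord h) (ordS (ordS (inord h))) by apply: o_sg; have [] := neS (inord h).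
  by rewrite /o E.
have p2 : 0 < s i0 * o (inord c) (inord h.+1).
  apply: o_sg; rewrite -val_eqE /= ?inordK //; first by rewrite eq_sym.
  case: (ltnP c.+1 k.+1) => h1; first by rewrite modn_small //; lia.
  by rewrite (_ : c.+1 = k.+1) ?modnn //; lia.
have b2 : 0 < s i0 ^+ 2.
  by rewrite exprn_even_gt0 //=; apply: contraTneq (sk i0) => ->; rewrite mul0r ltxx.
rewrite -(pmulr_rgt0 _ b2); have := mulr_gt0 p1 p2; rewrite /o.
by set A := det3 _ _ _; set B := det3 _ _ _; rewrite (_ : s i0 * A * (s i0 * B) = s i0 ^+ 2 * (A * B)); last by ring.
Qed.

Definition nonadjacent k (i j : 'I_k) : bool :=
  [&& j != i, j != ordS i & i != ordS j].

Lemma ordS_neq k (i : 'I_k) : (4 <= k)%N ->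
  [/\ ordS i != i, ordS (ordS i) != i, ordS (ordS (ordS i)) != i
    & ordS (ordS i) != ordS i].
Proof.
move=> k4; have lk := ltn_ord i.
by split; apply/eqP => /(congr1 (@nat_of_ord k)); rewrite !val_ordS; do ?[case: ifP]; lia.
Qed.

Lemma nonadjacentC k (i j : 'I_k) : nonadjacent i j = nonadjacent j i.
Proof. by rewrite /nonadjacent eq_sym; congr (_ && _); rewrite andbC. Qed.

Lemma ordS_surj k (i : 'I_k) : exists j, i = ordS j.
Proof.
by exists (ord_pred i); rewrite ord_predK.
Qed.

Lemma card_nonadjacent k (i : 'I_k) : (4 <= k)%N ->
  #|[pred j | nonadjacent i j]| = (k - 3)%N.
Proof.
move=> k4; have [h hi] := ordS_surj i.
have [h1 h2 h3 h4] := ordS_neq h k4.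
have -> : #|[pred j | nonadjacent i j]| = #|(~: [set h; i; ordS i])%SET|.
  apply: eq_card => j; rewrite !inE /nonadjacent !negb_or hi.
  rewrite (inj_eq (@ordS_inj k)) (eq_sym h j).
  by case: (j == h); case: (j == ordS h); case: (j == _).
have := cardsC [set h; i; ordS i]%SET; rewrite card_ord.
have -> : #|[set h; i; ordS i]%SET| = 3.
  rewrite -finset.setUA cardsU1 cards2 !inE hi negb_or !(eq_sym h) h1 h2.
  by rewrite eq_sym h4.
lia.
Qed.

Section Gon.
Variables (R : realType) (k : nat) (sg : R) (N V : 'I_k -> 'rV[R]_3).
Hypotheses (k4 : (4 <= k)%N) (G : gon sg N V).
Implicit Types (i j h : 'I_k) (x : 'rV[R]_3).
Local Notation l i x := (dot (N i) x).

Lemma gon_pos i j : j != i -> j != ordS i -> 0 < l i (V j).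
Proof. have [h _ _ _ _] := G; exact: h. Qed.

Lemma gon_0 i : l i (V i) = 0 /\ l i (V (ordS i)) = 0.
Proof. have [_ h _ _ _] := G; exact: h. Qed.

Lemma gon_nneg i j : 0 <= l i (V j).
Proof.
have [h1 h2] := gon_0 i.
case: (eqVneq j i) => [->|ji]; first by rewrite h1.
case: (eqVneq j (ordS i)) => [->|jS]; first by rewrite h2.
exact/ltW/gon_pos.
Qed.

Lemma edge_span i x : l i x = 0 -> exists a b, x = a *: V i + b *: V (ordS i).
Proof.
move=> lx; have [h1 h2 h3 h4] := ordS_neq i k4; have [_ _ Gd Gu _] := G.
set W := V (ordS (ordS i)).
have := gon_pos h2 h4; rewrite Gd -/W => D.
have D0 : det3 (V i) (V (ordS i)) W != 0.
  by apply: contraTneq D => ->; rewrite mulr0 ltxx.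
move: lx; rewrite Gd => /eqP; rewrite mulf_eq0 => /orP[/eqP sg0|/eqP dx].
  by rewrite sg0 unitr0 in Gu.
have := cramer3 (V i) (V (ordS i)) W x; rewrite dx scale0r addr0 => E.
exists (det3 x (V (ordS i)) W / det3 (V i) (V (ordS i)) W),
       (det3 (V i) x W / det3 (V i) (V (ordS i)) W).
by rewrite ![_ / _]mulrC -!scalerA -scalerDr -E scalerA mulVf // scale1r.
Qed.

(** With $x = a V_i + b V_{i+1}$, the form of the preceding edge is a positive multiple of $b$ and
    that of the following edge a positive multiple of $a$. If $a$ and $b$ had the same weak sign, so
    would all the edge forms at $x$. *)
Lemma gon_mixed i h x : i = ordS h -> l i x = 0 ->
  (exists j, 0 < l j x) -> (exists j, l j x < 0) -> l h x * l (ordS i) x < 0.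
Proof.
move=> hi lx [j jx] [j' jx'].
have [a [b xE]] := edge_span lx.
have [h1 h2 h3 h4] := ordS_neq h k4; have [h1' h2' h3' h4'] := ordS_neq i k4.
have le m : l m x = a * l m (V i) + b * l m (V (ordS i)).
  by rewrite xE dotDr !dotZr.
have -> : l h x = b * l h (V (ordS i)) by rewrite le hi (gon_0 h).2 mulr0 add0r.
have -> : l (ordS i) x = a * l (ordS i) (V i) by rewrite le (gon_0 (ordS i)).1 mulr0 addr0.
have p1 : 0 < l h (V (ordS i)) by apply: gon_pos; rewrite hi.
have p2 : 0 < l (ordS i) (V i) by apply: gon_pos; rewrite eq_sym.
rewrite mulrACA pmulr_llt0; last exact: mulr_gt0.
rewrite ltNge; apply/negP => ab; move: jx jx'; rewrite !le.
have := gon_nneg j i; have := gon_nneg j (ordS i).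
have := gon_nneg j' i; have := gon_nneg j' (ordS i).
set u1 := l _ _; set u2 := l _ _; set u3 := l _ _; set u4 := l _ _ => q1 q2 q3 q4 r1 r2.
case: (ltrP 0 a) => a0.
  have b0 : 0 <= b by rewrite -(pmulr_lge0 b a0).
  by have := addr_ge0 (mulr_ge0 (ltW a0) q2) (mulr_ge0 b0 q1); rewrite leNgt r2.
case: (ltrP 0 b) => b0.
  have a0' : 0 <= a by rewrite -(pmulr_rge0 a b0).
  by have := addr_ge0 (mulr_ge0 a0' q2) (mulr_ge0 (ltW b0) q1); rewrite leNgt r2.
have m1 := mulr_le0_ge0 a0 q4; have m2 := mulr_le0_ge0 b0 q3.
by move: r1; rewrite ltNge -[0]addr0 lerD.
Qed.

(** Permuting the three normals only changes the sign, so the last clause of [gon] applies after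
    sorting. Geometrically, a point lies on at most two edge lines. *)
Lemma gon_det_neq0 (i j h : 'I_k) : i != j -> j != h -> i != h ->
  det3 (N i) (N j) (N h) != 0.
Proof.
have [_ _ _ _ Gn] := G.
have Gn0 (a b c : 'I_k) : (a < b)%N -> (b < c)%N -> det3 (N a) (N b) (N c) != 0.
  by move=> ab bc; apply: contraTneq (Gn _ _ _ ab bc) => ->; rewrite mulr0 ltxx.
rewrite -!val_eqE /= !neq_ltn => /orP[] ij /orP[] jh /orP[] ih; try lia.
- exact: Gn0.
- by rewrite -det3_rot det3_swap oppr_eq0 Gn0.
- by rewrite -det3_rot Gn0.
- by rewrite det3_swap oppr_eq0 Gn0.
- by rewrite det3_rot Gn0.
- by rewrite det3_swap -det3_rot oppr_eq0 Gn0.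
Qed.

Lemma gon_indep i j h x : i != j -> j != h -> i != h ->
  l i x = 0 -> l j x = 0 -> l h x = 0 -> x = 0.
Proof.
move=> ij jh ih li lj lh; have D := gon_det_neq0 ij jh ih.
have := cramer3_dual (N i) (N j) (N h) x.
rewrite li lj lh !scale0r !addr0 => /eqP.
by rewrite scaler_eq0 (negbTE D) => /eqP.
Qed.

Lemma exists_third (i j : 'I_k) : exists h, i != h /\ j != h.
Proof.
have [h1 h2 h3 h4] := ordS_neq i k4.
case: (eqVneq j (ordS i)) => [->|ne].
  by exists (ordS (ordS i)); rewrite !(eq_sym _ (ordS (ordS i))).
by exists (ordS i); rewrite eq_sym.
Qed.

(** The point is a multiple of the vector product of the two normals, so the form of [h] there is a
    multiple of their determinant with [N h]. Its sign depends only on whether [h] lies between [i]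
    and [j]; [c] absorbs the choice of the representative. *)
Lemma gon_sign (i j : 'I_k) x : (i < j)%N -> x != 0 -> l i x = 0 -> l j x = 0 ->
  exists2 c : R, c != 0 & forall h : 'I_k,
    [/\ (h < i)%N || (j < h)%N -> 0 < c * l h x
      & (i < h)%N && (h < j)%N -> c * l h x < 0].
Proof.
move=> ij x0 li lj; have ij' : i != j by rewrite neq_ltn ij.
have [m [im jm]] := exists_third i j.
have [_ _ _ Gu Gn] := G.
have lm : l m x != 0.
  by apply: contra_neq x0 => lm; apply: (gon_indep (i := i) (j := j) (h := m)).
have := cramer3_dual (N i) (N j) (N m) x; rewrite li lj !scale0r !add0r => E.
pose D := det3 (N i) (N j) (N m).
have D0 : D != 0.
  exact: gon_det_neq0.
have lE h : D * l h x = l m x * det3 (N i) (N j) (N h).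
  by rewrite -dotZr E dotZr; congr (_ * _); exact: dotC.
have sg0 : sg != 0 by rewrite -unitfE.
exists (sg * D / l m x) => [|h].
  by rewrite !mulf_neq0 ?invr_eq0.
have cE : sg * D / l m x * l h x = sg * det3 (N i) (N j) (N h).
  by rewrite mulrAC -[sg * D * _]mulrA lE; field.
rewrite cE; split=> [/orP[hi|jh]|/andP[ih hj]].
- by rewrite -det3_rot; apply: Gn.
- exact: Gn.
- by rewrite -det3_rot det3_swap mulrN oppr_lt0; apply: Gn.
Qed.

Lemma gon_adjacent i x : l i x = 0 -> l (ordS i) x = 0 ->
  exists c, x = c *: V (ordS i).
Proof.
move=> li lS; have [a [b E]] := edge_span li; exists b.
have [h1 h2 h3 h4] := ordS_neq i k4.
have p : 0 < l (ordS i) (V i) by apply: gon_pos; rewrite eq_sym.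
move: lS; rewrite E dotDr !dotZr (gon_0 _).1 mulr0 addr0 => /eqP.
by rewrite mulf_eq0 (gt_eqF p) orbF => /eqP ->; rewrite scale0r add0r.
Qed.

(** Adjacent edge lines meet at a vertex, where no two edge forms have strictly opposite signs. *)
Lemma mixed_nonadjacent i j x : i != j -> l i x = 0 -> l j x = 0 ->
  (exists h, 0 < l h x) -> (exists h, l h x < 0) -> nonadjacent i j.
Proof.
move=> ij li lj [h hx] [h' hx'].
have adj m : l m x = 0 -> l (ordS m) x = 0 -> False.
  move=> h1 h2; have [c E] := gon_adjacent h1 h2; move: hx hx'.
  rewrite E !dotZr => p1 p2; have := gon_nneg h (ordS m); have := gon_nneg h' (ordS m).
  move=> q1 q2; case: (ltrP 0 c) => c0.
    by have := mulr_ge0 (ltW c0) q1; rewrite leNgt p2.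
  by have := mulr_le0_ge0 c0 q2; rewrite leNgt p1.
rewrite /nonadjacent eq_sym ij /=; apply/andP; split; apply/eqP => E.
  by apply: (adj i); rewrite // -E.
by apply: (adj j); rewrite // -E.
Qed.

End Gon.

(** * The adjoint form on the edges *)

(** The scalar is the coefficient in degree [size rs] rather than the leading one, so that a
    polynomial of smaller degree, which must then vanish, is included. *)
Lemma poly_factor (K : fieldType) (p : {poly K}) (rs : seq K) :
  uniq rs -> all (root p) rs -> (size p <= (size rs).+1)%N ->
  p = p`_(size rs) *: \prod_(z <- rs) ('X - z%:P).
Proof.
move=> u r sp; case: (eqVneq (size p) (size rs).+1) => [E|ne].
  rewrite {1}(all_roots_prod_XsubC E r) ?uniq_rootsE //.
  by rewrite lead_coefE E.
suff -> : p = 0 by rewrite coef0 scale0r.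
apply/eqP/negPn/negP => p0; have := max_poly_roots p0 r u.
by rewrite leqNgt ltn_neqAle ne /= sp.
Qed.

Section Adjoint.
Variables (R : realType) (k : nat) (sg : R) (N V : 'I_k -> 'rV[R]_3) (p : mpoly 3 R).
Hypotheses (k4 : (4 <= k)%N) (G : gon sg N V) (ph : p \is ishomog1 (k - 3) mdeg).
Local Notation l i x := (dot (N i) x).
Implicit Types (i j h : 'I_k) (x : 'rV[R]_3).
Local Notation ev x := (meval (fun a : 'I_3 => x 0 a) p).
Hypothesis res : forall i j x, nonadjacent i j -> x != 0 -> l i x = 0 -> l j x = 0 -> ev x = 0.

Lemma dot_line i (a b : 'rV[R]_3) s : l i (a + s *: b) = l i a + s * l i b.
Proof. by rewrite dotDr dotZr. Qed.

(* On the line C_i the form p vanishes at k-3 distinct residual points, as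
   many as its degree. *)
Lemma adjoint_edge i : exists c : R, forall x, l i x = 0 ->
  ev x = c * \prod_(j | nonadjacent i j) l j x.
Proof.
set A := V i; set B := V (ordS i); have [A0 B0] := gon_0 G i.
have lB j : nonadjacent i j -> 0 < l j B.
  by case/and3P=> h1 h2 h3; apply: (gon_pos G); rewrite ?(inj_eq (@ordS_inj k)) 1?eq_sym.
have AB s : A + s *: B != 0.
  have [h1 h2 h3 h4] := ordS_neq i k4.
  have pA : 0 < l (ordS i) A by apply: (gon_pos G); rewrite eq_sym.
  apply: contraTneq pA => /(congr1 (fun x => l (ordS i) x)).
  by rewrite dot_line (gon_0 G _).1 mulr0 addr0 dot0r => ->; rewrite ltxx.
(* Parameter of the residual point of the edges [i] and [j] on the line [A + s *: B]. *)
pose sj j := - l j A / l j B.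
have lsj j : nonadjacent i j -> l j (A + sj j *: B) = 0.
  by move=> /lB lj; rewrite dot_line /sj mulfVK ?subrr // gt_eqF.
pose rs := [seq sj j | j <- enum [pred j | nonadjacent i j]].
have srs : size rs = (k - 3)%N by rewrite size_map -cardE card_nonadjacent.
have urs : uniq rs.
  rewrite map_inj_in_uniq ?enum_uniq // => j h; rewrite !mem_enum !inE => nj nh E.
  apply/eqP/negPn/negP => jh; move: (AB (sj j)) => /eqP; apply.
  have [ji _ _] := and3P nj; have [hi _ _] := and3P nh.
  apply: (gon_indep k4 G (i := i) (j := j) (h := h)); rewrite // 1?eq_sym //.
  - by rewrite dot_line A0 B0 mulr0 addr0.
  - exact: lsj.
  - by rewrite E; apply: lsj.
have rrs : all (root (line_poly p A B)) rs.
  apply/allP => z /mapP[j]; rewrite mem_enum inE => nj ->.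
  apply/rootP; rewrite horner_line_poly; apply: (res nj) => //; last exact: lsj.
  by rewrite dot_line A0 B0 mulr0 addr0.
have sP : (size (line_poly p A B) <= (size rs).+1)%N by rewrite srs size_line_poly.
(* [B] is the point at infinity of this parametrization: the value of the form there is the
   coefficient of degree [k - 3]. *)
pose c := ev B / \prod_(j | nonadjacent i j) l j B.
have B0' : \prod_(j | nonadjacent i j) l j B != 0.
  by apply/prodf_neq0 => j /lB /gt_eqF ->.
exists c => x lx.
have cAB s : ev (A + s *: B) = c * \prod_(j | nonadjacent i j) l j (A + s *: B).
  rewrite -horner_line_poly (poly_factor urs rrs sP) srs (coef_line_poly _ _ ph).
  rewrite hornerZ horner_prod big_map big_enum_cond /= /c -mulrA; congr (_ * _).
  rewrite [RHS]mulrC -prodf_div; apply: eq_big => [j|j /andP[+ _]]; first by rewrite inE andbT.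
  rewrite inE => hj.
  have lj := lB j hj.
  by rewrite dot_line hornerXsubC /sj; field; rewrite gt_eqF.
have [a [b ->]] := edge_span k4 G lx; rewrite -/A -/B.
have scale (t : R) y : \prod_(j | nonadjacent i j) l j (t *: y) =
    t ^+ (k - 3) * \prod_(j | nonadjacent i j) l j y.
  under eq_bigr do rewrite dotZr.
  by rewrite big_split /= prodr_const card_nonadjacent.
case: (eqVneq a 0) => [->|a0].
  rewrite scale0r add0r (meval_homog _ _ ph) scale mulrCA; congr (_ * _).
  by rewrite /c mulfVK.
have -> : a *: A + b *: B = a *: (A + (b / a) *: B).
  by rewrite scalerDr scalerA mulrCA divff // mulr1.
by rewrite (meval_homog _ _ ph) scale mulrCA; congr (_ * _).
Qed.

Definition edge_coef i : R := projT1 (cid (adjoint_edge i)).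

Lemma edge_coefE i x : l i x = 0 ->
  ev x = edge_coef i * \prod_(j | nonadjacent i j) l j x.
Proof. exact: projT2 (cid (adjoint_edge i)) x. Qed.

Lemma edge_coefS i : exists2 c, 0 < c & edge_coef (ordS i) = c * edge_coef i.
Proof.
pose x := V (ordS i).
have pos h : h = i \/ h = ordS i -> 0 < \prod_(j | nonadjacent h j) l j x.
  move=> hi; apply: prodr_gt0 => j /and3P[h1 h2 h3]; apply: (gon_pos G).
    by case: hi h1 h2 h3 => -> h1 h2 h3; rewrite eq_sym.
  by case: hi h1 h2 h3 => -> h1 h2 h3 //; rewrite (inj_eq (@ordS_inj k)) eq_sym.
have E1 := edge_coefE (gon_0 G i).2; have E2 := edge_coefE (gon_0 G (ordS i)).1.
have p1 := pos _ (or_introl erefl); have p2 := pos _ (or_intror erefl).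
exists (\prod_(j | nonadjacent i j) l j x / \prod_(j | nonadjacent (ordS i) j) l j x).
  exact: divr_gt0.
by apply: (mulIf (lt0r_neq0 p2)); rewrite -E2 E1; field; apply: lt0r_neq0.
Qed.

Lemma edge_coef_sign i h : exists2 c, 0 < c & edge_coef h = c * edge_coef i.
Proof.
have [n nk ->] : exists2 n, (n < k)%N & h = iter n (@ordS k) i.
  have [hk ik] := (ltn_ord h, ltn_ord i).
  exists (if (i <= h)%N then h - i else h + k - i)%N; first by case: ifP; lia.
  apply: ord_inj; rewrite val_iter_ordS; last by case: ifP; lia.
  by do ?[case: ifP]; lia.
elim: n {nk} => [|n [c c0 E]]; first by exists 1; rewrite ?mul1r.
rewrite iterS; have [d d0 ->] := edge_coefS (iter n (@ordS k) i).
by exists (d * c); rewrite ?mulr_gt0 // E mulrA.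
Qed.

Hypothesis p0 : p != 0.

(* Otherwise p vanishes on all the k lines, hence on every line meeting them in
   k distinct points. *)
Lemma edge_coef_neq0 i : edge_coef i != 0.
Proof.
apply: contra_neq p0 => ci0; apply: (homog3_eq0 ph) => x.
have ev0 h y : l h y = 0 -> ev y = 0.
  by move=> /edge_coefE ->; have [c _ ->] := edge_coef_sign i h; rewrite ci0 mulr0 mul0r.
case: (pselect (exists h, l h x = 0)) => [[h /ev0 //]|nx].
have lx h : l h x != 0 by apply/eqP => E; apply: nx; exists h.
(* A generic direction [d] is sought on the conic $(1, t, t^2)$: a linear form [w] restricts there
   to the polynomial [q w], nonzero if [w] is, so each condition excludes finitely many [t]. *)
pose q (w : 'rV[R]_3) : {poly R} := (w 0 0)%:P + w 0 1 *: 'X + w 0 ord_max *: 'X^2.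
have qE w t : (q w).[t] = dot w (row3 1 t (t ^+ 2)).
  by rewrite /q !(hornerD, hornerZ, hornerC, hornerX, hornerXn) /dot !row3E; ring.
have q0 w : w != 0 -> q w != 0.
  apply: contra_neq => E; apply: row3P; rewrite mxE.
  - by move: (congr1 (fun f : {poly R} => f`_0) E); rewrite !coefE /= !mulr0 !addr0.
  - by move: (congr1 (fun f : {poly R} => f`_1) E); rewrite !coefE /= !mulr0 mulr1 add0r addr0.
  - by move: (congr1 (fun f : {poly R} => f`_2) E); rewrite !coefE /= !mulr0 mulr1 !add0r.
have N_indep a b (j h : 'I_k) : j != h -> a != 0 -> a *: N j - b *: N h != 0.
  move=> jh a0; apply: contra_neq a0 => E.
  have [m [jm hm]] := exists_third k4 j h.
  have D := gon_det_neq0 k4 G jh hm jm.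
  have : det3 (a *: N j - b *: N h) (N h) (N m) = 0.
    by rewrite E /det3 /dot /cross !row3E !mxE; ring.
  have -> : det3 (a *: N j - b *: N h) (N h) (N m) = a * det3 (N j) (N h) (N m).
    by rewrite /det3 /dot /cross !row3E !mxE; ring.
  by move/eqP; rewrite mulf_eq0 (negbTE D) orbF => /eqP.
(* The first factor keeps [d] off the edge lines; the second makes the crossings of the line through
   [x] with any two edge lines distinct. *)
pose Q := (\prod_h q (N h)) * \prod_j \prod_(h | h != j) q (l h x *: N j - l j x *: N h).
have Q0 : Q != 0.
  rewrite /Q mulf_neq0 //.
    apply/prodf_neq0 => h _; apply: q0; have [a [ha _]] := exists_third k4 h h.
    have := N_indep 1 0 h a ha (oner_neq0 _).
    by rewrite scale1r scale0r subr0.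
  by apply/prodf_neq0 => j _; apply/prodf_neq0 => h hj; apply: q0; apply: N_indep; rewrite // eq_sym.
have [t] : exists t, Q.[t] != 0.
  apply: contrapT => nt; move/eqP: Q0; apply; apply: poly_eq0_of_horner => t.
  by apply/eqP/negPn/negP => ht; apply: nt; exists t.
rewrite hornerM mulf_eq0 negb_or => /andP[]; set d := row3 1 t (t ^+ 2).
rewrite horner_prod => /prodf_neq0 ld; rewrite horner_prod => /prodf_neq0 ljh.
have {}ld h : l h d != 0 by rewrite -qE; apply: ld.
have {}ljh j h : h != j -> l h x * l j d - l j x * l h d != 0.
  move=> hj; have := ljh j isT; rewrite horner_prod => /prodf_neq0 /(_ h hj).
  by rewrite qE -/d /dot !mxE; apply: contra_neq => <-; ring.
pose rs := [seq - l h x / l h d | h <- enum 'I_k].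
have sh h : l h (x + (- l h x / l h d) *: d) = 0.
  by rewrite dot_line mulfVK ?subrr.
have f0 : line_poly p x d = 0.
  apply/eqP/negPn/negP => fn0; have := max_poly_roots (rs := rs) fn0 _ _.
  have : (size (line_poly p x d) <= size rs)%N.
    by apply: (leq_trans (size_line_poly _ _ ph)); rewrite size_map size_enum_ord; lia.
  rewrite leqNgt => /negP sz H; apply: sz; apply: H.
    by apply/allP => _ /mapP[h _ ->]; apply/rootP; rewrite horner_line_poly (ev0 h).
  rewrite map_inj_uniq ?enum_uniq // => j h E; apply/eqP/negPn/negP => jh.
  have /eqP := ljh h j jh; apply; apply/eqP; rewrite subr_eq0 -eqr_opp -!mulNr.
  by rewrite -eqr_div ?ld // E.
by have := horner_line_poly p x d 0; rewrite f0 horner0 scale0r addr0.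
Qed.

End Adjoint.

(** * Signs at the crossings with the edges *)

Lemma sign_prod (R : realDomainType) (I : finType) (A : pred I) (y : I -> R) :
  (forall i, A i -> y i != 0) ->
  0 < (-1) ^+ #|[pred i | A i && (y i < 0)]| * \prod_(i | A i) y i.
Proof.
move=> y0; rewrite -prodr_const (eq_bigl (fun i => A i && (y i < 0))) //.
rewrite big_mkcondr -big_split /=; apply: prodr_gt0 => i Ai.
by case: (ltrgtP (y i) 0) (y0 i Ai) => // yi _; rewrite ?mulN1r ?mul1r ?oppr_gt0.
Qed.

Section Signs.
Variables (R : realType) (k : nat) (sg : R) (N V : 'I_k -> 'rV[R]_3) (p : mpoly 3 R).
Variable c : 'I_k -> R.
Hypotheses (k4 : (4 <= k)%N) (G : gon sg N V).
Local Notation l i x := (dot (N i) x).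
Implicit Types (i j h : 'I_k) (x : 'rV[R]_3).
Local Notation ev x := (meval (fun a : 'I_3 => x 0 a) p).
Hypothesis c0 : forall i, 0 < c i.
Hypothesis pc : forall i x, l i x = 0 -> ev x = c i * \prod_(j | nonadjacent i j) l j x.

Definition npos x := #|[pred h | 0 < l h x]|.
Definition nneg x := #|[pred h | l h x < 0]|.
Definition mixed x := (exists h, 0 < l h x) /\ (exists h, l h x < 0).

(* At a point of C_i where the edge forms take both signs, those of the two edges
   adjacent to E_i have opposite signs: this accounts for the minus sign.  At a
   residual point, [B] leaves out the other edge through it. *)
Lemma sign_cofactor i x (B : pred 'I_k) : l i x = 0 -> mixed x ->
  (forall h, h != i -> B h -> l h x != 0) -> (forall h, l h x < 0 -> B h) ->
  (forall h, ~~ nonadjacent i h -> B h) ->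
  0 < - ((-1) ^+ nneg x * \prod_(h | nonadjacent i h && B h) l h x).
Proof.
move=> lx [px nx] Bx nB adB; have [g gi] := ordS_surj i.
have [h1 h2 h3 h4] := ordS_neq g k4; have [h1' h2' h3' h4'] := ordS_neq i k4.
have mx := gon_mixed k4 G gi lx px nx.
have : 0 < (-1) ^+ #|[pred h | ((h != i) && B h) && (l h x < 0)]|
   * \prod_(h | (h != i) && B h) l h x.
  by apply: sign_prod => h /andP[hi hB]; apply: Bx.
have -> : #|[pred h | ((h != i) && B h) && (l h x < 0)]| = nneg x.
  apply: eq_card => h; rewrite !inE; case: (boolP (l h x < 0)) => hx; rewrite ?andbF //.
  by rewrite (nB h hx) !andbT; apply: contraTneq hx => ->; rewrite lx ltxx.
have nag : ~~ nonadjacent i g by rewrite /nonadjacent gi eqxx !andbF.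
have naS : ~~ nonadjacent i (ordS i) by rewrite /nonadjacent eqxx andbF.
rewrite (bigD1 g) /=; last by rewrite adB // gi eq_sym h1.
rewrite (bigD1 (ordS i)) /=; last by rewrite adB // h1' gi h2.
rewrite (eq_bigl (fun h => nonadjacent i h && B h)); last first.
  move=> h; rewrite /nonadjacent gi (inj_eq (@ordS_inj k)) (eq_sym g h) -gi.
  by case: (h == i); case: (h == ordS i); case: (h == g); case: (B h).
set P := \prod_(_ | _) _ => H; rewrite -(nmulr_rlt0 _ mx).
by rewrite mulrN oppr_lt0 mulrCA -mulrA.
Qed.

Lemma simple_sign i x : l i x = 0 -> mixed x -> (forall h, h != i -> l h x != 0) ->
  0 < - ((-1) ^+ nneg x * ev x).
Proof.
move=> lx mx nx; have := sign_cofactor (B := predT) lx mx (fun h hi _ => nx h hi) _ _.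
move=> /(_ (fun _ _ => isT) (fun _ _ => isT)) H.
rewrite (pc lx) mulrCA -mulrN pmulr_rgt0 //; move: H; congr (_ < - (_ * _)).
by apply: eq_bigl => h; rewrite andbT.
Qed.

(** Along the line of [i] the form is [c i] times a product in which only the factor of [j] vanishes
    at [x]. The derivative is therefore that of this factor, positive in direction [u], times the
    remaining product. *)
Lemma residual_sign_half i j x u : l i x = 0 -> l j x = 0 -> x != 0 -> mixed x ->
  nonadjacent i j -> l i u = 0 -> 0 < l j u ->
  0 < - ((-1) ^+ nneg x * (line_poly p x u)^`().[0]).
Proof.
move=> li lj x0 mx nij lu lju; have [ji _ _] := and3P nij.
pose g := \prod_(h | nonadjacent i h && (h != j)) ((l h x)%:P + l h u *: 'X).
have E : line_poly p x u = 'X * (c i * l j u *: g).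
  apply/eqP; rewrite -subr_eq0; apply/eqP; apply: poly_eq0_of_horner => s.
  rewrite hornerD hornerN horner_line_poly (pc (i := i)); last first.
    by rewrite dot_line li lu mulr0 addr0.
  rewrite (bigD1 j) //= hornerM hornerX hornerZ horner_prod dot_line lj add0r.
  rewrite (eq_bigr (fun h => ((l h x)%:P + l h u *: 'X).[s])); first by ring.
  by move=> h _; rewrite dot_line hornerD hornerC hornerZ hornerX mulrC.
rewrite E derivM derivX mul1r !(hornerD, hornerM, hornerX) mul0r addr0 hornerZ.
rewrite mulrCA -mulrN pmulr_rgt0 ?mulr_gt0 // horner_prod.
rewrite (eq_bigr (fun h => l h x)); last first.
  by move=> h _; rewrite hornerD hornerC hornerZ hornerX mulr0 addr0.
apply: sign_cofactor => // [h hi hj|h|h].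
- by apply: contra_neq x0 => lh; apply: (gon_indep k4 G (i := i) (j := j) (h := h)); rewrite // eq_sym.
- by apply: contraTneq => ->; rewrite lj ltxx.
- by apply: contraNneq => ->.
Qed.

Lemma residual_sign i j x e : l i x = 0 -> l j x = 0 -> x != 0 -> mixed x ->
  i != j -> 0 < l i e -> 0 < l j e ->
  0 < - ((-1) ^+ nneg x * (line_poly p x e)^`().[0]).
Proof.
move=> li lj x0 mx ij le je; have nij := mixed_nonadjacent k4 G ij li lj mx.1 mx.2.
have [ji jS iS] := and3P nij.
have pV : 0 < l j (V i) by apply: (gon_pos G).
(* Split e into u, along C_i, and e - u, along C_j. *)
pose u := (l j e / l j (V i)) *: V i.
have lju : l j u = l j e by rewrite dotZr mulfVK // gt_eqF.
have liu : l i u = 0 by rewrite dotZr (gon_0 G i).1 mulr0.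
have ljw : l j (e - u) = 0 by rewrite dotDr dotNr lju subrr.
have liw : l i (e - u) = l i e by rewrite dotDr dotNr liu subr0.
have := residual_sign_half li lj x0 mx nij liu; rewrite lju => /(_ je) H1.
have nji : nonadjacent j i by rewrite nonadjacentC.
have := residual_sign_half lj li x0 mx nji ljw; rewrite liw => /(_ le) H2.
have := addr_gt0 H1 H2; rewrite -opprD -mulrDr; congr (_ < - (_ * _)).
rewrite !deriv_line_poly -big_split /=; apply: eq_bigr => a _.
rewrite !scale0r -mulrDl; congr (_ * _).
by rewrite [(e - u) 0 a]mxE [(- u) 0 a]mxE addrCA subrr addr0.
Qed.

(** The form of [j] is positive at both ends of the edge [i], so its zero on that line has
    coefficients of opposite signs on the two vertices; the two edges adjacent to [i] then exhibit
    the two signs. *)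
Lemma nonadjacent_mixed i j x : nonadjacent i j -> x != 0 -> l i x = 0 -> l j x = 0 -> mixed x.
Proof.
move=> nij x0 li lj; have [ji jS iS] := and3P nij.
have [a [b E]] := edge_span k4 G li; have [g gi] := ordS_surj i.
have [h1 h2 h3 h4] := ordS_neq g k4; have [h1' h2' h3' h4'] := ordS_neq i k4.
have p1 : 0 < l j (V i) by apply: (gon_pos G); rewrite // eq_sym.
have p2 : 0 < l j (V (ordS i)) by apply: (gon_pos G); rewrite ?(inj_eq (@ordS_inj k)) eq_sym.
have q1 : 0 < l g (V (ordS i)) by apply: (gon_pos G); rewrite gi.
have q2 : 0 < l (ordS i) (V i) by apply: (gon_pos G); rewrite eq_sym.
have {}lj : a * l j (V i) + b * l j (V (ordS i)) = 0 by rewrite -!dotZr -dotDr -E.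
have lgx : l g x = b * l g (V (ordS i)) by rewrite E dotDr !dotZr {1}gi (gon_0 G g).2 mulr0 add0r.
have lSx : l (ordS i) x = a * l (ordS i) (V i).
  by rewrite E dotDr !dotZr (gon_0 G (ordS i)).1 mulr0 addr0.
have bE : b = - (a * l j (V i)) / l j (V (ordS i)).
  by apply: (mulIf (lt0r_neq0 p2)); rewrite mulfVK ?lt0r_neq0 //; apply/eqP; rewrite -subr_eq0 opprK addrC lj.
have a0 : a != 0.
  by apply: contra_neq x0 => a0; rewrite E bE a0 mul0r oppr0 mul0r !scale0r addr0.
case: (ltrgtP a 0) a0 => // a0 _; split.
- by exists g; rewrite lgx pmulr_lgt0 // bE divr_gt0 // oppr_gt0 pmulr_llt0.
- by exists (ordS i); rewrite lSx pmulr_llt0.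
- by exists (ordS i); rewrite lSx pmulr_lgt0.
- by exists g; rewrite lgx pmulr_llt0 // bE mulNr oppr_lt0 divr_gt0 // mulr_gt0.
Qed.

(** By [nonadjacent_mixed] no residual point has all its edge forms nonnegative, so the factors are
    strictly positive, even at a vertex. *)
Lemma boundary_pos i x : x != 0 -> l i x = 0 -> (forall h, 0 <= l h x) -> 0 < ev x.
Proof.
move=> x0 li nx; rewrite (pc li) mulr_gt0 //; apply: prodr_gt0 => j nij.
rewrite lt_neqAle nx andbT eq_sym; apply/eqP => lj.
by have [_ [h]] := nonadjacent_mixed nij x0 li lj; rewrite ltNge nx.
Qed.

End Signs.

(** * Roots along a line through an interior point *)

Lemma simple_root_sign (R : realType) (f : {poly R}) (x c : R) :
  f.[x] = 0 -> 0 < c * f^`().[x] ->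
  \forall u \near 0^'+, 0 < c * f.[x + u] /\ 0 < - (c * f.[x - u]).
Proof.
move=> /rootP /factor_theorem [g fE].
rewrite fE derivM hornerD !hornerM hornerXsubC subrr mulr0 add0r derivXsubC hornerC mulr1 => g0.
have : \forall y \near x, 0 < c * g.[y].
  have : (fun y => c * g.[y]) @ x --> c * g.[x].
    by apply: cvgM; [exact: cvg_cst|exact: continuous_horner].
  by move=> /cvgr_gt; apply.
move=> /nbhs_ballP[eps /= eps0 H].
near=> u.
have u0 : 0 < u by [].
have ue : u < eps by near: u; apply: nbhs_right_lt.
rewrite !hornerM !hornerXsubC (addrC x u) addrK (addrC x (- u)) addrK.
split; first by rewrite mulrA mulr_gt0 // H // /ball /= opprD addrCA subrr addr0 normrN gtr0_norm.
rewrite mulrA mulrN opprK mulr_gt0 // H // /ball /= opprD opprK addrCA subrr addr0 gtr0_norm.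
Unshelve. all: by end_near. Qed.

Lemma near_ordinal (T : Type) (F : set_system T) (P : T -> nat -> Prop) m : Filter F ->
  (forall a, (a < m)%N -> \forall u \near F, P u a) ->
  \forall u \near F, forall a, (a < m)%N -> P u a.
Proof.
move=> FF H; have : \forall u \near F, forall a : 'I_m, P u a.
  by apply: filter_forall => a; apply: H.
by apply: filterS => u h a am; apply: (h (Ordinal am)).
Qed.

Section Interlace.
Variables (R : realType) (k : nat) (sg : R) (N V : 'I_k -> 'rV[R]_3) (p : mpoly 3 R).
Variable c : 'I_k -> R.
Hypotheses (k4 : (4 <= k)%N) (G : gon sg N V) (ph : p \is ishomog1 (k - 3) mdeg).
Local Notation l i x := (dot (N i) x).
Implicit Types (i j h : 'I_k) (x : 'rV[R]_3).
Local Notation ev x := (meval (fun a : 'I_3 => x 0 a) p).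
Hypothesis c0 : forall i, 0 < c i.
Hypothesis pc : forall i x, l i x = 0 -> ev x = c i * \prod_(j | nonadjacent i j) l j x.
Variables (d e : 'rV[R]_3).
Hypotheses (e0 : forall h, 0 < l h e) (de : forall s, d + s *: e != 0).

Local Notation pt s := (d + s *: e).
Let f := line_poly p d e.
(** Parameter at which the line meets the edge line [h]; this hides the vector product of the same
    name. *)
Let cross h := - l h d / l h e.

Let lpt h s : l h (pt s) = l h e * (s - cross h).
Proof. by rewrite dot_line /cross; field; rewrite gt_eqF. Qed.

Let lpt_gt0 h s : (0 < l h (pt s)) = (cross h < s).
Proof. by rewrite lpt pmulr_rgt0 // subr_gt0. Qed.

Let lpt_lt0 h s : (l h (pt s) < 0) = (s < cross h).
Proof. by rewrite lpt pmulr_rlt0 // subr_lt0. Qed.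

Let lpt_eq0 h s : l h (pt s) = 0 <-> s = cross h.
Proof.
rewrite lpt; split=> [/eqP|->]; last by rewrite subrr mulr0.
by rewrite mulf_eq0 (gt_eqF (e0 h)) /= subr_eq0 => /eqP.
Qed.

Let i0 : 'I_k := Ordinal (leq_trans (isT : (0 < 4)%N) k4).
Let L := sort (fun i j => cross i <= cross j) (enum 'I_k).
Let idx a := nth i0 L a.
Let t a := cross (idx a).

Let sizeL : size L = k. Proof. by rewrite size_sort size_enum_ord. Qed.

Let idx_inj a b : (a < k)%N -> (b < k)%N -> idx a = idx b -> a = b.
Proof.
move=> ak bk /eqP; rewrite nth_uniq ?sizeL // ?sort_uniq ?enum_uniq // => /eqP //.
Qed.

Let idx_surj h : exists2 a, (a < k)%N & idx a = h.
Proof.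
have /(nthP i0)[a] : h \in L by rewrite mem_sort mem_enum.
by rewrite sizeL => ak <-; exists a.
Qed.

Let t_mono a b : (a <= b)%N -> (b < k)%N -> t a <= t b.
Proof.
move=> ab bk; have ak := leq_ltn_trans ab bk.
apply: (sorted_leq_nth (leT := fun i j => cross i <= cross j)) => //; rewrite ?inE ?sizeL //.
- by move=> ? ? ?; apply: le_trans.
- by apply: sort_sorted => i j; apply: le_total.
Qed.

Let cardL (P : pred 'I_k) : #|P| = count (fun a => P (idx a)) (iota 0 k).
Proof.
rewrite cardE /enum_mem size_filter -enumT.
rewrite (_ : count (mem P) _ = count P L); last by rewrite count_sort.
by rewrite -[in LHS](mkseq_nth i0 L) sizeL count_map.
Qed.

Let count_iota (P : pred nat) a : (a <= k)%N -> (forall b, (b < a)%N -> P b) ->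
  (forall b, (a <= b)%N -> (b < k)%N -> ~~ P b) -> count P (iota 0 k) = a.
Proof.
move=> ak h1 h2; rewrite -(subnKC ak) iotaD count_cat add0n.
rewrite (eq_in_count (a2 := predT)) ?count_predT ?size_iota; last first.
  by move=> b; rewrite mem_iota add0n => /andP[_ ba]; apply: h1.
rewrite (eq_in_count (a2 := pred0)) ?count_pred0 ?addn0 //.
move=> b; rewrite mem_iota subnKC // => /andP[ab bk]; exact/negbTE/h2.
Qed.

Let npos_pt a s : (a <= k)%N -> (forall b, (b < a)%N -> t b < s) ->
  (forall b, (a <= b)%N -> (b < k)%N -> s <= t b) -> npos N (pt s) = a.
Proof.
move=> ak h1 h2; rewrite /npos cardL; apply: count_iota => // b; rewrite inE lpt_gt0.
  exact: h1.
by move=> ab bk; rewrite -leNgt; apply: h2.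
Qed.

Let nneg_pt a s : (a <= k)%N -> (forall b, (b < a)%N -> t b <= s) ->
  (forall b, (a <= b)%N -> (b < k)%N -> s < t b) -> nneg N (pt s) = (k - a)%N.
Proof.
move=> ak h1 h2; rewrite /nneg cardL; apply/eqP; rewrite -(eqn_add2l a) subnKC //; apply/eqP.
rewrite -[X in (X + _)%N](count_iota (P := fun b => (b < a)%N) ak) // => [|b]; last by rewrite -leqNgt.
rewrite -[RHS](size_iota 0) -(count_predC (fun b => (b < a)%N)); congr (_ + _)%N.
apply: eq_in_count => b; rewrite mem_iota add0n => /andP[_ bk].
rewrite inE lpt_lt0 /= -leqNgt; case: leqP => ab; first exact: h2.
by apply/negbTE; rewrite -leNgt; apply: h1.
Qed.

(** Three equal crossings would put the nonzero vector [pt (t a)] on three edge lines. Hence ties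
    among the sorted crossings are at most double. *)
Let t_triple a : (a.+2 < k)%N -> t a < t a.+2.
Proof.
move=> ak; rewrite lt_neqAle t_mono ?andbT; try lia.
apply/eqP => E; have E1 : t a.+1 = t a.
  by apply/eqP; rewrite eq_le {1}E !t_mono //; lia.
have /eqP := de (t a); apply.
apply: (gon_indep k4 G (i := idx a) (j := idx a.+1) (h := idx a.+2)).
- by apply/eqP => /idx_inj; lia.
- by apply/eqP => /idx_inj; lia.
- by apply/eqP => /idx_inj; lia.
- exact/lpt_eq0.
- exact/lpt_eq0.
- exact/lpt_eq0.
Qed.

Let mixed_pt a b s : (a < k)%N -> (b < k)%N -> t a < s -> s < t b -> mixed N (pt s).
Proof.
by move=> ak bk ta tb; split; [exists (idx a); rewrite lpt_gt0|exists (idx b); rewrite lpt_lt0].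
Qed.

Let f_pt s : f.[s] = ev (pt s). Proof. exact: horner_line_poly. Qed.

Let df_pt s : f^`().[s] = (line_poly p (pt s) e)^`().[0].
Proof. by rewrite !deriv_line_poly; under [RHS]eq_bigr do rewrite scale0r addr0. Qed.

(* The form changes sign at a double crossing t a = t a.+1, which is therefore
   replaced by two test points at distance u on both sides; the form alternates in
   sign at the test points [z u 1], ..., [z u (k - 2)]. *)
Let dl a := (a.+1 <= k - 2)%N && (t a == t a.+1).
Let dr a := (1 < a)%N && (t a == t a.-1).
(** The bounds in [dl] and [dr] leave unsplit a tie with the first or the last crossing: the line
    then passes through a vertex, where the form does not vanish, and the crossing itself serves as
    test point. *)
Let z u a := t a - u *+ dl a + u *+ dr a.

Let signE m (y : R) : (0 < (-1) ^+ m.+1 * y) = (0 < - ((-1) ^+ m * y)).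
Proof. by rewrite exprS mulN1r mulNr. Qed.

(** At a simple crossing the [k - a.+1] later forms are negative and the earlier ones positive, and
    [simple_sign] changes the parity by one. At a split tie the form vanishes and [residual_sign]
    gives the sign of its slope, hence its signs on both sides. At a vertex [boundary_pos]
    decides. *)
Let z_sign a : (1 <= a)%N -> (a <= k - 2)%N ->
  \forall u \near 0^'+, 0 < (-1) ^+ (k - 2 - a) * f.[z u a].
Proof.
move=> a1 ak.
have tl := t_mono (leq_pred a); have tr := t_mono (leqnSn a).
have ta b : (b < a)%N -> t b <= t a.-1 by move=> ba; apply: t_mono; lia.
have tb b : (a < b)%N -> (b < k)%N -> t a.+1 <= t b by move=> ab bk; apply: t_mono.
have fa0 : l (idx a) (pt (t a)) = 0 by apply/lpt_eq0.
case: (eqVneq (t a) (t a.+1)) => [Er|Nr].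
  have Ll : t a.-1 < t a.
    by have := @t_triple a.-1; rewrite prednK // -Er; apply; lia.
  have dra : dr a = false by rewrite /dr [t a == _]gt_eqF ?andbF.
  case: (ltnP a (k - 2)) => ak2.
    have dla : dl a by rewrite /dl Er eqxx andbT.
    have Lr : t a.+1 < t a.+2 by rewrite -Er; apply: t_triple; lia.
    have mx : mixed N (pt (t a)) by apply: (@mixed_pt a.-1 a.+2) => //; try lia; rewrite Er.
    have ne : idx a != idx a.+1 by apply/eqP => /idx_inj; lia.
    have fS0 : l (idx a.+1) (pt (t a)) = 0 by apply/lpt_eq0.
    have na : nneg N (pt (t a)) = (k - 2 - a)%N.
      rewrite (_ : (k - 2 - a)%N = (k - a.+2)%N); last by lia.
      apply: nneg_pt.
      - by lia.
      - move=> b; rewrite ltnS leq_eqVlt => /orP[/eqP->|]; rewrite ?Er // => ba.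
        by rewrite -Er; apply: t_mono; lia.
      - by move=> b h1 h2; apply: (lt_le_trans _ (t_mono h1 h2)); rewrite Er.
    have := residual_sign k4 G c0 pc fa0 fS0 (de _) mx ne (e0 _) (e0 _).
    rewrite -df_pt na -mulNr => D.
    have f0 : f.[t a] = 0.
      rewrite f_pt (pc fa0) (bigD1 (idx a.+1)) /= ?fS0 ?mul0r ?mulr0 //.
      exact: (mixed_nonadjacent k4 G ne fa0 fS0 mx.1 mx.2).
    have := simple_root_sign f0 D; apply: filterS => u [_].
    by rewrite /z dla dra mulr1n mulr0n addr0 mulNr opprK.
  (* Tie with the last crossing: the point is a vertex of the polygon, with all edge forms
     nonnegative. *)
  have aE : a = (k - 2)%N by lia.
  near=> u; rewrite /z dra /dl ltnNge ak2 /= !mulr0n subr0 addr0 f_pt.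
  rewrite aE subnn expr0 mul1r -aE; apply: (boundary_pos k4 G c0 pc (i := idx a)) => // h.
  have [b bk <-] := idx_surj h; rewrite leNgt lpt_lt0 -leNgt -/(t b).
  by rewrite Er; apply: t_mono; lia.
have {}Nr : t a < t a.+1 by rewrite lt_neqAle Nr tr; lia.
have dla : dl a = false by rewrite /dl lt_eqF ?andbF.
case: (eqVneq (t a) (t a.-1)) => [El|Nl].
  have na : nneg N (pt (t a)) = (k - a.+1)%N.
    apply: nneg_pt => [|b|b h1 h2]; first lia.
      by rewrite ltnS => ba; apply: t_mono; lia.
    by apply: (lt_le_trans Nr); apply: t_mono.
  case: (ltnP 1 a) => a2.
    have dra : dr a by rewrite /dr El eqxx andbT.
    have Ll : t a.-2 < t a.
      by have := @t_triple a.-2; rewrite (_ : a.-2.+2 = a); [apply|]; lia.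
    have mx : mixed N (pt (t a)) by apply: (@mixed_pt a.-2 a.+1) => //; lia.
    have ne : idx a != idx a.-1 by apply/eqP => /idx_inj; lia.
    have fS0 : l (idx a.-1) (pt (t a)) = 0 by apply/lpt_eq0.
    have := residual_sign k4 G c0 pc fa0 fS0 (de _) mx ne (e0 _) (e0 _).
    rewrite -df_pt na -signE (_ : (k - a.+1).+1 = (k - 2 - a).+2); last by lia.
    rewrite !exprS mulrA mulrNN mul1r mul1r => D.
    have f0 : f.[t a] = 0.
      rewrite f_pt (pc fa0) (bigD1 (idx a.-1)) /= ?fS0 ?mul0r ?mulr0 //.
      exact: (mixed_nonadjacent k4 G ne fa0 fS0 mx.1 mx.2).
    have := simple_root_sign f0 D; apply: filterS => u [+ _].
    by rewrite /z dla dra mulr1n mulr0n subr0.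
  (* Tie with the first crossing: the opposite vector represents a vertex, and homogeneity turns the
     positive value there into the sign $(-1)^{k-3}$. *)
  have aE : a = 1%N by lia.
  near=> u; rewrite /z /dr dla ltnNge a2 /= !mulr0n subr0 addr0 f_pt.
  have -> : (k - 2 - a = k - 3)%N by lia.
  rewrite -(meval_homog _ _ ph) scaleN1r.
  apply: (boundary_pos k4 G c0 pc (i := idx a)); rewrite ?oppr_eq0 ?dotNr ?fa0 ?oppr0 // => h.
  have [b bk <-] := idx_surj h; rewrite dotNr oppr_ge0 leNgt lpt_gt0 -leNgt -/(t b).
  by rewrite El; apply: t_mono; lia.
have {}Nl : t a.-1 < t a by rewrite lt_neqAle eq_sym Nl tl; lia.
have dra : dr a = false by rewrite /dr gt_eqF ?andbF.
near=> u; rewrite /z dla dra !mulr0n subr0 addr0 f_pt.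
have mx : mixed N (pt (t a)) by apply: (@mixed_pt a.-1 a.+1) => //; lia.
have na : nneg N (pt (t a)) = (k - a.+1)%N.
  apply: nneg_pt; first by lia.
  - by move=> b; rewrite ltnS => ba; apply: t_mono; lia.
  - by move=> b h1 h2; apply: (lt_le_trans Nr); apply: t_mono.
have := simple_sign k4 G c0 pc fa0 mx _.
rewrite na -signE (_ : (k - a.+1).+1 = (k - 2 - a).+2); last by lia.
rewrite !exprS mulrA mulrNN mul1r mul1r; apply.
move=> h; have [b bk <-] := idx_surj h => ne; apply/eqP => /lpt_eq0 E.
have {}E : t a = t b by [].
case: (ltngtP a b) ne => [ab|ba|->]; last by rewrite eqxx.
  by have := tb b ab bk; rewrite leNgt -E Nr.
by have := ta b ba; rewrite leNgt -E Nl.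
Unshelve. all: by end_near. Qed.

Let z_lt a : (1 <= a)%N -> (a.+1 <= k - 2)%N ->
  \forall u \near 0^'+, z u a < z u a.+1.
Proof.
move=> a1 ak; case: (eqVneq (t a) (t a.+1)) => [E|ne].
  have dla : dl a by rewrite /dl ak E eqxx.
  have drS : dr a.+1 by rewrite /dr /= ltnS a1 E eqxx.
  have dra : dr a = false.
    apply/negbTE/negP => /andP[a2 /eqP Ea].
    by have := @t_triple a.-1; rewrite prednK // -E -Ea ltxx; lia.
  have dlS : dl a.+1 = false.
    apply/negbTE/negP => /andP[a2 /eqP Ea].
    by have := @t_triple a; rewrite -Ea -E ltxx; lia.
  near=> u; rewrite /z dla dra dlS drS !mulr1n !mulr0n addr0 subr0 -E.
  have u0 : 0 < u by [].
  by rewrite (lt_trans (y := t a)) // ?ltrDl // gtrBl.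
have lt_t : t a < t a.+1 by rewrite lt_neqAle ne t_mono //; lia.
near=> u.
have u0 : 0 < u by [].
have us : u < (t a.+1 - t a) / 2 by near: u; apply: nbhs_right_lt; rewrite divr_gt0 // subr_gt0.
have -> : z u a = t a + u *+ dr a.
  by rewrite /z /dl (negbTE ne) andbF mulr0n subr0.
have -> : z u a.+1 = t a.+1 - u *+ dl a.+1.
  by rewrite /z /dr eq_sym (negbTE ne) andbF mulr0n addr0.
by case: (dl _); case: (dr _); rewrite ?mulr1n ?mulr0n; lra.
Unshelve. all: by end_near. Qed.

Let z_top : \forall u \near 0^'+, z u (k - 2) <= t k.-1.
Proof.
have dlk : dl (k - 2) = false by rewrite /dl ltnn.
have le_t : t (k - 2) <= t k.-1 by apply: t_mono; lia.
case: (boolP (dr (k - 2))) => drk; last first.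
  by near=> u; rewrite /z dlk (negbTE drk) !mulr0n subr0 addr0.
have lt_t : t (k - 2) < t k.-1.
  case/andP: (drk) => k5 /eqP ->; have := @t_triple (k - 2).-1.
  by rewrite (_ : (k - 2).-1.+2 = k.-1); [apply|]; lia.
near=> u; rewrite /z dlk drk mulr0n mulr1n subr0 -lerBrDl.
by apply: ltW; near: u; apply: nbhs_right_lt; rewrite subr_gt0.
Unshelve. all: by end_near. Qed.

(** The [k - 2] test points give [k - 3] sign changes, as many as the degree, so the roots between
    them are all the roots and the restriction splits, with top coefficient the value at [e]. For a
    double crossing [s], [npos] counts the crossings below it. The two test points obtained by
    splitting it enclose exactly one root, which is therefore [s], of index [npos] minus one. *)
Lemma interlace : exists r : nat -> R,
  [/\ forall a b, (a < b)%N -> (b < k - 3)%N -> r a < r b,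
     forall s, ev (pt s) = ev e * \prod_(a < k - 3) (s - r a),
     0 < ev e,
     forall s, (forall h, 0 <= l h (pt s)) -> forall a, (a < k - 3)%N -> r a < s
   & forall i j s, nonadjacent i j -> l i (pt s) = 0 -> l j (pt s) = 0 ->
       (0 < npos N (pt s) <= k - 3)%N /\ s = r (npos N (pt s)).-1].
Proof.
have [u [zs zl zt u0]] : exists u, [/\
    forall a, (a < k - 2)%N -> 0 < (-1) ^+ (k - 3 - a) * f.[z u a.+1],
    forall a, (a < k - 3)%N -> z u a.+1 < z u a.+2, z u (k - 2) <= t k.-1 & 0 < u].
  have H1 : \forall u \near 0^'+, forall a, (a < k - 2)%N ->
      0 < (-1) ^+ (k - 3 - a) * f.[z u a.+1].
    apply: near_ordinal => a ak; rewrite (_ : (k - 3 - a = k - 2 - a.+1)%N); last by lia.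
    by apply: z_sign; lia.
  have H2 : \forall u \near 0^'+, forall a, (a < k - 3)%N -> z u a.+1 < z u a.+2.
    by apply: near_ordinal => a ak; apply: z_lt; lia.
  have : \forall u \near 0^'+, [/\ forall a, (a < k - 2)%N -> 0 < (-1) ^+ (k - 3 - a) * f.[z u a.+1],
    forall a, (a < k - 3)%N -> z u a.+1 < z u a.+2, z u (k - 2) <= t k.-1 & 0 < u].
    near=> u; split; [by near: u|by near: u|by near: u; exact: z_top|by []].
  by move=> /filter_ex.
have k32 : (k - 3 < k - 2)%N by clear -k4; lia.
have z_mono a b : (a < b)%N -> (b < k - 2)%N -> z u a.+1 < z u b.+1.
  elim: b => // b IHb; rewrite ltnS leq_eqVlt => /orP[/eqP -> bk|ab bk]; first by apply: zl; lia.
  by apply: (lt_trans (IHb ab _)); [lia|apply: zl; lia].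
have root_ex a : exists r, (a < k - 3)%N -> [/\ z u a.+1 < r, r < z u a.+2 & f.[r] = 0].
  case: (ltnP a (k - 3)) => ak; last by exists 0.
  have p1 := zs a (ltac:(lia)); have p2 := zs a.+1 (ltac:(lia)).
  have zz := zl a ak.
  have [|r] := @poly_ivtoo _ f _ _ (ltW zz).
    rewrite -oppr_gt0; have := mulr_gt0 p1 p2.
    rewrite (_ : (k - 3 - a = (k - 3 - a.+1).+1)%N); last by lia.
    by rewrite mulrACA exprS -(mulrA (-1)) -expr2 sqrr_sign mulr1 mulN1r.
  by rewrite in_itv /= => /andP[h1 h2] /rootP h3; exists r.
have {root_ex} [r rE] := choice root_ex.
have r_mono a b : (a < b)%N -> (b < k - 3)%N -> r a < r b.
  move=> ab bk; have [_ h1 _] := rE a (ltn_trans ab bk); have [h2 _ _] := rE b bk.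
  apply: (lt_trans h1); apply: (le_lt_trans _ h2).
  case: (ltngtP a.+1 b) ab => // [ab _|-> //]; by apply/ltW/z_mono; lia.
pose rs := [seq r a | a <- iota 0 (k - 3)].
have srs : size rs = (k - 3)%N by rewrite size_map size_iota.
have urs : uniq rs.
  rewrite map_inj_in_uniq ?iota_uniq // => a b; rewrite !mem_iota !add0n => /= ak bk E.
  by case: (ltngtP a b) => // ab; have := r_mono _ _ ab _; rewrite E ltxx => /(_ ltac:(lia)).
have rrs : all (root f) rs.
  apply/allP => y /mapP[a]; rewrite mem_iota add0n => /= ak ->.
  by apply/rootP; have [_ _] := rE a ak.
have fE s : ev (pt s) = ev e * \prod_(a < k - 3) (s - r a).
  rewrite -f_pt (poly_factor urs rrs) ?srs ?size_line_poly //.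
  rewrite hornerZ (coef_line_poly _ _ ph) horner_prod big_map.
  rewrite -[X in iota 0 X]subn0 -/(index_iota 0 (k - 3)) big_mkord.
  by congr (_ * _); apply: eq_bigr => a _; rewrite hornerXsubC.
have r_top a : (a < k - 3)%N -> r a < z u (k - 2).
  move=> ak; have [_ h _] := rE a ak; apply: (lt_le_trans h).
  case: (ltngtP a.+1 (k - 3)) ak => // [ak _|-> _]; last by rewrite (_ : (k - 3).+1 = (k - 2)%N) //; lia.
  by apply/ltW; rewrite (_ : (k - 2)%N = (k - 3).+1); [apply: z_mono|]; lia.
exists r; split=> //.
- have := zs (k - 3)%N k32; rewrite subnn expr0 mul1r (_ : (k - 3).+1 = (k - 2)%N); last by lia.
  rewrite f_pt fE pmulr_lgt0 //; apply: prodr_gt0 => a _; rewrite subr_gt0; exact: r_top.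
- move=> s hs a ak; apply: (lt_le_trans (r_top a ak)); apply: (le_trans zt).
  by have := hs (idx k.-1); rewrite leNgt lpt_lt0 -leNgt.
move=> i j s nij li lj.
have mx := nonadjacent_mixed k4 G nij (de s) li lj.
have [a [ak [ta tS]]] : exists a, (a.+1 < k)%N /\ t a = s /\ t a.+1 = s.
  have [ji _ _] := and3P nij; have [a ak ai] := idx_surj i; have [b bk bj] := idx_surj j.
  have ta : t a = s by rewrite /t ai; apply/esym/lpt_eq0.
  have tb : t b = s by rewrite /t bj; apply/esym/lpt_eq0.
  case: (ltngtP a b) => ab; last by rewrite -ai -bj ab eqxx in ji.
    exists a; split; first by clear -ab bk; lia.
    split=> //; apply/eqP; rewrite eq_le; apply/andP; split.
      by rewrite -tb; apply: t_mono.
    by rewrite -ta; apply: t_mono; clear -ab bk; lia.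
  exists b; split; first by clear -ab ak; lia.
  split=> //; apply/eqP; rewrite eq_le; apply/andP; split.
    by rewrite -ta; apply: t_mono.
  by rewrite -tb; apply: t_mono; clear -ab ak; lia.
(* Both signs occur at the point, so the tie involves neither the first nor the last crossing and
   has been split. *)
have a0 : (0 < a)%N.
  rewrite lt0n; apply/eqP => a0; have [h] := mx.1; rewrite lpt_gt0.
  by have [b bk <-] := idx_surj h; rewrite -/(t b) ltNge -ta a0 t_mono.
have ak2 : (a.+1 <= k - 2)%N.
  rewrite leqNgt; apply/negP => ak2; have [h] := mx.2; rewrite lpt_lt0.
  by have [b bk <-] := idx_surj h; rewrite -/(t b) ltNge -tS t_mono //; lia.
have na : npos N (pt s) = a.
  apply: npos_pt => [|b ba|b ab bk]; first lia.
    rewrite -ta; have := @t_triple a.-1; rewrite prednK // tS => H.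
    by apply: (le_lt_trans (t_mono (_ : b <= a.-1)%N _)); rewrite ?ta ?H //; clear -ba ak2; lia.
  by rewrite -ta; apply: t_mono.
rewrite na; split; first lia.
have dla : dl a by rewrite /dl ak2 ta tS eqxx.
have drS : dr a.+1 by rewrite /dr /= ltnS a0 ta tS eqxx.
have za : z u a < s.
  rewrite /z dla mulr1n ta (_ : dr a = false) ?mulr0n ?addr0 ?gtrBl //.
  apply/negbTE/negP => /andP[a2 /eqP Ea].
  by have := @t_triple a.-1; rewrite prednK // -Ea ta tS ltxx; clear -ak2; lia.
have zS : s < z u a.+1.
  rewrite /z drS mulr1n tS (_ : dl a.+1 = false) ?mulr0n ?subr0 ?ltrDl //.
  apply/negbTE/negP => /andP[a2 /eqP Ea].
  by have := @t_triple a; rewrite -Ea ta tS ltxx; clear -ak2; lia.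
have : f.[s] = 0.
  by rewrite f_pt (pc li) (bigD1 j) //= lj mul0r mulr0.
rewrite f_pt fE => /eqP; rewrite mulf_eq0 => /orP[/eqP ev0|].
  have := zs (k - 3)%N k32.
  by rewrite f_pt fE ev0 mul0r mulr0 ltxx.
move=> /prodf_eq0[b _]; rewrite subr_eq0 => /eqP sE.
have [h1 h2 _] := rE b (ltn_ord b); rewrite sE; congr (r _).
have bk := ltn_ord b.
apply/eqP; case: (ltngtP (nat_of_ord b) a.-1) => // ba; exfalso.
- have : z u b.+2 <= z u a.
    have : (b.+2 <= a)%N by clear -ba; lia.
    rewrite leq_eqVlt => /orP[/eqP -> //|ba2].
    rewrite -[in X in _ <= X](prednK a0); apply/ltW/z_mono; [clear -ba2|clear -ak2]; lia.
  by move=> H; have := lt_trans (lt_le_trans h2 H) za; rewrite sE ltxx.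
- have : z u a.+1 <= z u b.+1.
    have : (a <= b)%N by clear -ba; lia.
    rewrite leq_eqVlt => /orP[/eqP -> //|ba2].
    by apply/ltW/z_mono => //; clear -bk; lia.
  by move=> H; have := lt_trans zS (le_lt_trans H h1); rewrite sE ltxx.
Unshelve. all: by end_near. Qed.

End Interlace.

(** * Topology of the projective plane *)

Local Open Scope quotient_scope.

Section ProjectivePlane.
Variable R : realType.
Implicit Types (u v w : 'rV[R]_3) (x : P2 R).

(* The point with homogeneous coordinates v, with a junk value at v = 0. *)
Definition toP v : P2 R :=
  if pselect (v \in [set w : 'rV[R]_3 | w != 0]) is left h
  then \pi_(P2 R) (exist _ v h) else affine 0.

Lemma toPE v (h : v \in [set w : 'rV[R]_3 | w != 0]) : toP v = \pi_(P2 R) (exist _ v h).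
Proof.
rewrite /toP; case: pselect => // h'; congr (\pi_(P2 R) _).
exact: val_inj.
Qed.

Lemma hc_neq0 x : hc x != 0.
Proof. by have := valP (repr x : nzvec R); rewrite inE. Qed.

Lemma hcK x : toP (hc x) = x.
Proof.
have h : hc x \in [set w : 'rV[R]_3 | w != 0] by rewrite inE /= hc_neq0.
rewrite (toPE h) -[RHS]reprK; congr (\pi_(P2 R) _).
exact: val_inj.
Qed.

Lemma affineE p : affine p = toP (homogenize p).
Proof. by rewrite (toPE (homogenize_neq0 p)). Qed.

Lemma eq_pi (a b : nzvec R) :
  (\pi_(P2 R) a = \pi_(P2 R) b) <-> (val a == val b)%MS.
Proof.
by split=> [/eqquotP|h]; last apply/eqquotP.
Qed.

Lemma eq_toP u v : u != 0 -> v != 0 -> toP u = toP v <-> exists2 c, c != 0 & u = c *: v.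
Proof.
move=> u0 v0.
have hu : u \in [set w : 'rV[R]_3 | w != 0] by rewrite inE.
have hv : v \in [set w : 'rV[R]_3 | w != 0] by rewrite inE.
rewrite (toPE hu) (toPE hv) eq_pi /=; split.
  move=> /andP[/sub_rVP[c E] _]; exists c => //.
  by apply: contra_neq u0 => c0; rewrite E c0 scale0r.
move=> [c c0 ->]; apply/andP; split; first by rewrite scalemx_sub.
by rewrite -{1}[v]scale1r -(mulVf c0) -scalerA scalemx_sub.
Qed.

Lemma toPZ c v : c != 0 -> toP (c *: v) = toP v.
Proof.
move=> c0; case: (eqVneq v 0) => [->|v0]; first by rewrite scaler0.
by apply/eq_toP => //; [rewrite scaler_eq0 negb_or c0|exists c].
Qed.

Lemma hc_toP v : v != 0 -> exists2 c, c != 0 & hc (toP v) = c *: v.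
Proof. by move=> v0; apply/eq_toP; rewrite ?hc_neq0 ?hcK. Qed.

Lemma open_neq0 : open [set w : 'rV[R]_3 | w != 0].
Proof.
have -> : [set w : 'rV[R]_3 | w != 0] = ~` [set 0].
  by rewrite predeqE => w; split=> /eqP.
apply: closed_openC; apply: accessible_closed_set1; apply: hausdorff_accessible.
exact: norm_hausdorff.
Qed.

Lemma nbhs_neq0 v : v != 0 -> \forall w \near v, w != 0.
Proof. by move=> v0; apply: open_nbhs_nbhs; split=> //; apply: open_neq0. Qed.

(** The quotient map is open: the preimage of the image of [O] is the union of the rescalings of
    [O]. Limits on the projective plane can therefore be computed on vectors. *)
Lemma nbhs_toP v (A : set (P2 R)) : v != 0 ->
  nbhs (toP v) A <-> nbhs v [set w | A (toP w)].
Proof.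
move=> v0; split.
  rewrite nbhsE => -[U [oU Uv] UA]; case: (oU) => O oO OE.
  rewrite nbhsE; exists (O `&` [set w | w != 0]).
    split; last split => //.
    - by apply: openI => //; apply: open_neq0.
    - have hv : v \in [set w : 'rV[R]_3 | w != 0] by rewrite inE.
      by move: Uv; rewrite (toPE hv) -[U _]/((\pi_(P2 R) @^-1` U) _) -OE.
  move=> w [Ow /= w0]; apply: UA; have hw : w \in [set w : 'rV[R]_3 | w != 0] by rewrite inE.
  by rewrite (toPE hw) -[U _]/((\pi_(P2 R) @^-1` U) _) -OE.
rewrite nbhsE => -[O [oO Ov] OA].
pose U : set (P2 R) := [set x | exists w, [/\ O w, w != 0 & toP w = x]].
rewrite nbhsE; exists U; last by move=> x [w [Ow w0 <-]]; apply: OA.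
split; last by exists v.
rewrite /open /= /quotient_open.
pose O' := \bigcup_(c in [set c : R | c != 0]) [set w | O (c *: w)].
exists O'.
  apply: bigcup_open => c c0; apply: (open_comp (f := fun w => c *: w)) => // w _.
  exact: scaler_continuous.
rewrite predeqE => -[y hy]; rewrite /O' /U /=.
have y0 : y != 0 by move: (hy); rewrite inE.
rewrite /set_val /= -(toPE hy); split.
  by move=> [c c0 Oc]; exists (c *: y); rewrite scaler_eq0 negb_or c0 y0 toPZ.
move=> [w [Ow w0]] /eq_toP => /(_ w0 y0) [c c0 wE].
by exists c => //; rewrite wE in Ow.
Qed.

Lemma cvg_toP (T : topologicalType) (f : P2 R -> T) v (F : set_system T) : v != 0 ->
  f @ nbhs (toP v) --> F <-> (fun w => f (toP w)) @ nbhs v --> F.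
Proof.
move=> v0; split=> h A /h /=.
  by move=> /(nbhs_toP _ v0).
by move=> H; apply/(nbhs_toP _ v0).
Qed.

Lemma toP_continuous v : v != 0 -> {for v, continuous toP}.
Proof. by move=> v0 A /(nbhs_toP _ v0). Qed.

Lemma open_hc (Q : 'rV[R]_3 -> Prop) :
  (forall c v, c != 0 -> v != 0 -> Q v -> Q (c *: v)) ->
  (forall v, v != 0 -> Q v -> \forall w \near v, Q w) ->
  open [set x | Q (hc x)].
Proof.
move=> Qs Qn; rewrite openE => x /= Qx; rewrite /interior -(hcK x).
apply/nbhs_toP; first exact: hc_neq0.
near=> w => /=.
have w0 : w != 0 by near: w; apply: nbhs_neq0; apply: hc_neq0.
have [c c0 ->] := hc_toP w0; apply: Qs => //.
by near: w; apply: Qn => //; apply: hc_neq0.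
Unshelve. all: by end_near. Qed.

(** [hc] selects an arbitrary representative, so what is said through it can be read at [v] only if
    it is insensitive to scaling. *)
Lemma hc_toPP (Q : 'rV[R]_3 -> Prop) v : v != 0 ->
  (forall c v, c != 0 -> v != 0 -> Q v -> Q (c *: v)) -> Q (hc (toP v)) <-> Q v.
Proof.
move=> v0 Qs; have [c c0 ->] := hc_toP v0; split; last exact: Qs.
move=> /(Qs c^-1 (c *: v)); rewrite scalerA mulVf // scale1r; apply.
  by rewrite invr_eq0.
by rewrite scaler_eq0 negb_or c0.
Qed.

End ProjectivePlane.

Local Close Scope quotient_scope.

Section Connectedness.
Variable T : topologicalType.
Implicit Types A B U W S : set T.

Lemma connected_sub_open U W B : open U -> open W -> U `&` W = set0 ->
  connected B -> B `<=` U `|` W -> B `&` U !=set0 -> B `<=` U.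
Proof.
move=> oU oW UW cB BUW [x [Bx Ux]].
have disj y : U y -> W y -> False by move=> Uy Wy; have : set0 y by rewrite -UW.
rewrite -(cB (B `&` U)); first by move=> y [].
- by exists x.
- by exists U.
- exists (~` W); first exact: open_closedC.
  rewrite predeqE => y; split=> -[By]; first by move=> Uy; split=> // Wy; apply: disj Wy.
  by move=> nWy; split=> //; case: (BUW y By).
Qed.

Lemma connected_sub_closed U W B : closed U -> closed W -> U `&` W = set0 ->
  connected B -> B `<=` U `|` W -> B `&` U !=set0 -> B `<=` U.
Proof.
move=> cU cW UW cB BUW [x [Bx Ux]].
have disj y : U y -> W y -> False by move=> Uy Wy; have : set0 y by rewrite -UW.
rewrite -(cB (B `&` U)); first by move=> y [].
- by exists x.
- exists (~` W); first exact: closed_openC.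
  rewrite predeqE => y; split=> -[By]; first by move=> Uy; split=> // Wy; apply: disj Wy.
  by move=> nWy; split=> //; case: (BUW y By).
- by exists U.
Qed.

Lemma connected_component_eq A U x : U x -> connected U -> U `<=` A ->
  (forall B, connected B -> B `<=` A -> B `&` U !=set0 -> B `<=` U) ->
  connected_component A x = U.
Proof.
move=> Ux cU UA max; apply/seteqP; split; last exact: connected_component_max.
apply: max; first exact: component_connected; first exact: connected_component_sub.
by exists x; split=> //; apply: connected_component_refl; apply: UA.
Qed.

Lemma component_eqP A U : U !=set0 -> connected U -> U `<=` A ->
  (forall B, connected B -> B `<=` A -> B `&` U !=set0 -> B `<=` U) ->
  component A U.
Proof.
move=> [x Ux] cU UA max; exists x; first exact: UA.
by rewrite (connected_component_eq Ux).
Qed.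

Lemma component_setU_open A U W S : A = U `|` W -> open U -> open W -> U `&` W = set0 ->
  U !=set0 -> W !=set0 -> connected U -> connected W ->
  component A S <-> S = U \/ S = W.
Proof.
move=> -> oU oW UW U0 W0 cU cW.
have mU B : connected B -> B `<=` U `|` W -> B `&` U !=set0 -> B `<=` U.
  exact: connected_sub_open.
have mW B : connected B -> B `<=` U `|` W -> B `&` W !=set0 -> B `<=` W.
  move=> cB BUW; apply: (connected_sub_open oW oU) => //; first by rewrite setIC.
  by rewrite setUC.
have sU : U `<=` U `|` W by move=> y; left.
have sW : W `<=` U `|` W by move=> y; right.
split=> [[x + ->]|[->|->]].
- by move=> [Ux|Wx]; [left|right]; apply: connected_component_eq.
- exact: component_eqP.
- exact: component_eqP.
Qed.

Lemma connected_component_unique A S S' : connected A -> component A S -> component A S' -> S = S'.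
Proof.
have E x : connected A -> A x -> connected_component A x = A.
  by move=> cA Ax; apply: connected_component_eq => // B _.
by move=> cA [x Ax ->] [y Ay ->]; rewrite !E.
Qed.

Lemma path_connected_connected (R : realType) A x0 : A x0 ->
  (forall x, A x -> exists g : R -> T, [/\ continuous g, g 0 = x, g 1 = x0
    & forall t, t \in `[0, 1] -> A (g t)]) -> connected A.
Proof.
move=> Ax0 P.
have /choice[g gP] : forall x, exists g : R -> T, A x -> [/\ continuous g, g 0 = x,
    g 1 = x0 & forall t, t \in `[0, 1] -> A (g t)].
  by move=> x; case: (pselect (A x)) => [/P[g gP]|nA]; [exists g|exists (fun=> x0)].
have -> : A = \bigcup_(x in A) (g x @` `[0, 1]%classic).
  rewrite predeqE => y; split.
    move=> Ay; exists y => //; exists 0; last by have [] := gP y Ay.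
    by rewrite /= in_itv /= lexx ler01.
  by move=> [x Ax [t t01 <-]]; have [_ _ _] := gP x Ax; apply.
apply: bigcup_connected.
  exists x0 => x Ax; exists 1; last by have [] := gP x Ax.
  by rewrite /= in_itv /= lexx ler01.
move=> x Ax; have [cg _ _ _] := gP x Ax.
apply: connected_continuous_connected; first exact: segment_connected.
exact: continuous_subspaceT.
Qed.

End Connectedness.

Section VectorContinuity.
Variables (R : realType) (T : topologicalType) (F : set_system T).
Hypothesis FF : Filter F.

Lemma row3_decomp (a b c : R) :
  row3 a b c = a *: row3 1 0 0 + b *: row3 0 1 0 + c *: row3 0 0 1.
Proof. by apply: row3P; rewrite !mxE /=; ring. Qed.

Lemma cvg_row3 (a b c : T -> R) (a0 b0 c0 : R) :
  a @ F --> a0 -> b @ F --> b0 -> c @ F --> c0 ->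
  (fun t => row3 (a t) (b t) (c t)) @ F --> row3 a0 b0 c0.
Proof.
move=> ha hb hc; rewrite row3_decomp; under eq_fun do rewrite row3_decomp.
by apply: cvgD; [apply: cvgD|]; apply: cvgZr_tmp.
Qed.

End VectorContinuity.

Section Clamp.
Variable R : realType.
Implicit Type t : R.

(** Retraction of the line onto the unit interval: composing with it replaces continuity within the
    interval by continuity everywhere. *)
Definition clamp t : R := Num.max 0 (Num.min t 1).

Lemma clamp_in t : clamp t \in `[0, 1].
Proof.
rewrite in_itv /= /clamp le_max lexx /= ge_max ler01 /=.
by rewrite ge_min lexx orbT.
Qed.

Lemma clampE t : t \in `[0, 1] -> clamp t = t.
Proof. by rewrite in_itv /= /clamp => /andP[t0 t1]; rewrite min_l // max_r. Qed.

Lemma clamp_cont : continuous clamp.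
Proof.
move=> t; apply: (@continuous_max _ _ (fun=> 0 : R^o) (fun t : R => Num.min t 1 : R^o) t).
  exact: cst_continuous.
by apply: (@continuous_min _ _ (fun t : R => t : R^o) (fun=> 1 : R^o) t); [exact: cvg_id|exact: cst_continuous].
Qed.

End Clamp.

(** * Star-shaped regions *)

(* A gauge g cuts out a region of P2 that is star-shaped about the point e,
   together with its boundary and exterior; [v] and [- v] are the same point. *)
Section Star.
Variables (R : realType) (e : 'rV[R]_3) (g : 'rV[R]_3 -> R).
Implicit Types (v : 'rV[R]_3) (c t : R) (x : P2 R).
Hypotheses (g_cont : continuous g) (g_hom : forall c v, 0 < c -> g (c *: v) = c * g v)
  (g_e : forall v t, g (v + t *: e) = g v + t).

Definition star_in : set (P2 R) := [set x | 0 < g (hc x) \/ 0 < g (- hc x)].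
Definition star_bd : set (P2 R) := [set x | g (hc x) = 0 \/ g (- hc x) = 0].
Definition star_out : set (P2 R) := [set x | g (hc x) < 0 /\ g (- hc x) < 0].

Lemma star_g0 : g 0 = 0.
Proof.
have : g (2 *: 0) = 2 * g 0 by rewrite g_hom.
by rewrite scaler0 mulr_natl mulr2n => /eqP; rewrite -subr_eq0 opprD addNKr oppr_eq0 => /eqP.
Qed.

Lemma g_homN c v : c < 0 -> g (c *: v) = - c * g (- v).
Proof. by move=> c0; rewrite -g_hom ?oppr_gt0 // scaleNr scalerN opprK. Qed.

(** A negative scalar exchanges the two values up to a positive factor, so stability under positive
    factors and under the exchange suffices. *)
Lemma sign_invariant (P : R -> R -> Prop) :
  (forall a b c, 0 < c -> P a b -> P (c * a) (c * b)) ->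
  (forall a b, P a b -> P b a) ->
  forall c v, c != 0 -> v != 0 -> P (g v) (g (- v)) -> P (g (c *: v)) (g (- (c *: v))).
Proof.
move=> h1 h2 c v c0 v0 H; case: (ltrgtP c 0) c0 => // c0 _.
  rewrite -scalerN !g_homN // opprK; apply: h1; rewrite ?oppr_gt0 //; exact: h2.
by rewrite -scalerN !g_hom //; apply: h1.
Qed.

Lemma star_in_inv c v : c != 0 -> v != 0 -> 0 < g v \/ 0 < g (- v) ->
  0 < g (c *: v) \/ 0 < g (- (c *: v)).
Proof.
apply: (sign_invariant (P := fun a b => 0 < a \/ 0 < b)) => [a b {}c c0|a b]; last by case; [right|left].
by case=> h; [left|right]; apply: mulr_gt0.
Qed.

Lemma star_bd_inv c v : c != 0 -> v != 0 -> g v = 0 \/ g (- v) = 0 ->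
  g (c *: v) = 0 \/ g (- (c *: v)) = 0.
Proof.
apply: (sign_invariant (P := fun a b => a = 0 \/ b = 0)) => [a b {}c c0|a b]; last by case; [right|left].
by case=> ->; [left|right]; apply: mulr0.
Qed.

Lemma star_out_inv c v : c != 0 -> v != 0 -> g v < 0 /\ g (- v) < 0 ->
  g (c *: v) < 0 /\ g (- (c *: v)) < 0.
Proof.
apply: (sign_invariant (P := fun a b => a < 0 /\ b < 0)) => [a b {}c c0|a b]; last by case.
by case=> h1 h2; rewrite !pmulr_rlt0.
Qed.

Lemma g_contN : continuous (fun v : 'rV[R]_3 => g (- v)).
Proof. by move=> v; apply: continuous_comp; [apply: opp_continuous|apply: g_cont]. Qed.

Lemma star_in_open : open star_in.
Proof.
apply: (open_hc (Q := fun v => 0 < g v \/ 0 < g (- v))); first exact: star_in_inv.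
move=> v v0 [gv|gv].
  have /cvgr_gt/(_ _ gv) := @g_cont v; apply: filterS => w; by left.
have /cvgr_gt/(_ _ gv) := @g_contN v; apply: filterS => w; by right.
Qed.

Lemma star_out_open : open star_out.
Proof.
apply: (open_hc (Q := fun v => g v < 0 /\ g (- v) < 0)); first exact: star_out_inv.
move=> v v0 [gv gNv]; near=> w; split.
  by near: w; have /cvgr_lt/(_ _ gv) := @g_cont v.
by near: w; have /cvgr_lt/(_ _ gNv) := @g_contN v.
Unshelve. all: by end_near. Qed.

Lemma star_bd_closed : closed star_bd.
Proof.
rewrite -[star_bd]setCK; apply: open_closedC.
have -> : ~` star_bd = [set x | g (hc x) != 0 /\ g (- hc x) != 0].
  rewrite predeqE => x; split=> [nx|[/eqP h1 /eqP h2] []] //.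
  by split; apply/eqP => gx; apply: nx; [left|right].
apply: (open_hc (Q := fun v => g v != 0 /\ g (- v) != 0)).
  apply: (sign_invariant (P := fun a b => a != 0 /\ b != 0)) => [a b c c0 []|a b []] //.
  by rewrite !mulf_eq0 (gt_eqF c0).
move=> v v0 [g1 g2]; near=> w; split; near: w.
  by apply: (cvgr_neq0 _ (@g_cont v)).
by apply: (cvgr_neq0 _ (g_contN (x := v))).
Unshelve. all: by end_near. Qed.

Lemma star_inP v : v != 0 -> star_in (toP v) <-> 0 < g v \/ 0 < g (- v).
Proof. by move=> v0; apply: hc_toPP v0 star_in_inv. Qed.

Lemma star_bdP v : v != 0 -> star_bd (toP v) <-> g v = 0 \/ g (- v) = 0.
Proof. by move=> v0; apply: hc_toPP v0 star_bd_inv. Qed.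

Lemma star_outP v : v != 0 -> star_out (toP v) <-> g v < 0 /\ g (- v) < 0.
Proof. by move=> v0; apply: hc_toPP v0 star_out_inv. Qed.

Lemma g_neq0 v : 0 < g v -> v != 0.
Proof. by apply: contraTneq => ->; rewrite star_g0 ltxx. Qed.

Lemma g_center : g e = 1.
Proof. by have := g_e 0 1; rewrite add0r scale1r star_g0 add0r. Qed.

Lemma g_seg v t : 0 < g v -> t \in `[0, 1] -> 0 < g ((1 - t) *: v + t *: e).
Proof.
rewrite in_itv /= => gv /andP[t0 t1]; rewrite g_e.
(* Homogeneity is available for positive factors only, so the end [t = 1] is treated apart. *)
move: t1; rewrite le_eqVlt => /orP[/eqP->|t1].
  by rewrite subrr scale0r star_g0 add0r.
by rewrite g_hom ?subr_gt0 // ltr_wpDr // mulr_gt0 // subr_gt0.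
Qed.

Lemma star_rep x : star_in x -> exists v, [/\ v != 0, 0 < g v & x = toP v].
Proof.
case=> h; first by exists (hc x); rewrite hcK; split=> //; apply: hc_neq0.
exists (- hc x); split=> //; first by rewrite oppr_eq0 hc_neq0.
by rewrite -scaleN1r toPZ ?oppr_eq0 ?oner_eq0 // hcK.
Qed.

Lemma seg_cont v : continuous (fun t : R => (1 - t) *: v + t *: e).
Proof.
move=> t; apply: cvgD; apply: cvgZr_tmp; last exact: cvg_id.
by apply: cvgB; [exact: cvg_cst|exact: cvg_id].
Qed.

Lemma star_in_connected : connected star_in.
Proof.
have e0 : e != 0 by apply: g_neq0; rewrite g_center ltr01.
apply: (@path_connected_connected _ R _ (toP e)).
  by apply/star_inP => //; left; rewrite g_center ltr01.
move=> x /star_rep[v [v0 gv ->]].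
exists (fun t => toP ((1 - clamp t) *: v + clamp t *: e)); split.
- move=> t; apply: (continuous_comp (f := fun t => (1 - clamp t) *: v + clamp t *: e) (g := @toP R)); last first.
    by apply: toP_continuous; apply: g_neq0; apply: g_seg => //; apply: clamp_in.
  apply: (continuous_comp (f := @clamp R) (g := fun t => (1 - t) *: v + t *: e)); last exact: seg_cont.
  exact: clamp_cont.
- by rewrite clampE ?in_itv /= ?lexx ?ler01 // subr0 scale1r scale0r addr0.
- by rewrite clampE ?in_itv /= ?lexx ?ler01 // subrr scale0r scale1r add0r.
- move=> t t01; apply/star_inP; last by left; apply: g_seg => //; apply: clamp_in.
  by apply: g_neq0; apply: g_seg => //; apply: clamp_in.
Qed.

End Star.

Section StarOval.
Variables (R : realType) (e : 'rV[R]_3) (g : 'rV[R]_3 -> R).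
Implicit Types (v w : 'rV[R]_3) (c t : R) (x : P2 R).
Hypotheses (g_cont : continuous g) (g_hom : forall c v, 0 < c -> g (c *: v) = c * g v)
  (g_e : forall v t, g (v + t *: e) = g v + t)
  (g_opp : forall v, v != 0 -> 0 <= g v -> g (- v) < 0).

Lemma star_bd_compl : ~` star_bd g = star_in g `|` star_out g.
Proof.
rewrite predeqE => x; rewrite /star_bd /star_in /star_out /=.
have x0 := hc_neq0 x; have h1 := g_opp x0.
have h2 : 0 <= g (- hc x) -> g (hc x) < 0.
  by rewrite -[X in _ -> g X < 0]opprK; apply: g_opp; rewrite oppr_eq0.
move: h1 h2; case: (ltrgtP (g (hc x)) 0) => a; case: (ltrgtP (g (- hc x)) 0) => b //= h1 h2.
- by split=> [_|_ [/eqP|/eqP]]; [right|rewrite lt_eqF|rewrite lt_eqF].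
- by split=> [_|_ [/eqP|/eqP]]; [left; right|rewrite lt_eqF|rewrite gt_eqF].
- by split=> [[]|[[//|//]|[]]] //; right.
- by split=> [_|_ [/eqP|/eqP]]; [left; left|rewrite gt_eqF|rewrite lt_eqF].
- by have := h1 isT.
- by have := h1 isT.
- by split=> [[]|[[//|//]|[]]] //; left.
- by have := h1 isT.
- by have := h1 isT.
Qed.

Lemma star_in_out : star_in g `&` star_out g = set0.
Proof.
by rewrite predeqE => x; split=> // -[[a|a] [b c]]; [have := lt_trans a b|have := lt_trans a c]; rewrite ltxx.
Qed.

(** By [g_opp] at most one of [v] and [- v] has positive gauge. Scaling it to gauge one gives a
    representative that varies continuously over the region, and the straight segment from it to [e]
    stays inside. *)
Lemma star_in_contractible : contractible R (star_in g).
Proof.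
have e0 : e != 0 by apply: (g_neq0 g_hom); rewrite (g_center g_hom g_e) ltr01.
exists (toP e); first by apply/star_inP => //; left; rewrite (g_center g_hom g_e) ltr01.
pose nrm v := if 0 < g v then (g v)^-1 *: v else (g (- v))^-1 *: (- v).
have nrm_pos v c : 0 < g v -> c != 0 -> nrm (c *: v) = (g v)^-1 *: v.
  move=> gv c0; rewrite /nrm; case: (ltrgtP c 0) c0 => // cs _; last first.
    by rewrite g_hom // pmulr_rgt0 // gv scalerA invfM mulrAC mulVf ?gt_eqF // mul1r.
  rewrite (g_homN g_hom) // pmulr_rgt0 ?oppr_gt0 // ltNge ltW /=; last first.
    by apply: g_opp; [exact: (g_neq0 g_hom)|exact: ltW].
  rewrite -scaleNr g_hom ?oppr_gt0 // scalerA invfM mulrAC mulVf ?mul1r //.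
  by rewrite oppr_eq0 lt_eqF.
have gnrm v : 0 < g v -> g ((g v)^-1 *: v) = 1.
  by move=> gv; rewrite g_hom ?invr_gt0 // mulVf // gt_eqF.
pose xh x := nrm (hc x).
have xhE v : 0 < g v -> xh (toP v) = (g v)^-1 *: v.
  move=> gv; rewrite /xh; have [c c0 ->] := hc_toP (g_neq0 g_hom gv).
  exact: nrm_pos.
have g_xh x : star_in g x -> 0 < g (xh x).
  by move=> /star_rep[v [v0 gv ->]]; rewrite xhE // gnrm // ltr01.
have xh_cont x : star_in g x -> {for x, continuous xh}.
  move=> /star_rep[v [v0 gv ->]]; apply/(cvg_toP _ _ v0); rewrite xhE //.
  have gV : (g w)^-1 @[w --> v] --> (g v)^-1.
    by apply: (@cvgV R _ (nbhs v) _ g (g v)); [rewrite gt_eqF|exact: g_cont].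
  have : (fun w => (g w)^-1 *: w) @ v --> (g v)^-1 *: v by apply: (cvgZ gV); exact: cvg_id.
  apply: cvg_trans; apply: near_eq_cvg.
  have /cvgr_gt/(_ _ gv) := @g_cont v; apply: filterS => w gw.
  by rewrite xhE.
exists (fun p => toP ((1 - p.2) *: xh p.1 + p.2 *: e)); split.
- apply: continuous_in_subspaceT => -[x t]; rewrite inE => -[/= Dx t01].
  apply: (continuous_comp (f := fun p : P2 R * R => (1 - p.2) *: xh p.1 + p.2 *: e) (g := @toP R)).
    apply: cvgD; apply: cvgZ.
    + by apply: cvgB; [exact: cvg_cst|exact: cvg_snd].
    + by apply: cvg_comp; [exact: cvg_fst|exact: xh_cont].
    + exact: cvg_snd.
    + exact: cvg_cst.
  by apply: toP_continuous; apply: (g_neq0 g_hom); apply: (g_seg g_hom g_e) => //=; apply: g_xh.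
- move=> x t Dx t01 /=; have H := g_seg g_hom g_e (g_xh x Dx) t01.
  by apply/(star_inP g_hom); [exact: (g_neq0 g_hom H)|left].
- move=> x /star_rep[v [v0 gv ->]] /=.
  by rewrite subr0 scale1r scale0r addr0 xhE // toPZ // invr_eq0 gt_eqF.
- by move=> x _ /=; rewrite subrr scale0r scale1r add0r.
Qed.

End StarOval.

(** * The exterior of an oval *)

Lemma pair_continuous (X Y Z : topologicalType) (f : X -> Y) (h : X -> Z) x :
  {for x, continuous f} -> {for x, continuous h} ->
  {for x, continuous (fun y => (f y, h y))}.
Proof. by move=> cf ch; apply: (@cvg_pair _ _ _ (nbhs x) (nbhs (f x)) (nbhs (h x))). Qed.

Local Open Scope quotient_scope.

Section Moebius.
Variable R : realType.
Implicit Types (p q : R * R).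

Local Notation MQ := (quotient_topology {eq_quot (@glide R)}).

Definition toM p : mobius R := \pi_MQ p.
Definition reprM (y : mobius R) : R * R := repr (y : MQ).

Lemma reprMK y : toM (reprM y) = y.
Proof. exact: reprK. Qed.

Lemma eq_toM p q : toM p = toM q <-> exists n : int, q = (p.1 + n%:~R, (-1) ^ n * p.2).
Proof.
split=> [/eqquotP /asboolP //|h].
by apply/eqquotP/asboolP.
Qed.

Lemma toM_shift n p : toM (p.1 + n%:~R, (-1) ^ n * p.2) = toM p.
Proof. by apply/esym/eq_toM; exists n. Qed.

(** The quotient map is open, because the saturation of an open set is the union of its images under
    the powers of the glide reflection. *)
Lemma nbhs_toM p (A : set (mobius R)) :
  nbhs (toM p) A <-> nbhs p [set q | A (toM q)].
Proof.
split; first exact: (@pi_continuous _ {eq_quot (@glide R)} p A).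
rewrite nbhsE => -[O [oO Op] OA].
rewrite nbhsE; exists [set y | exists2 q, O q & toM q = y]; last first.
  by move=> y [q Oq <-]; apply: OA.
split; last by exists p.
rewrite /open /= /quotient_open.
have -> : \pi_MQ @^-1` [set y | exists2 q, O q & toM q = y] =
    \bigcup_(n in [set: int]) ((fun q => (q.1 + n%:~R, (-1) ^ n * q.2)) @^-1` O).
  rewrite predeqE => q; split.
    by move=> [q' Oq' /esym/eq_toM[n q'E]]; exists n => //=; rewrite /preimage /= -q'E.
  by move=> [n _ /= On]; exists (q.1 + n%:~R, (-1) ^ n * q.2) => //; apply: toM_shift.
apply: bigcup_open => n _; apply: open_comp => // q _.
apply: (@pair_continuous _ R R (fun q : R * R => q.1 + n%:~R) (fun q : R * R => (-1) ^ n * q.2)).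
  by apply: (@cvgD _ _ _ (nbhs q)); [exact: cvg_fst|exact: cvg_cst].
by apply: (@cvgM _ _ (nbhs q)); [exact: cvg_cst|exact: cvg_snd].
Qed.

Lemma toM_continuous : continuous toM.
Proof. by move=> p A /nbhs_toM. Qed.

End Moebius.

Local Close Scope quotient_scope.

Section Polar.
Variable R : realType.
Implicit Types x y : R.

Lemma polar (a b : R) : (a != 0) || (b != 0) ->
  exists c x, [/\ 0 < c, a = c * cos (pi * x) & b = c * sin (pi * x)].
Proof.
move=> ab; pose c := Num.sqrt (a ^+ 2 + b ^+ 2).
have c0 : 0 < c.
  rewrite sqrtr_gt0; case/orP: ab => h.
    by rewrite ltr_pwDl ?sqr_ge0 // exprn_even_gt0.
  by rewrite ltr_wpDl ?sqr_ge0 // exprn_even_gt0.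
have cE : c ^+ 2 = a ^+ 2 + b ^+ 2 by rewrite sqr_sqrtr // addr_ge0 ?sqr_ge0.
have ac : -1 <= a / c <= 1.
  rewrite ler_pdivrMr // ler_pdivlMr // mulN1r mul1r -ler_norml.
  rewrite -(@ler_pXn2r _ 2) ?nnegrE ?(ltW c0) // cE real_normK ?num_real //.
  by rewrite lerDl sqr_ge0.
have pi0 : pi != 0 :> R by rewrite gt_eqF // pi_gt0.
have cosA : cos (acos (a / c)) = a / c by rewrite acosK // in_itv.
have sinA : sin (acos (a / c)) = `|b| / c.
  rewrite sin_acos // -[RHS]ger0_norm ?divr_ge0 ?(ltW c0) // -sqrtr_sqr; congr Num.sqrt.
  rewrite !expr_div_n real_normK ?num_real // -(@divff _ (c ^+ 2)) ?expf_neq0 ?gt_eqF //.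
  by rewrite -mulrBl cE addrAC subrr add0r.
case: (lerP 0 b) => b0.
  exists c, (acos (a / c) / pi); rewrite (mulrC pi) mulfVK // cosA sinA ger0_norm //.
  by rewrite !(mulrC c) !mulfVK // gt_eqF.
exists c, (- acos (a / c) / pi); rewrite (mulrC pi) mulfVK // cosN sinN cosA sinA ltr0_norm //.
by split=> //; field; rewrite gt_eqF.
Qed.

Lemma cos_pi_shift x (n : int) : cos (pi * (x + n%:~R)) = (-1) ^ n * cos (pi * x).
Proof.
have S (y : R) : cos (pi * (y + 1)) = - cos (pi * y) by rewrite mulrDr mulr1 cosDpi.
have S' (y : R) : cos (pi * (y - 1)) = - cos (pi * y) by rewrite -[y in RHS](subrK 1) S opprK.
elim/int_rec: n => [|n IHn|n IHn]; first by rewrite addr0 expr0z mul1r.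
  by rewrite -addn1 PoszD intrD addrA S IHn expfzDr ?oppr_eq0 ?oner_eq0 // expr1z mulrN1 mulNr.
rewrite -addn1 PoszD opprD intrD addrA S' IHn expfzDr ?oppr_eq0 ?oner_eq0 //.
by rewrite [(-1) ^ (- 1%:Z)]/= exprN1 invrN1 mulrN1 mulNr.
Qed.

Lemma sin_pi_shift x (n : int) : sin (pi * (x + n%:~R)) = (-1) ^ n * sin (pi * x).
Proof.
have E (y : R) : sin (pi * y) = - cos (pi * (y + 2^-1)) by rewrite mulrDr cosDpihalf opprK.
by rewrite !E addrAC cos_pi_shift mulrN.
Qed.

Lemma sign_double (m : int) : (-1) ^ (m + m) = 1 :> R.
Proof.
by rewrite expfzDr ?oppr_eq0 ?oner_eq0 // -expfzMl mulrNN mulr1 exp1rz.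
Qed.

Lemma cos_pi_eq1 x : cos (pi * x) = 1 -> exists n : int, x = (n + n)%:~R.
Proof.
(* [n + n] is an even integer nearest to [x], which brings [y] into $[-1, 1)$, where [acos] recovers
   [pi * y] up to sign. *)
move=> cx; pose n := Num.floor ((x + 1) / 2); exists n.
have n1 : n%:~R <= (x + 1) / 2 by apply: real_floor_le; apply: num_real.
have n2 : (x + 1) / 2 < (n + 1)%:~R by apply: real_floorD1_gt; apply: num_real.
have pi0 : 0 < pi :> R := pi_gt0 R.
pose y := x - (n + n)%:~R.
have cy : cos (pi * y) = 1.
  by rewrite /y -mulrNz cos_pi_shift opprD sign_double mul1r.
have [y1 y2] : -1 <= y /\ y < 1 by rewrite /y intrD; move: n2; rewrite intrD; lra.
apply/eqP; rewrite -subr_eq0 -/y; apply/eqP/(mulfI (lt0r_neq0 pi0)); rewrite mulr0.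
case: (lerP 0 y) => y0.
  by rewrite -[LHS]cosK ?cy ?acos1 // in_itv /= mulr_ge0 ?(ltW pi0) //= -[leRHS]mulr1 ler_pM2l // ltW.
have := @cosKN _ (pi * y); rewrite cy acos1 => /(_ _)/esym/eqP.
rewrite oppr_eq0 => H; apply/eqP/H; rewrite pmulr_rle0 // (ltW y0) andbT.
by have := ler_wpM2l (ltW pi0) y1; rewrite mulrN1.
Qed.

End Polar.

(* Coordinates centred at e = (c1, c2, 1): [mk a b s] is (a, b, 0) + s e, and the
   gauge measures s from the graph s = r (a, b). *)
Section Gauge.
Variables (R : realType) (c1 c2 : R) (r : R * R -> R).
Implicit Types (v w : 'rV[R]_3) (a b c s t x : R).

Definition da v : R := v 0 0 - c1 * v 0 ord_max.
Definition db v : R := v 0 1 - c2 * v 0 ord_max.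
Definition mk a b s : 'rV[R]_3 := row3 (a + c1 * s) (b + c2 * s) s.
Definition center : 'rV[R]_3 := row3 c1 c2 1.
Definition gauge v : R := v 0 ord_max - r (da v, db v).

Lemma da_mk a b s : da (mk a b s) = a.
Proof. by rewrite /da /mk !row3E addrK. Qed.
Lemma db_mk a b s : db (mk a b s) = b.
Proof. by rewrite /db /mk !row3E addrK. Qed.
Lemma mk_eta v : mk (da v) (db v) (v 0 ord_max) = v.
Proof. by apply: row3P; rewrite !row3E /da /db ?subrK. Qed.
Lemma mkZ c a b s : mk (c * a) (c * b) (c * s) = c *: mk a b s.
Proof. by apply: row3P; rewrite !mxE /=; ring. Qed.
Lemma daZ c v : da (c *: v) = c * da v.
Proof. by rewrite /da !mxE; ring. Qed.
Lemma dbZ c v : db (c *: v) = c * db v.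
Proof. by rewrite /db !mxE; ring. Qed.
Lemma daN v : da (- v) = - da v.
Proof. by rewrite /da !mxE; ring. Qed.
Lemma dbN v : db (- v) = - db v.
Proof. by rewrite /db !mxE; ring. Qed.

Lemma coord_cvg (i : 'I_3) v : {for v, continuous (fun w : 'rV[R]_3 => w 0 i)}.
Proof. exact: coord_continuous. Qed.

Lemma da_cont : continuous da.
Proof.
move=> v; apply: (@cvgB _ _ _ (nbhs v)); first exact: coord_cvg.
by apply: (@cvgM _ _ (nbhs v)); [exact: cvg_cst|exact: coord_cvg].
Qed.

Lemma db_cont : continuous db.
Proof.
move=> v; apply: (@cvgB _ _ _ (nbhs v)); first exact: coord_cvg.
by apply: (@cvgM _ _ (nbhs v)); [exact: cvg_cst|exact: coord_cvg].
Qed.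

Hypotheses (r_cont : continuous r)
  (r_hom : forall c a b, 0 < c -> r (c * a, c * b) = c * r (a, b)).

Lemma gauge_cont : continuous gauge.
Proof.
move=> v; apply: (@cvgB _ _ _ (nbhs v)); first exact: coord_cvg.
apply: (continuous_comp (f := fun w => (da w, db w)) (g := r)); last exact: r_cont.
by apply: pair_continuous; [exact: da_cont|exact: db_cont].
Qed.

Lemma gauge_hom c v : 0 < c -> gauge (c *: v) = c * gauge v.
Proof. by move=> c0; rewrite /gauge daZ dbZ r_hom // mxE mulrBr. Qed.

Lemma gauge_e v t : gauge (v + t *: center) = gauge v + t.
Proof.
rewrite /gauge; have -> : da (v + t *: center) = da v by rewrite /da !mxE /=; ring.
have -> : db (v + t *: center) = db v by rewrite /db !mxE /=; ring.
by rewrite !mxE /=; ring.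
Qed.

Lemma gauge_mk a b s : gauge (mk a b s) = s - r (a, b).
Proof. by rewrite /gauge da_mk db_mk row3E. Qed.

Lemma gauge_mkN a b s : gauge (- mk a b s) = - s - r (- a, - b).
Proof. by rewrite /gauge daN dbN da_mk db_mk mxE row3E. Qed.

Lemma mk_neq0 a b s : (a != 0) || (b != 0) -> mk a b s != 0.
Proof.
apply: contraTneq => E; have h1 := da_mk a b s; have h2 := db_mk a b s.
by move: h1 h2; rewrite E /da /db !mxE !mulr0 subr0 => <- <-; rewrite eqxx.
Qed.

Lemma cos_sin_neq0 x : (cos (pi * x) != 0) || (sin (pi * x) != 0).
Proof.
rewrite -negb_and; apply/negP => /andP[/eqP h1 /eqP h2].
have := cos2Dsin2 (pi * x); rewrite h1 h2 expr0n /= addr0 => /eqP.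
by rewrite eq_sym oner_eq0.
Qed.

Definition ray x s : P2 R := toP (mk (cos (pi * x)) (sin (pi * x)) s).

Lemma mk_cont (T : topologicalType) (fa fb fs : T -> R) (y : T) :
  {for y, continuous fa} -> {for y, continuous fb} -> {for y, continuous fs} ->
  {for y, continuous (fun z => mk (fa z) (fb z) (fs z))}.
Proof.
move=> ha hb hs; apply: (@cvg_row3 _ _ (nbhs y)) => //.
  by apply: (@cvgD _ _ _ (nbhs y)) => //; apply: (@cvgM _ _ (nbhs y)); [exact: cvg_cst|].
by apply: (@cvgD _ _ _ (nbhs y)) => //; apply: (@cvgM _ _ (nbhs y)); [exact: cvg_cst|].
Qed.

Lemma cos_pi_cont (T : topologicalType) (f : T -> R) y :
  {for y, continuous f} -> {for y, continuous (fun z => cos (pi * f z))}.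
Proof.
move=> hf; apply: (continuous_comp (f := fun z => pi * f z)); last exact: continuous_cos.
by apply: (@cvgM _ _ (nbhs y)); [exact: cvg_cst|].
Qed.

Lemma sin_pi_cont (T : topologicalType) (f : T -> R) y :
  {for y, continuous f} -> {for y, continuous (fun z => sin (pi * f z))}.
Proof.
move=> hf; apply: (continuous_comp (f := fun z => pi * f z)); last exact: continuous_sin.
by apply: (@cvgM _ _ (nbhs y)); [exact: cvg_cst|].
Qed.

Lemma ray_cont (T : topologicalType) (fx fs : T -> R) (y : T) :
  {for y, continuous fx} -> {for y, continuous fs} ->
  {for y, continuous (fun z => ray (fx z) (fs z))}.
Proof.
move=> hx hs; apply: (continuous_comp (f := fun z => mk (cos (pi * fx z)) (sin (pi * fx z)) (fs z))).
  by apply: mk_cont => //; [apply: cos_pi_cont|apply: sin_pi_cont].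
by apply: toP_continuous; apply: mk_neq0; apply: cos_sin_neq0.
Qed.

Lemma r_ray_cont (T : topologicalType) (fx : T -> R) (y : T) :
  {for y, continuous fx} ->
  {for y, continuous (fun z => r (cos (pi * fx z), sin (pi * fx z)))}.
Proof.
move=> hx; apply: (continuous_comp (f := fun z => (cos (pi * fx z), sin (pi * fx z))) (g := r)).
  by apply: pair_continuous; [apply: cos_pi_cont|apply: sin_pi_cont].
exact: r_cont.
Qed.

Lemma r0 : r (0, 0) = 0.
Proof.
have := r_hom 0 0 (ltr0n R 2); rewrite !mulr0 mulr_natl mulr2n => /eqP.
by rewrite -subr_eq0 opprD addNKr oppr_eq0 => /eqP.
Qed.

Lemma gauge0_dir v : v != 0 -> gauge v = 0 -> (da v != 0) || (db v != 0).
Proof.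
move=> v0 gv; rewrite -negb_and; apply: contra_neqN v0 => /andP[/eqP h1 /eqP h2].
move: gv; rewrite /gauge h1 h2 r0 subr0 => h3.
by rewrite -(mk_eta v) h1 h2 h3 /mk; apply: row3P; rewrite !mxE /=; ring.
Qed.

Lemma gauge_bd_ray (x : P2 R) : star_bd gauge x -> exists t, x = ray t (r (cos (pi * t), sin (pi * t))).
Proof.
suff H v : v != 0 -> gauge v = 0 -> exists t, toP v = ray t (r (cos (pi * t), sin (pi * t))).
  case=> gx; first by rewrite -(hcK x); apply: H => //; apply: hc_neq0.
  rewrite -(hcK x) -(@toPZ _ (-1)) ?oppr_eq0 ?oner_eq0 // scaleN1r.
  by apply: H => //; rewrite oppr_eq0 hc_neq0.
move=> v0 gv; have [c [t [c0 aE bE]]] := polar (gauge0_dir v0 gv); exists t.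
rewrite -(mk_eta v) aE bE (_ : v 0 ord_max = c * (r (cos (pi * t), sin (pi * t)))).
  by rewrite mkZ toPZ // gt_eqF.
by rewrite -r_hom // -aE -bE; apply/eqP; rewrite -subr_eq0 -/(gauge v) gv.
Qed.

Lemma ray_bd t : star_bd gauge (ray t (r (cos (pi * t), sin (pi * t)))).
Proof.
apply/(star_bdP gauge_hom); first by apply: mk_neq0; apply: cos_sin_neq0.
by left; rewrite gauge_mk subrr.
Qed.

Lemma star_bd_connected : connected (star_bd gauge).
Proof.
have -> : star_bd gauge = (fun t => ray t (r (cos (pi * t), sin (pi * t)))) @` [set: R].
  rewrite predeqE => x; split; first by move=> /gauge_bd_ray[t ->]; exists t.
  by move=> [t _ <-]; apply: ray_bd.
apply: connected_continuous_connected.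
  by apply/connected_intervalP => a b _ _ c _.
apply: continuous_subspaceT => t; apply: ray_cont; first exact: cvg_id.
by apply: r_ray_cont; exact: cvg_id.
Qed.

Lemma star_bd_neq0 : star_bd gauge !=set0.
Proof. by exists (ray 0 (r (cos (pi * 0), sin (pi * 0)))); apply: ray_bd. Qed.

Hypothesis r_pos : forall a b, (a != 0) || (b != 0) -> 0 < r (a, b) + r (- a, - b).

Lemma gauge_opp v : v != 0 -> 0 <= gauge v -> gauge (- v) < 0.
Proof.
move=> v0; case: (boolP ((da v != 0) || (db v != 0))) => [dv|].
  have := r_pos dv; rewrite /gauge daN dbN mxE; lra.
rewrite -negb_and negbK => /andP[/eqP h1 /eqP h2] gv.
have sv : v 0 ord_max != 0.
  apply: contra_neq v0 => h3; rewrite -(mk_eta v) h1 h2 h3 /mk.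
  by apply: row3P; rewrite !mxE /=; ring.
move: gv; rewrite /gauge daN dbN h1 h2 !oppr0 r0 !subr0 mxE => gv.
by rewrite oppr_lt0 lt_neqAle eq_sym sv.
Qed.

(* Coordinates on the exterior: [pi * x] is the angle of the direction from the
   centre, and the logistic function of [t] is the position between the two
   boundary points on the line through the centre.  Reversing the direction
   changes the sign of [t], as in the definition of the Moebius strip. *)
Let wid x := r (cos (pi * x), sin (pi * x)) + r (- cos (pi * x), - sin (pi * x)).
Let out_ray (p : R * R) : P2 R :=
  ray p.1 (wid p.1 * (expR p.2 / (1 + expR p.2)) - r (- cos (pi * p.1), - sin (pi * p.1))).

(** The odds of the position between the two boundary points, equal to [expR t] at [out_ray (x, t)].
    Passing to [- v] inverts them, so their logarithm changes sign. *)
Let ratio v := gauge (- v) / gauge v.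

Let wid_gt0 x : 0 < wid x. Proof. exact: r_pos (cos_sin_neq0 x). Qed.

Let exp1_gt0 t : 0 < 1 + expR t :> R. Proof. by rewrite addr_gt0 ?expR_gt0 ?ltr01. Qed.

Let out_ray_vec x t : let v := mk (cos (pi * x)) (sin (pi * x))
    (wid x * (expR t / (1 + expR t)) - r (- cos (pi * x), - sin (pi * x))) in
  [/\ v != 0, gauge v < 0, gauge (- v) < 0 & ratio v = expR t].
Proof.
move=> v; have h0 := exp1_gt0 t; have hw := wid_gt0 x; have he := expR_gt0 t.
have v0 : v != 0 by apply: mk_neq0; apply: cos_sin_neq0.
have gv : gauge v = - (wid x / (1 + expR t)).
  by rewrite gauge_mk /wid; field; rewrite gt_eqF.
have gNv : gauge (- v) = - (wid x * (expR t / (1 + expR t))).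
  by rewrite gauge_mkN /wid; ring.
split=> //.
- by rewrite gv oppr_lt0 divr_gt0.
- by rewrite gNv oppr_lt0 mulr_gt0 // divr_gt0.
- by rewrite /ratio gv gNv; field; rewrite !gt_eqF.
Qed.

(** Some angle of the direction in units of [pi], chosen without continuity: it is determined up to
    even integers, which the Moebius quotient absorbs. *)
Let ang v : R := xget 0 [set x | exists2 c, 0 < c & da v = c * cos (pi * x) /\ db v = c * sin (pi * x)].

Let angP v : (da v != 0) || (db v != 0) ->
  exists2 c, 0 < c & da v = c * cos (pi * ang v) /\ db v = c * sin (pi * ang v).
Proof.
move=> /polar[c [x [c0 h1 h2]]]; rewrite /ang; case: xgetP => [y _ //|/(_ x)[]].
by exists c.
Qed.

Let out_coord (y : P2 R) : mobius R := toM (ang (hc y), ln (ratio (hc y))).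

Let out_dir v : gauge v < 0 -> gauge (- v) < 0 -> (da v != 0) || (db v != 0).
Proof.
move=> gv gNv; rewrite -negb_and; apply/negP => /andP[/eqP h1 /eqP h2].
move: gv gNv; rewrite /gauge daN dbN h1 h2 !oppr0 r0 !subr0 mxE; lra.
Qed.

Let polar_unique c c' x x' : 0 < c -> 0 < c' ->
  c * cos (pi * x) = c' * cos (pi * x') -> c * sin (pi * x) = c' * sin (pi * x') ->
  exists n : int, x' = x + (n + n)%:~R.
Proof.
move=> c0 c'0 h1 h2.
have cc : c = c'.
  apply/eqP; rewrite -(@eqrXn2 _ 2) ?ltW //; apply/eqP.
  rewrite -[LHS]mulr1 -[RHS]mulr1 -{1}(cos2Dsin2 (pi * x)) -(cos2Dsin2 (pi * x')).
  by rewrite !mulrDr -!exprMn h1 h2.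
have {}h1 : cos (pi * x) = cos (pi * x') by apply: (mulfI (lt0r_neq0 c'0)); rewrite -h1 cc.
have {}h2 : sin (pi * x) = sin (pi * x') by apply: (mulfI (lt0r_neq0 c'0)); rewrite -h2 cc.
have [|n E] := @cos_pi_eq1 _ (x' - x).
  by rewrite mulrBr cosB h1 h2 -!expr2 cos2Dsin2.
by exists n; rewrite -E addrC subrK.
Qed.

(** Independence of the choices in [hc] and [ang]: a positive factor changes the angle by an even
    integer, a negative one by an odd integer while inverting the ratio, and both are effects of
    powers of the glide reflection. *)
Let out_coordE v c x : gauge v < 0 -> gauge (- v) < 0 -> 0 < c ->
  da v = c * cos (pi * x) -> db v = c * sin (pi * x) ->
  out_coord (toP v) = toM (x, ln (ratio v)).
Proof.
move=> gv gNv c0 h1 h2; have dv := out_dir gv gNv.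
have v0 : v != 0 by rewrite -(mk_eta v); apply: mk_neq0.
rewrite /out_coord; have [k k0 ->] := hc_toP v0.
have dkv : (da (k *: v) != 0) || (db (k *: v) != 0).
  by rewrite daZ dbZ !mulf_eq0 (negbTE k0).
have [c' c'0 [h1' h2']] := angP dkv.
case: (ltrgtP k 0) k0 => // ks _; last first.
  have [n E] : exists n : int, ang (k *: v) = x + (n + n)%:~R.
    apply: (@polar_unique (k * c) c'); rewrite ?mulr_gt0 //.
      by rewrite -mulrA -h1 -daZ.
    by rewrite -mulrA -h2 -dbZ.
  have -> : ratio (k *: v) = ratio v.
    rewrite /ratio -scalerN !gauge_hom //; field; rewrite lt_eqF //=.
    by rewrite gt_eqF.
  rewrite E; have := toM_shift (n + n) (x, ln (ratio v)).
  by rewrite /= sign_double mul1r.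
have [n E] : exists n : int, ang (k *: v) = x + 1 + (n + n)%:~R.
  apply: (@polar_unique (- k * c) c'); rewrite ?mulr_gt0 ?oppr_gt0 //.
    rewrite -h1' daZ h1 (_ : 1 = (1 : int)%:~R) // cos_pi_shift expr1z; ring.
  rewrite -h2' dbZ h2 (_ : 1 = (1 : int)%:~R) // sin_pi_shift expr1z; ring.
have -> : ratio (k *: v) = (ratio v)^-1.
  have e1 : gauge (k *: v) = - k * gauge (- v) by rewrite (g_homN gauge_hom).
  have e2 : gauge (- (k *: v)) = - k * gauge v by rewrite -scaleNr gauge_hom ?oppr_gt0.
  by rewrite /ratio e1 e2; field; rewrite !lt_eqF.
rewrite lnV ?posrE; last by rewrite /ratio nmulr_rgt0 ?invr_lt0.
rewrite E; have := toM_shift (1 + (n + n)) (x, ln (ratio v)).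
rewrite /= expfzDr ?oppr_eq0 ?oner_eq0 // sign_double mulr1 expr1z mulN1r => <-.
by rewrite [(1 + (n + n))%:~R]intrD addrA.
Qed.

Let out_ray_shift (n : int) p : out_ray (p.1 + n%:~R, (-1) ^ n * p.2) = out_ray p.
Proof.
case: p => x t; rewrite /out_ray /wid /ray /= cos_pi_shift sin_pi_shift.
have /orP[/eqP->|/eqP->] : ((-1) ^ n == 1 :> R) || ((-1) ^ n == -1 :> R).
- by rewrite -eqf_sqr expr1n expr2 -expfzDr ?oppr_eq0 ?oner_eq0 // sign_double eqxx.
- by rewrite !mul1r.
rewrite !mulN1r !opprK.
set A := cos (pi * x); set B := sin (pi * x).
rewrite -[RHS](@toPZ _ (-1)) ?oppr_eq0 ?oner_eq0 // -mkZ !mulN1r; congr (toP (mk _ _ _)).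
by rewrite expRN; field; rewrite ?gt_eqF ?expR_gt0 ?exp1_gt0.
Qed.

Let out_rayE (p : R * R) : out_ray (reprM (toM p)) = out_ray p.
Proof.
have /eq_toM[n ->] : toM p = toM (reprM (toM p)) by rewrite reprMK.
exact: out_ray_shift.
Qed.

Let out_ray_cont : continuous out_ray.
Proof.
move=> p; have h1 : {for p, continuous (fun q : R * R => q.1)} by exact: cvg_fst.
have h2 : {for p, continuous (fun q : R * R => expR q.2)}.
  apply: (continuous_comp (f := snd)); [exact: cvg_snd|exact: continuous_expR].
have hN : {for p, continuous (fun q : R * R => r (- cos (pi * q.1), - sin (pi * q.1)))}.
  apply: (continuous_comp (f := fun q : R * R => (- cos (pi * q.1), - sin (pi * q.1))) (g := r)); last exact: r_cont.
  apply: pair_continuous; apply: (@cvgN _ _ _ (nbhs p)); [exact: cos_pi_cont|exact: sin_pi_cont].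
apply: ray_cont => //; apply: (@cvgB _ _ _ (nbhs p)) => //.
apply: (@cvgM _ _ (nbhs p)).
  by apply: (@cvgD _ _ _ (nbhs p)) => //; apply: r_ray_cont.
apply: (@cvgM _ _ (nbhs p)) => //; apply: (@cvgV _ _ (nbhs p)); first by rewrite gt_eqF ?exp1_gt0.
by apply: (@cvgD _ _ _ (nbhs p)) => //; exact: cvg_cst.
Qed.

Let out_rayK v : gauge v < 0 -> gauge (- v) < 0 -> forall c x, 0 < c ->
  da v = c * cos (pi * x) -> db v = c * sin (pi * x) ->
  out_ray (x, ln (ratio v)) = toP v.
Proof.
move=> gv gNv c x c0 h1 h2.
have rp : 0 < ratio v by rewrite /ratio nmulr_rgt0 ?invr_lt0.
rewrite /out_ray /= lnK ?posrE //.
have -> : toP v = toP (c^-1 *: mk (da v) (db v) (v 0 ord_max)).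
  by rewrite mk_eta toPZ // invr_eq0 gt_eqF.
rewrite -mkZ h1 h2.
rewrite /ray !mulKf ?gt_eqF //; congr (toP (mk _ _ _)).
have ci : 0 < c^-1 by rewrite invr_gt0.
have e1 : cos (pi * x) = c^-1 * da v by rewrite h1 mulKf ?gt_eqF.
have e2 : sin (pi * x) = c^-1 * db v by rewrite h2 mulKf ?gt_eqF.
rewrite /wid e1 e2 -!mulrN !r_hom // -daN -dbN.
have E1 : r (da v, db v) = v 0 ord_max - gauge v by rewrite /gauge opprB addrC subrK.
have E2 : r (da (- v), db (- v)) = - v 0 ord_max - gauge (- v).
  by rewrite /gauge mxE opprB addrC subrK.
rewrite E1 E2 /ratio; have n1 : gauge v != 0 by rewrite lt_eqF.
have n2 : gauge v + gauge (- v) != 0 by rewrite lt_eqF // -[ltRHS]addr0 ltrD.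
by field; rewrite (gt_eqF c0) n1 n2.
Qed.

Let out_coord_cont (x : P2 R) : star_out gauge x -> {for x, continuous out_coord}.
Proof.
move=> [gx gNx]; rewrite -(hcK x); set v := hc x in gx gNx *.
have v0 : v != 0 by apply: hc_neq0.
have [c [y [c0 h1 h2]]] := polar (out_dir gx gNx).
(* [ang] is not continuous. Near [v] it is replaced by [y] plus an arctangent, computed after
   rotating the direction of [v] to the first axis, so that the first coordinate [al] stays
   positive. *)
pose al w := da w * cos (pi * y) + db w * sin (pi * y).
pose be w := db w * cos (pi * y) - da w * sin (pi * y).
have al_cont : {for v, continuous al}.
  apply: (@cvgD _ _ _ (nbhs v)); apply: (@cvgM _ _ (nbhs v)); [exact: da_cont|exact: cvg_cst|exact: db_cont|exact: cvg_cst].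
have be_cont : {for v, continuous be}.
  apply: (@cvgB _ _ _ (nbhs v)); apply: (@cvgM _ _ (nbhs v)); [exact: db_cont|exact: cvg_cst|exact: da_cont|exact: cvg_cst].
have alv : 0 < al v.
  by rewrite /al h1 h2 -!mulrA -mulrDr -!expr2 cos2Dsin2 mulr1.
have pi0 : pi != 0 :> R by rewrite gt_eqF // pi_gt0.
pose th w := atan (be w / al w).
have thE w : 0 < al w -> exists2 k, 0 < k & da w = k * cos (pi * (y + th w / pi)) /\
    db w = k * sin (pi * (y + th w / pi)).
  move=> aw; have [/andP[t1 t2] tE] := atan_def (be w / al w).
  have ct : 0 < cos (th w) by rewrite cos_gt0_pihalf // t1.
  have st : sin (th w) = be w / al w * cos (th w) by rewrite -tE /tan mulfVK // gt_eqF.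
  have cs := cos2Dsin2 (pi * y).
  exists (al w / cos (th w)); first exact: divr_gt0.
  rewrite mulrDr (mulrC pi (_ / _)) mulfVK // cosD sinD st.
  have e1 : da w = al w * cos (pi * y) - be w * sin (pi * y).
    rewrite /al /be -[LHS]mulr1 -cs; ring.
  have e2 : db w = al w * sin (pi * y) + be w * cos (pi * y).
    rewrite /al /be -[LHS]mulr1 -cs; ring.
  by rewrite {1}e1 {1}e2; split; field; rewrite !gt_eqF.
have rat_v : 0 < ratio v by rewrite /ratio nmulr_rgt0 ?invr_lt0.
have rat_cont : {for v, continuous ratio}.
  apply: (@cvgM _ _ (nbhs v)); first exact: (g_contN gauge_cont).
  by apply: (@cvgV _ _ (nbhs v)); [rewrite lt_eqF|exact: gauge_cont].
have chart_cont : {for v, continuous (fun w => toM (y + th w / pi, ln (ratio w)))}.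
  apply: (continuous_comp (f := fun w => (y + th w / pi, ln (ratio w))) (g := @toM R)); last exact: toM_continuous.
  apply: pair_continuous.
    apply: (@cvgD _ _ _ (nbhs v)); first exact: cvg_cst.
    apply: (@cvgM _ _ (nbhs v)); last exact: cvg_cst.
    apply: (continuous_comp (f := fun w => be w / al w)); last exact: continuous_atan.
    apply: (@cvgM _ _ (nbhs v)); first exact: be_cont.
    by apply: (@cvgV _ _ (nbhs v)); [rewrite gt_eqF|exact: al_cont].
  by apply: (continuous_comp (f := ratio)); [exact: rat_cont|exact: continuous_ln].
have chartE w : gauge w < 0 -> gauge (- w) < 0 -> 0 < al w ->
    out_coord (toP w) = toM (y + th w / pi, ln (ratio w)).
  by move=> g1 g2 /thE[k k0 [e1 e2]]; apply: (out_coordE g1 g2 k0).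
apply/(cvg_toP _ _ v0); rewrite chartE //; move: chart_cont; apply: cvg_trans; apply: near_eq_cvg.
near=> w; apply/esym/chartE.
- by near: w; have /cvgr_lt/(_ _ gx) := @gauge_cont v.
- by near: w; have /cvgr_lt/(_ _ gNx) := @g_contN _ _ gauge_cont v.
- by near: w; have /cvgr_gt/(_ _ alv) := al_cont.
Unshelve. all: by end_near. Qed.

Lemma star_out_mobius : homeomorphic (star_out gauge) [set: mobius R].
Proof.
exists out_coord, (fun y => out_ray (reprM y)); split.
- by apply: continuous_in_subspaceT => x; rewrite inE; apply: out_coord_cont.
- apply: continuous_subspaceT => y; rewrite -(reprMK y) => A.
  rewrite out_rayE => /out_ray_cont HA; apply/nbhs_toM.
  have : \forall q \near reprM y, A (out_ray q) by exact: HA.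
  by apply: filterS => q /=; rewrite out_rayE.
- move=> x [gx gNx]; split=> //; have [c [y [c0 h1 h2]]] := polar (out_dir gx gNx).
  rewrite -[in RHS](hcK x) -[in LHS](hcK x) (out_coordE gx gNx c0 h1 h2) out_rayE.
  exact: (out_rayK gx gNx c0 h1 h2).
move=> y _; rewrite -(reprMK y); case: (reprM y) => x t; rewrite out_rayE.
have [v0 gv gNv rv] := out_ray_vec x t; split.
  exact/(star_outP gauge_hom).
rewrite /out_ray /ray /= (out_coordE gv gNv (@ltr01 R) (x := x)) ?mul1r ?da_mk ?db_mk //.
by rewrite rv expRK.
Qed.

Lemma star_out_connected : connected (star_out gauge).
Proof.
have [f [h [_ ch _ hP]]] := star_out_mobius.
have -> : star_out gauge = out_ray @` [set: R * R].
  rewrite predeqE => x; split.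
    move=> [gx gNx]; have [c [y [c0 h1 h2]]] := polar (out_dir gx gNx).
    exists (y, ln (ratio (hc x))) => //.
    by rewrite (out_rayK gx gNx c0 h1 h2) hcK.
  move=> [[y t] _ <-]; have [v0 gv gNv rv] := out_ray_vec y t.
  exact/(star_outP gauge_hom).
apply: connected_continuous_connected; last exact: continuous_subspaceT.
have -> : [set: R * R] = \bigcup_(p in [set: R * R]) ((fun t : R => (t * p.1, t * p.2)) @` [set: R]).
  rewrite predeqE => -[a b]; split=> // _; exists (a, b) => //; exists 1 => //=.
  by rewrite !mul1r.
apply: bigcup_connected; first by exists (0, 0) => p _; exists 0; rewrite // !mul0r.
move=> p _; apply: connected_continuous_connected.
  by apply/connected_intervalP => a b _ _ c _.
apply: continuous_subspaceT => t; apply: (@pair_continuous R R R (fun t : R => t * p.1) (fun t : R => t * p.2));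
  apply: (@cvgM _ _ (nbhs t)); [exact: cvg_id|exact: cvg_cst|exact: cvg_id|exact: cvg_cst].
Qed.

End Gauge.

(** * A loop that is not contractible *)

Section RealContinuity.
Variables (R : realType) (T : topologicalType).

Lemma contD (f g : T -> R) y : {for y, continuous f} -> {for y, continuous g} ->
  {for y, continuous (fun z => f z + g z)}.
Proof. exact: cvgD. Qed.

Lemma contM (f g : T -> R) y : {for y, continuous f} -> {for y, continuous g} ->
  {for y, continuous (fun z => f z * g z)}.
Proof. exact: cvgM. Qed.

End RealContinuity.

Section NotSimplyConnected.
Variable R : realType.
Implicit Types (v w u : 'rV[R]_3) (p q x : P2 R) (s t h : R).

Lemma dot_gt0 v : v != 0 -> 0 < dot v v.
Proof.
move=> v0; rewrite /dot -!expr2 lt_neqAle !addr_ge0 ?sqr_ge0 // andbT eq_sym.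
apply: contra_neq v0 => /eqP; rewrite !paddr_eq0 ?addr_ge0 ?sqr_ge0 // !sqrf_eq0.
by move=> /andP[/andP[/eqP h0 /eqP h1] /eqP h2]; apply: row3P; rewrite mxE.
Qed.

(** Entries of the orthogonal projector onto the line [p]: they are invariant under scaling and so,
    unlike [hc], continuous on the projective plane. *)
Definition proj_entry (i j : 'I_3) p : R := hc p 0 i * hc p 0 j / dot (hc p) (hc p).

Definition proj p v : 'rV[R]_3 :=
  row3 (proj_entry 0 0 p * v 0 0 + proj_entry 0 1 p * v 0 1 + proj_entry 0 ord_max p * v 0 ord_max)
       (proj_entry 1 0 p * v 0 0 + proj_entry 1 1 p * v 0 1 + proj_entry 1 ord_max p * v 0 ord_max)
       (proj_entry ord_max 0 p * v 0 0 + proj_entry ord_max 1 p * v 0 1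
          + proj_entry ord_max ord_max p * v 0 ord_max).

Lemma projE u v : u != 0 -> proj (toP u) v = (dot u v / dot u u) *: u.
Proof.
move=> u0; rewrite /proj /proj_entry; have [c c0 ->] := hc_toP u0.
have := dot_gt0 u0; rewrite dotZl dotZr /dot => d0.
by apply: row3P; rewrite !mxE /=; field; rewrite c0 gt_eqF.
Qed.

Lemma proj_entryE i j u : u != 0 -> proj_entry i j (toP u) = u 0 i * u 0 j / dot u u.
Proof.
move=> u0; rewrite /proj_entry; have [c c0 ->] := hc_toP u0.
have := dot_gt0 u0; rewrite dotZl dotZr => d0; rewrite !mxE.
by field; rewrite c0 gt_eqF.
Qed.

Lemma dot_cont v : {for v, continuous (fun w => dot w w)}.
Proof.
by apply: (@cvgD _ _ _ (nbhs v)); [apply: (@cvgD _ _ _ (nbhs v))|]; apply: (@cvgM _ _ (nbhs v)); apply: coord_cvg.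
Qed.

Lemma proj_entry_cont i j : continuous (proj_entry i j).
Proof.
move=> x; rewrite -(hcK x); set u := hc x; have u0 : u != 0 by apply: hc_neq0.
apply/(cvg_toP _ _ u0); rewrite proj_entryE //.
have H : {for u, continuous (fun w => w 0 i * w 0 j / dot w w)}.
  apply: (@cvgM _ _ (nbhs u)); first by apply: (@cvgM _ _ (nbhs u)); apply: coord_cvg.
  by apply: (@cvgV _ _ (nbhs u)); [rewrite gt_eqF // dot_gt0|apply: dot_cont].
move: H; apply: cvg_trans; apply: near_eq_cvg.
by have := nbhs_neq0 u0; apply: filterS => w w0; rewrite proj_entryE.
Qed.

Lemma proj_cont (T : topologicalType) (fp : T -> P2 R) (fv : T -> 'rV[R]_3) (y : T) :
  {for y, continuous fp} -> {for y, continuous fv} ->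
  {for y, continuous (fun z => proj (fp z) (fv z))}.
Proof.
move=> hp hv.
have he i j : {for y, continuous (fun z => proj_entry i j (fp z))}.
  by apply: (continuous_comp (f := fp)) => //; apply: proj_entry_cont.
have hc i : {for y, continuous (fun z => fv z 0 i)}.
  by apply: (continuous_comp (f := fv) (g := fun w : 'rV[R]_3 => w 0 i)) => //; apply: coord_cvg.
have hm i j : {for y, continuous (fun z => proj_entry i j (fp z) * fv z 0 j)}.
  exact: (@cvgM _ _ (nbhs y) _ _ _ _ _ (he i j) (hc j)).
by apply: (@cvg_row3 _ _ (nbhs y)); do 2?apply: (@cvgD _ _ _ (nbhs y)); apply: hm.
Qed.

Lemma clamp_extension (T : topologicalType) (H : R * R -> T) :
  {within `[0, 1]%classic `*` `[0, 1]%classic, continuous H} ->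
  continuous (fun y => H (clamp y.1, clamp y.2)).
Proof.
move=> /subspace_continuousP cH y.
have sq : (`[0, 1]%classic `*` `[0, 1]%classic) (clamp y.1, clamp y.2).
  by split; apply: clamp_in.
move=> A /(cH _ sq) HA.
have C : {for y, continuous (fun z : R * R => (clamp z.1, clamp z.2))}.
  apply: (@pair_continuous _ R R (fun z : R * R => clamp z.1) (fun z : R * R => clamp z.2)).
    by apply: (continuous_comp (f := fst)); [exact: cvg_fst|exact: clamp_cont].
  by apply: (continuous_comp (f := snd)); [exact: cvg_snd|exact: clamp_cont].
have HB : \forall z \near (clamp y.1, clamp y.2),
    (`[0, 1]%classic `*` `[0, 1]%classic) z -> A (H z) by exact: HA.
have HC : \forall z \near y, (`[0, 1]%classic `*` `[0, 1]%classic) (clamp z.1, clamp z.2) ->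
    A (H (clamp z.1, clamp z.2)) by exact: (C _ HB).
by move: HC; apply: filterS => z; apply; split; apply: clamp_in.
Qed.

Lemma sum_cont (T : topologicalType) (I : Type) (r : seq I) (f : I -> T -> R) (y : T) :
  (forall i, {for y, continuous (f i)}) ->
  {for y, continuous (fun z => \sum_(i <- r) f i z)}.
Proof.
move=> hf; elim: r => [|i r IHr].
  rewrite (_ : (fun z => _) = fun=> 0); first exact: cst_continuous.
  by apply/funext => z; rewrite big_nil.
rewrite (_ : (fun z => _) = fun z => f i z + \sum_(j <- r) f j z).
  by apply: (@cvgD _ _ _ (nbhs y)); [exact: hf|exact: IHr].
by apply/funext => z; rewrite big_cons.
Qed.

(* The squared cosine of the angle between two lines of R^3. *)
Let kappa p q : R := \sum_i \sum_j proj_entry i j p * proj_entry i j q.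

Let kappaE p q : kappa p q = dot (hc p) (hc q) ^+ 2 / (dot (hc p) (hc p) * dot (hc q) (hc q)).
Proof.
rewrite /kappa; under eq_bigr do rewrite !big_ord_recl big_ord0.
rewrite !big_ord_recl big_ord0 /proj_entry.
have := dot_gt0 (hc_neq0 p); have := dot_gt0 (hc_neq0 q).
have -> : lift ord0 ord0 = 1 :> 'I_3 by apply: val_inj.
have -> : lift ord0 (lift ord0 ord0) = ord_max :> 'I_3 by apply: val_inj.
rewrite /dot => h1 h2; field.
by rewrite !gt_eqF.
Qed.

(* A homotopy from t |-> toP (w t) to a constant loop is lifted to R^3 by
   successive orthogonal projections onto its lines at the points i / (n + 1) of a
   fine subdivision, starting from a fixed vector.  The scalar product of the last
   projection with that vector never vanishes, although it is negative for the
   given loop and positive for the constant one. *)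
Lemma not_simply_connected (U : set (P2 R)) (w : R -> 'rV[R]_3) :
  continuous w -> (forall t, w t != 0) -> w 1 = - w 0 -> (forall t, U (toP (w t))) ->
  ~ simply_connected R U.
Proof.
move=> wc w0 w1 Uw [_ _ sc]; pose x := toP (w 0).
have xE : toP (w 1) = x by rewrite w1 -scaleN1r toPZ // oppr_eq0 oner_eq0.
have [|H [cH _ H0 Hx]] := sc x (fun t => toP (w t)).
  split=> //; apply: continuous_subspaceT => t.
  by apply: (continuous_comp (f := w)); [exact: wc|exact: toP_continuous].
pose K y := H (clamp y.1, clamp y.2).
have Kc : continuous K by exact: clamp_extension.
have in0 : (0 : R) \in `[0, 1] by rewrite in_itv /= lexx ler01.
have in1 : (1 : R) \in `[0, 1] by rewrite in_itv /= lexx ler01.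
have K0 t : t \in `[0, 1] -> K (0, t) = toP (w t).
  by move=> ti; rewrite /K /= !clampE //; have [] := H0 t ti.
have K1 t : K (1, t) = x.
  by rewrite /K /= (clampE in1); have [] := H0 _ (clamp_in t).
have Kx0 s : K (s, 0) = x.
  by rewrite /K /= (clampE in0); have [] := Hx _ (clamp_in s).
have Kx1 s : K (s, 1) = x.
  by rewrite /K /= (clampE in1); have [] := Hx _ (clamp_in s).
(* By compactness one bound on the step [h] serves for the whole square: lines that close in the
   loop parameter are never orthogonal, so projecting from one to the next does not kill a nonzero
   vector. *)
have unifK : \forall h \near (0 : R), forall y, (`[0, 1]%classic `*` `[0, 1]%classic) y ->
    kappa (K y) (K (y.1, y.2 + h)) != 0.
  have /compact_near_coveringP C : compact (`[(0 : R), 1]%classic `*` `[(0 : R), 1]%classic).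
    by apply: compact_setX; apply: segment_compact.
  apply: (C R (nbhs 0) (fun h y => kappa (K y) (K (y.1, y.2 + h)) != 0)) => y _.
  pose phi (z : (R * R) * R) := kappa (K z.1) (K (z.1.1, z.1.2 + z.2)).
  have phi_c : {for (y, 0), continuous phi}.
    have c1 : {for (y, 0), continuous (fun z : (R * R) * R => K z.1)}.
      by apply: (continuous_comp (f := fst)); [exact: cvg_fst|exact: Kc].
    have c2 : {for (y, 0), continuous (fun z : (R * R) * R => K (z.1.1, z.1.2 + z.2))}.
      apply: (continuous_comp (f := fun z : (R * R) * R => (z.1.1, z.1.2 + z.2)) (g := K)); last exact: Kc.
      apply: (@pair_continuous _ R R (fun z : (R * R) * R => z.1.1) (fun z => z.1.2 + z.2)).
        by apply: (continuous_comp (f := fst) (g := fst)); exact: cvg_fst.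
      apply: (@contD R _ (fun z : (R * R) * R => z.1.2) snd); last exact: cvg_snd.
      by apply: (continuous_comp (f := fst) (g := snd)); [exact: cvg_fst|exact: cvg_snd].
    rewrite /phi /kappa; apply: sum_cont => i; apply: sum_cont => j.
    apply: contM.
      by apply: (continuous_comp (f := fun z : (R * R) * R => K z.1)) => //; apply: proj_entry_cont.
    by apply: (continuous_comp (f := fun z : (R * R) * R => K (z.1.1, z.1.2 + z.2))) => //; apply: proj_entry_cont.
  have p1 : 0 < phi (y, 0).
    rewrite /phi /= addr0 -surjective_pairing kappaE.
    by rewrite divr_gt0 ?exprn_gt0 ?mulr_gt0 ?dot_gt0 ?hc_neq0.
  have /cvgr_gt/(_ _ p1) := phi_c.
  move=> [[A B] /= [nA nB] AB]; exists (A, B); first by split.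
  move=> -[y' h] [/= Ay Bh].
  by have := AB (y', h) (conj Ay Bh); rewrite /phi /= => /lt0r_neq0.
(* For the given loop the lift [w] itself is at hand; acute angles between its successive values
   make each of them project to a positive multiple of the next. *)
have unifw : \forall h \near (0 : R), forall t, `[0, 1]%classic t -> 0 < dot (w t) (w (t + h)).
  have /compact_near_coveringP C : compact `[(0 : R), 1]%classic by apply: segment_compact.
  apply: (C R (nbhs 0) (fun h t => 0 < dot (w t) (w (t + h)))) => t _.
  pose phi (z : R * R) := dot (w z.1) (w (z.1 + z.2)).
  have phi_c : {for (t, 0), continuous phi}.
    have c1 i : {for (t, 0), continuous (fun z : R * R => w z.1 0 i)}.
      apply: (continuous_comp (f := fst) (g := fun s => w s 0 i)); first exact: cvg_fst.
      by apply: (continuous_comp (f := w) (g := fun v : 'rV[R]_3 => v 0 i)); [exact: wc|exact: coord_cvg].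
    have c2 i : {for (t, 0), continuous (fun z : R * R => w (z.1 + z.2) 0 i)}.
      apply: (continuous_comp (f := fun z : R * R => z.1 + z.2) (g := fun s => w s 0 i)).
        by apply: (@contD R _ fst snd); [exact: cvg_fst|exact: cvg_snd].
      by apply: (continuous_comp (f := w) (g := fun v : 'rV[R]_3 => v 0 i)); [exact: wc|exact: coord_cvg].
    by apply: contD; [apply: contD|]; apply: contM; by [apply: c1|apply: c2].
  have p1 : 0 < phi (t, 0) by rewrite /phi /= addr0 dot_gt0.
  have /cvgr_gt/(_ _ p1) := phi_c.
  move=> [[A B] /= [nA nB] AB]; exists (A, B); first by split.
  move=> -[t' h] [/= At Bh].
  exact: (AB (t', h) (conj At Bh)).
have [n [hK hw]] : exists n : nat,
    (forall y, (`[0, 1]%classic `*` `[0, 1]%classic) y -> kappa (K y) (K (y.1, y.2 + n.+1%:R^-1)) != 0) /\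
    (forall t, `[0, 1]%classic t -> 0 < dot (w t) (w (t + n.+1%:R^-1))).
  pose P h := (forall y, (`[0, 1]%classic `*` `[0, 1]%classic) y ->
     kappa (K y) (K (y.1, y.2 + h)) != 0) /\ (forall t, `[0, 1]%classic t -> 0 < dot (w t) (w (t + h))).
  have HF : \forall h \near (0 : R), P h by near=> h; split; near: h.
  have /filter_ex[n Pn] : \forall n \near \oo, P (harmonic n) by exact: (cvg_harmonic HF).
  by exists n.
pose tt i : R := i%:R / n.+1%:R.
have tt_in i : (i <= n.+1)%N -> tt i \in `[0, 1].
  by move=> ni; rewrite in_itv /= divr_ge0 //= ler_pdivrMr ?ltr0n // mul1r ler_nat.
have ttS i : tt i.+1 = tt i + n.+1%:R^-1 by rewrite /tt -[i.+1]addn1 natrD mulrDl mul1r.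
have tt0 : tt 0%N = 0 by rewrite /tt mul0r.
have ttn : tt n.+1 = 1 by rewrite /tt divff // pnatr_eq0.
pose fix W s i := if i is i'.+1 then proj (K (s, tt i)) (W s i') else hc x.
have Wc i : continuous (W^~ i).
  elim: i => [|i IHi] s; first exact: cst_continuous.
  apply: (@proj_cont R (fun s => K (s, tt i.+1)) (W^~ i) s); last exact: IHi.
  apply: (continuous_comp (f := fun s => (s, tt i.+1)) (g := K)); last exact: Kc.
  by apply: (@pair_continuous R R R (fun s => s) (fun=> tt i.+1)); [exact: cvg_id|exact: cvg_cst].
have WE s i : s \in `[0, 1] -> (i <= n.+1)%N ->
    exists2 c, c != 0 & W s i = c *: hc (K (s, tt i)).
  move=> si; elim: i => [|i IHi] ni.
    by exists 1; rewrite ?oner_eq0 // tt0 Kx0 scale1r.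
  have [c c0 E] := IHi (ltnW ni).
  have /hK : (`[0, 1]%classic `*` `[0, 1]%classic) (s, tt i) by split => //=; apply: tt_in; apply: ltnW.
  rewrite /= -ttS kappaE => kn.
  exists (c * (dot (hc (K (s, tt i.+1))) (hc (K (s, tt i))) / dot (hc (K (s, tt i.+1))) (hc (K (s, tt i.+1))))).
    rewrite !mulf_neq0 //; last by rewrite invr_eq0 gt_eqF // dot_gt0 // hc_neq0.
    by apply: contra_neq kn; rewrite dotC => ->; rewrite expr0n mul0r.
  rewrite /= -/(W s i) E -{1}(hcK (K (s, tt i.+1))) projE ?hc_neq0 //.
  by rewrite dotZr mulrA.
pose T s := dot (W s n.+1) (hc x).
have Tc : continuous T.
  move=> s; have c1 i : {for s, continuous (fun s => W s n.+1 0 i * hc x 0 i)}.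
    apply: (@cvgM _ _ (nbhs s)); last exact: cvg_cst.
    by apply: (continuous_comp (f := W^~ n.+1) (g := fun v : 'rV[R]_3 => v 0 i)); [exact: Wc|exact: coord_cvg].
  by apply: (@cvgD _ _ _ (nbhs s)); [apply: (@cvgD _ _ _ (nbhs s))|]; apply: c1.
have T_neq0 s : s \in `[0, 1] -> T s != 0.
  move=> si; have [c c0 E] := WE s n.+1 si (leqnn _).
  by rewrite /T E ttn Kx1 dotZl mulf_neq0 // gt_eqF // dot_gt0 // hc_neq0.
have T1 : 0 < T 1.
  have W1 i : W 1 i = hc x.
    elim: i => [//|i IHi]; rewrite /= -/(W 1 i) IHi K1 -{1}(hcK x) projE ?hc_neq0 //.
    by rewrite divff ?scale1r // gt_eqF // dot_gt0 // hc_neq0.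
  by rewrite /T W1 dot_gt0 // hc_neq0.
have [c0 c0n xw] : exists2 c, c != 0 & hc x = c *: w 0 by apply: hc_toP.
have T0 : T 0 < 0.
  (* The vectors [W 0 i] follow [w] with a factor of the sign of [c0], and so end at a multiple of
     [w 1], which is [- w 0]. *)
  have W0 i : (i <= n.+1)%N -> exists2 c, 0 < c * c0 & W 0 i = c *: w (tt i).
    elim: i => [|i IHi] ni.
      by exists c0; rewrite ?tt0 // -expr2 exprn_even_gt0.
    have [c cc E] := IHi (ltnW ni).
    have /hw d0 : `[0, 1]%classic (tt i) by apply: tt_in; apply: ltnW.
    rewrite -ttS in d0.
    exists (c * (dot (w (tt i.+1)) (w (tt i)) / dot (w (tt i.+1)) (w (tt i.+1)))).
      by rewrite mulrAC mulr_gt0 // divr_gt0 ?dot_gt0 // dotC.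
    by rewrite /= -/(W 0 i) E K0 ?tt_in // projE // dotZr mulrA.
  have [c cc E] := W0 n.+1 (leqnn _).
  rewrite /T E ttn w1 xw dotZl dotZr dotC dotNr !mulrN oppr_lt0 mulrA mulr_gt0 //.
  exact: dot_gt0.
have Tb : Num.min (T 0) (T 1) <= 0 <= Num.max (T 0) (T 1).
  by rewrite ge_min le_max (ltW T0) (ltW T1) orbT.
have [s si] := IVT ler01 (continuous_subspaceT Tc) Tb.
by move/eqP; apply/negP; apply: T_neq0.
Unshelve. all: by end_near. Qed.

End NotSimplyConnected.

(** * The root functions *)

Section AdjointRoots.
Variables (R : realType) (k : nat) (v : 'I_k -> 'rV[R]_2) (F : dhomog 3 R (k - 3)).
Hypotheses (k4 : (4 <= k)%N) (aF : adjoint_curve v F).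
Variables (sg : R) (N : 'I_k -> 'rV[R]_3).
Hypothesis G : gon sg N (fun i => homogenize (v i)).
Local Notation V := (fun i => homogenize (v i)).
Local Notation l i x := (dot (N i) x).
Implicit Types (i j h : 'I_k) (x d e : 'rV[R]_3).

Lemma eval_atZ c x : eval_at F (c *: x) = c ^+ (k - 3) * eval_at F x.
Proof. exact: meval_homog (dhomog_is_dhomog F). Qed.

Lemma edge_lineP i (y : P2 R) : edge_line v i y <-> l i (hc y) = 0.
Proof.
have [h1 h2] := gon_0 G i; split.
  rewrite /edge_line /= => /sub_addsmxP[[A B] /= ->].
  by rewrite dotDr (mx11_scalar A) (mx11_scalar B) !mul_scalar_mx !dotZr h1 h2 !mulr0 addr0.
move=> /(edge_span k4 G)[a [b E]]; rewrite /edge_line /= E.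
by rewrite addmx_sub // scalemx_sub // ?addsmxSl ?addsmxSr.
Qed.

Lemma real_locus_toP x : x != 0 -> real_locus F (toP x) <-> eval_at F x = 0.
Proof.
move=> x0; apply: (hc_toPP (Q := fun x => eval_at F x = 0)) => // c y _ _ E.
by rewrite eval_atZ E mulr0.
Qed.

Lemma adjoint_residual i j x : nonadjacent i j -> x != 0 -> l i x = 0 -> l j x = 0 ->
  eval_at F x = 0.
Proof.
case/and3P=> ji jS iS x0 li lj; have [_ res] := aF.
apply/(real_locus_toP x0)/res; exists i, j; have [c c0 E] := hc_toP x0.
by split; rewrite // 1?eq_sym //; apply/edge_lineP; rewrite E dotZr ?li ?lj mulr0.
Qed.

(** The edge coefficients share a sign, and passing from [F] to its opposite changes neither the
    curve nor the roots along a line. *)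
Lemma adjoint_sign : exists (q : mpoly 3 R) (c : 'I_k -> R),
  [/\ q = F \/ q = - (F : mpoly 3 R), q \is ishomog1 (k - 3) mdeg, forall i, 0 < c i
    & forall i x, l i x = 0 ->
        meval (fun a => x 0 a) q = c i * \prod_(j | nonadjacent i j) l j x].
Proof.
pose c := edge_coef k4 G (dhomog_is_dhomog F) adjoint_residual.
have F0 : (F : mpoly 3 R) != 0.
  by have [F0 _] := aF; apply: contra_neq F0 => E; apply: val_inj.
have cn i : c i != 0 := edge_coef_neq0 _ _ _ _ F0 i.
pose i0 : 'I_k := Ordinal (leq_trans (isT : (0 < 4)%N) k4).
have cs i : exists2 t, 0 < t & c i = t * c i0 := edge_coef_sign _ _ _ _ i0 i.
have cE i x : l i x = 0 -> eval_at F x = c i * \prod_(j | nonadjacent i j) l j x.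
  exact: edge_coefE.
case: (ltrgtP (c i0) 0) (cn i0) => // ci _.
  exists (- (F : mpoly 3 R)), (fun i => - c i); split.
  - by right.
  - by rewrite dhomogN dhomog_is_dhomog.
  - by move=> i; have [t t0 ->] := cs i; rewrite oppr_gt0 pmulr_rlt0.
  - by move=> i x li; rewrite mevalN -/(eval_at F x) (cE i x li) mulNr.
exists (F : mpoly 3 R), c; split=> //.
- by left.
- exact: dhomog_is_dhomog.
- by move=> i; have [t t0 ->] := cs i; rewrite mulr_gt0.
Qed.

Lemma adjoint_roots e d : (forall h, 0 < l h e) -> (forall s, d + s *: e != 0) ->
  eval_at F e != 0 /\ exists r : nat -> R,
  [/\ forall a b, (a < b)%N -> (b < k - 3)%N -> r a < r b,
     forall s, eval_at F (d + s *: e) = eval_at F e * \prod_(a < k - 3) (s - r a),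
     forall s, (forall h, 0 <= l h (d + s *: e)) -> forall a, (a < k - 3)%N -> r a < s
   & forall i j s, nonadjacent i j -> l i (d + s *: e) = 0 -> l j (d + s *: e) = 0 ->
       (0 < npos N (d + s *: e) <= k - 3)%N /\ s = r (npos N (d + s *: e)).-1].
Proof.
move=> e0 de; have [q [c [qF qh c0 qc]]] := adjoint_sign.
have [r [r1 r2 r3 r4 r5]] := interlace k4 G qh c0 qc e0 de.
case: qF r2 r3 => -> r2 r3; first by split; [apply: lt0r_neq0|exists r].
have E x : eval_at F x = - meval (fun a => x 0 a) (- (F : mpoly 3 R)) by rewrite mevalN opprK.
split; first by rewrite E oppr_eq0 lt0r_neq0.
by exists r; split=> // s; rewrite !E r2 mulNr.
Qed.

End AdjointRoots.

(** Used to match two increasing lists of roots index by index: it suffices to send each root of one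
    list, in increasing fashion, to some root of the other. *)
Lemma incr_self_id (n : nat) (f : nat -> nat) :
  (forall a b, (a < b)%N -> (b < n)%N -> (f a < f b)%N) ->
  (forall a, (a < n)%N -> (f a < n)%N) -> forall a, (a < n)%N -> f a = a.
Proof.
move=> finc fn.
have lo a : (a < n)%N -> (a <= f a)%N.
  elim: a => // a IHa an; apply: (leq_ltn_trans (IHa (ltnW an))); exact: finc.
have hi m : forall a, (a < n)%N -> n = (a + m)%N -> (f a + m <= n)%N.
  elim: m => [|m IHm] a an E; first by rewrite addn0 ltnW // fn.
  case: (ltnP a.+1 n) => h.
    have := IHm a.+1 h; rewrite addSnnS -E => /(_ erefl); have := finc a a.+1 (ltnSn a) h; lia.
  by have := fn a an; lia.
move=> a an; apply/eqP; rewrite eqn_leq lo // andbT.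
by have := hi (n - a)%N a an; rewrite subnKC ?(ltnW an) // => /(_ erefl); lia.
Qed.

Section SortedRoots.
Variable R : realType.
Implicit Types (r : nat -> R) (n : nat).

Definition increasing n r := forall a b, (a < b)%N -> (b < n)%N -> r a < r b.

Lemma increasing_roots_unique n r r' : increasing n r -> increasing n r' ->
  (forall s, \prod_(a < n) (s - r a) = \prod_(a < n) (s - r' a)) ->
  forall a, (a < n)%N -> r a = r' a.
Proof.
move=> ir ir' E.
have /choice[f fP] : forall a, exists b, (a < n)%N -> (b < n)%N /\ r a = r' b.
  move=> a; case: (ltnP a n) => an; last by exists 0%N.
  have /eqP : \prod_(b < n) (r a - r' b) = 0.
    by rewrite -E (bigD1 (Ordinal an)) //= subrr mul0r.
  by move=> /prodf_eq0[b _]; rewrite subr_eq0 => /eqP rb; exists b.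
have fid := @incr_self_id n f _ _.
move=> a an; have [_ ->] := fP a an; rewrite fid // => [b c bc cn|b bn]; last by have [] := fP b bn.
have [fb rb] := fP b (ltn_trans bc cn); have [fc rc] := fP c cn.
have := ir b c bc cn; rewrite rb rc; case: (ltngtP (f b) (f c)) => // [cb|->]; last by rewrite ltxx.
by move=> h; have := lt_trans h (ir' _ _ cb fb); rewrite ltxx.
Qed.

(** Around each root at [x0], an interval of half-width [u], less than half of every gap, shows a
    change of sign that persists nearby. These disjoint intervals thus each contain a nearby root,
    and [incr_self_id] forces it to carry the same index. *)
Lemma increasing_roots_cont (T : topologicalType) n (f : T -> R -> R) (c : R)
    (r : T -> nat -> R) (x0 : T) : c != 0 ->
  (\forall x \near x0, increasing n (r x)) ->
  (\forall x \near x0, forall s, f x s = c * \prod_(a < n) (s - r x a)) ->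
  (forall s, {for x0, continuous (fun x => f x s)}) ->
  forall a, (a < n)%N -> {for x0, continuous (fun x => r x a)}.
Proof.
move=> c0 ir fE fc a0 a0n; apply/cvgrPdist_lt => eps eps0.
have ir0 := nbhs_singleton ir; have fE0 := nbhs_singleton fE.
have [u [u0 ue ug]] : exists u : R, [/\ 0 < u, u <= eps &
    forall a, (a < n)%N -> forall b, (b < a)%N -> 2 * u < r x0 a - r x0 b].
  have H : \forall u \near 0^'+, forall a, (a < n)%N -> forall b, (b < a)%N -> 2 * u < r x0 a - r x0 b.
    apply: near_ordinal => a an; apply: near_ordinal => b ba; near=> u.
    have : u < (r x0 a - r x0 b) / 2.
      by near: u; apply: nbhs_right_lt; rewrite divr_gt0 // subr_gt0 ir0.
    by lra.
  have : \forall u \near 0^'+, [/\ 0 < u, u <= eps &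
    forall a, (a < n)%N -> forall b, (b < a)%N -> 2 * u < r x0 a - r x0 b].
    by near=> u; split; near: u; [exact: nbhs_right_gt|exact: nbhs_right_le|exact: H].
  by move=> /filter_ex[u [h1 h2 h3]]; exists u.
have neg a : (a < n)%N -> f x0 (r x0 a - u) * f x0 (r x0 a + u) < 0.
  move=> an; rewrite !fE0 mulrACA -big_split /= pmulr_rlt0; last first.
    by rewrite -expr2 exprn_even_gt0.
  rewrite (bigD1 (Ordinal an)) //= pmulr_llt0.
    rewrite (_ : _ * _ = - (u * u)); last by ring.
    by rewrite oppr_lt0 mulr_gt0.
  apply: prodr_gt0 => b ba.
  have : (nat_of_ord b < a)%N \/ (a < nat_of_ord b)%N.
    by case: (ltngtP (nat_of_ord b) a) ba => [|| /eqP]; [left|right|rewrite -val_eqE /= => ->].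
  by case=> h; [have := ug a an b h|have := ug b (ltn_ord b) a h]; nra.
have nneg : \forall x \near x0, forall a, (a < n)%N -> f x (r x0 a - u) * f x (r x0 a + u) < 0.
  apply: near_ordinal => a an.
  have C : {for x0, continuous (fun x => f x (r x0 a - u) * f x (r x0 a + u))}.
    by apply: contM; apply: fc.
  by have /cvgr_lt/(_ _ (neg a an)) := C.
near=> x.
have irx : increasing n (r x) by near: x.
have fEx : forall s, f x s = c * \prod_(a < n) (s - r x a) by near: x.
have ngx : forall a, (a < n)%N -> f x (r x0 a - u) * f x (r x0 a + u) < 0 by near: x.
have /choice[g gP] : forall a, exists b, (a < n)%N ->
    [/\ (b < n)%N, r x0 a - u < r x b & r x b < r x0 a + u].
  move=> a; case: (ltnP a n) => an; last by exists 0%N.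
  (* Without a root in the interval, each factor would have the same weak sign at its two ends. *)
  apply: contrapT => nb; have := ngx a an; rewrite ltNge; apply/negP; rewrite negbK.
  rewrite !fEx mulrACA -big_split /= mulr_ge0 //; first by rewrite -expr2 sqr_ge0.
  apply: prodr_ge0 => b _; rewrite leNgt; apply/negP => h.
  apply: nb; exists b => _; split=> //; nra.
have gid := @incr_self_id n g _ _.
have [_ h1 h2] := gP a0 a0n; move: h1 h2; rewrite gid // => [h1 h2|b d bd dn|b bn]; last by have [] := gP b bn.
  by rewrite ltr_norml; lra.
have [gb b1 b2] := gP b (ltn_trans bd dn); have [gd d1 d2] := gP d dn.
have gap := ug d dn b bd; have : r x (g b) < r x (g d) by lra.
case: (ltngtP (g b) (g d)) => // [db|->]; last by rewrite ltxx.
by move=> h; have := lt_trans h (irx _ _ db gb); rewrite ltxx.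
Unshelve. all: by end_near. Qed.

End SortedRoots.

Lemma meval_cont (R : realType) (p : mpoly 3 R) :
  continuous (fun x : 'rV[R]_3 => meval (fun a => x 0 a) p).
Proof.
move=> x; rewrite (_ : (fun _ => _) = fun y : 'rV[R]_3 =>
   \sum_(m <- msupp p) mcoeff m p * \prod_i y 0 i ^+ m i); last first.
  by apply/funext => y; rewrite mevalE.
apply: sum_cont => m; apply: contM; first exact: cst_continuous.
elim: (index_enum _) => [|i s IHs].
  rewrite (_ : (fun _ => _) = fun=> 1); first exact: cst_continuous.
  by apply/funext => y; rewrite big_nil.
rewrite (_ : (fun _ => _) = fun y : 'rV[R]_3 => y 0 i ^+ m i * \prod_(j <- s) y 0 j ^+ m j).
  apply: contM; last exact: IHs.
  elim: (m i) => [|d IHd].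
    by rewrite (_ : (fun _ => _) = fun=> 1); [exact: cst_continuous|apply/funext].
  rewrite (_ : (fun _ => _) = fun y : 'rV[R]_3 => y 0 i * y 0 i ^+ d).
    by apply: contM; [exact: coord_cvg|exact: IHd].
  by apply/funext => y; rewrite exprS.
by apply/funext => y; rewrite big_cons.
Qed.

Section Rho.
Variables (R : realType) (k : nat) (v : 'I_k -> 'rV[R]_2) (F : dhomog 3 R (k - 3)).
Hypotheses (k4 : (4 <= k)%N) (aF : adjoint_curve v F).
Variables (sg : R) (N : 'I_k -> 'rV[R]_3) (c1 c2 : R).
Hypothesis G : gon sg N (fun i => homogenize (v i)).
Local Notation l i x := (dot (N i) x).
Local Notation e := (center c1 c2).
Local Notation mk := (mk c1 c2).
Hypothesis e0 : forall h, 0 < l h e.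
Let n := (k - 3)%N.

Lemma mkE a b s : mk a b s = mk a b 0 + s *: e.
Proof. by apply: row3P; rewrite !mxE /=; ring. Qed.

Lemma eval_center_neq0 : eval_at F e != 0.
Proof.
have [] := adjoint_roots k4 aF G (d := mk 1 0 0) e0 _ => // s.
by rewrite -mkE mk_neq0 // oner_eq0.
Qed.

Definition rho_spec (rho : nat -> R * R -> R) :=
  [/\ forall a b, (a != 0) || (b != 0) -> increasing n (rho^~ (a, b)),
     forall a b s, eval_at F (mk a b s) = eval_at F e * \prod_(j < n) (s - rho j (a, b)),
     forall a b s, (a != 0) || (b != 0) -> (forall h, 0 <= l h (mk a b s)) ->
       forall j, (j < n)%N -> rho j (a, b) < s
   & forall a b s, (a != 0) || (b != 0) ->
       forall i j, nonadjacent i j -> l i (mk a b s) = 0 -> l j (mk a b s) = 0 ->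
       (0 < npos N (mk a b s) <= n)%N /\ s = rho (npos N (mk a b s)).-1 (a, b)].

Lemma rho_exists : exists rho, rho_spec rho.
Proof.
have /choice[r rP] : forall p : R * R, exists r : nat -> R,
  [/\ (p.1 != 0) || (p.2 != 0) -> increasing n r,
      forall s, eval_at F (mk p.1 p.2 s) = eval_at F e * \prod_(j < n) (s - r j),
      forall s, (p.1 != 0) || (p.2 != 0) -> (forall h, 0 <= l h (mk p.1 p.2 s)) ->
        forall j, (j < n)%N -> r j < s
    & forall s, (p.1 != 0) || (p.2 != 0) ->
        forall i j, nonadjacent i j -> l i (mk p.1 p.2 s) = 0 -> l j (mk p.1 p.2 s) = 0 ->
       (0 < npos N (mk p.1 p.2 s) <= n)%N /\ s = r (npos N (mk p.1 p.2 s)).-1].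
  move=> [a b] /=; case: (boolP ((a != 0) || (b != 0))) => ab; last first.
    (* In the zero direction the form is its value at [e] times a power of [s]: all the roots are
       zero. *)
    exists (fun=> 0); split=> // s.
    move: ab; rewrite -negb_and negbK => /andP[/eqP -> /eqP ->].
    have -> : mk 0 0 s = s *: e by apply: row3P; rewrite !mxE /=; ring.
    rewrite eval_atZ mulrC; congr (_ * _).
    by under eq_bigr do rewrite subr0; rewrite prodr_const card_ord.
  have [|_ [r [r1 r2 r3 r4]]] := adjoint_roots k4 aF G (d := mk a b 0) e0 _.
    by move=> s; rewrite -mkE mk_neq0.
  exists r; split=> [_ //|s|s _|s _]; first by rewrite mkE r2.
    by rewrite (mkE a b s); apply: r3.
  by move=> i j; rewrite (mkE a b s); apply: r4.
exists (fun j p => r p j); split=> a b.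
- by move=> ab; have [h _ _ _] := rP (a, b); apply: h.
- by move=> s; have [_ h _ _] := rP (a, b); apply: h.
- by move=> s ab; have [_ _ h _] := rP (a, b); apply: h.
- by move=> s ab; have [_ _ _ h] := rP (a, b); apply: h.
Qed.

Variable rho : nat -> R * R -> R.
Hypothesis rhoP : rho_spec rho.

Let rho_inc a b : (a != 0) || (b != 0) -> increasing n (rho^~ (a, b)).
Proof. by have [h _ _ _] := rhoP; apply: h. Qed.
Let rhoE a b s : eval_at F (mk a b s) = eval_at F e * \prod_(j < n) (s - rho j (a, b)).
Proof. by have [_ h _ _] := rhoP; apply: h. Qed.

Lemma rho0 j : (j < n)%N -> rho j (0, 0) = 0.
Proof.
move=> jn; have : eval_at F (mk 0 0 (rho j (0, 0))) = 0.
  by rewrite rhoE (bigD1 (Ordinal jn)) //= subrr mul0r mulr0.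
set s := rho j _; have -> : mk 0 0 s = s *: e by apply: row3P; rewrite !mxE /=; ring.
rewrite eval_atZ => /eqP; rewrite mulf_eq0 (negbTE eval_center_neq0) orbF expf_eq0.
by case/andP => _ /eqP.
Qed.

Lemma rho_hom c a b j : (j < n)%N -> 0 < c -> rho j (c * a, c * b) = c * rho j (a, b).
Proof.
move=> jn c0; case: (boolP ((a != 0) || (b != 0))) => ab; last first.
  move: ab; rewrite -negb_and negbK => /andP[/eqP -> /eqP ->].
  by rewrite !mulr0 rho0 // mulr0.
have cab : (c * a != 0) || (c * b != 0) by rewrite !mulf_eq0 (gt_eqF c0).
apply: (increasing_roots_unique (r' := fun j => c * rho j (a, b)) (rho_inc cab)) jn.
  by move=> i j' ij jn; rewrite ltr_pM2l //; apply: (rho_inc ab).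
move=> s; apply: (mulfI eval_center_neq0); rewrite -rhoE.
have -> : mk (c * a) (c * b) s = c *: mk a b (s / c).
  by rewrite -mkZ mulrCA divff ?gt_eqF // mulr1.
rewrite eval_atZ rhoE mulrCA; congr (_ * _).
have -> : c ^+ (k - 3) = \prod_(i < n) c by rewrite prodr_const card_ord.
rewrite -big_split /=; apply: eq_bigr => i _.
by field; rewrite gt_eqF.
Qed.

(** Passing to the opposite vector changes the sign of [s], which reverses the order of the
    roots. *)
Lemma rho_opp a b j : (j < n)%N -> rho j (- a, - b) = - rho (n - j.+1)%N (a, b).
Proof.
move=> jn; case: (boolP ((a != 0) || (b != 0))) => ab; last first.
  move: ab; rewrite -negb_and negbK => /andP[/eqP -> /eqP ->].
  by rewrite !oppr0 !rho0 ?oppr0 //; lia.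
have nab : (- a != 0) || (- b != 0) by rewrite !oppr_eq0.
apply: (increasing_roots_unique (r' := fun j => - rho (n - j.+1)%N (a, b)) (rho_inc nab)) jn.
  by move=> i j' ij jn; rewrite ltrN2; apply: (rho_inc ab); lia.
move=> s; apply: (mulfI eval_center_neq0); rewrite -rhoE.
have -> : mk (- a) (- b) s = (-1) *: mk a b (- s).
  by rewrite -mkZ !mulN1r opprK.
rewrite eval_atZ rhoE mulrCA; congr (_ * _).
have -> : (-1) ^+ (k - 3) = \prod_(i < n) (-1) :> R by rewrite prodr_const card_ord.
rewrite -big_split /= (reindex_inj rev_ord_inj) /=.
by apply: eq_bigr => i _; rewrite mulN1r opprD !opprK.
Qed.

Lemma rho_cont j : (j < n)%N -> continuous (rho j).
Proof.
move=> jn [a b]; case: (boolP ((a != 0) || (b != 0))) => ab.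
  have mkc s : {for (a, b), continuous (fun p : R * R => eval_at F (mk p.1 p.2 s))}.
    apply: (continuous_comp (f := fun p : R * R => mk p.1 p.2 s)); last exact: meval_cont.
    by apply: mk_cont; [exact: cvg_fst|exact: cvg_snd|exact: cst_continuous].
  apply: (@increasing_roots_cont R _ n (fun p s => eval_at F (mk p.1 p.2 s)) (eval_at F e)
    (fun p j => rho j p)) jn => //; first exact: eval_center_neq0.
    have : \forall p \near (a, b), (p.1 != 0) || (p.2 != 0).
      case/orP: ab => [a0|b0].
        have C : {for (a, b), continuous (fun p : R * R => p.1)} by exact: cvg_fst.
        have H : \forall p \near (a, b), p.1 != 0 by apply: (cvgr_neq0 _ C).
        by apply: filterS H => p ->.
      have C : {for (a, b), continuous (fun p : R * R => p.2)} by exact: cvg_snd.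
      have H : \forall p \near (a, b), p.2 != 0 by apply: (cvgr_neq0 _ C).
      by apply: filterS H => p ->; rewrite orbT.
    by apply: filterS => -[a' b'] /=; apply: rho_inc.
  have H0 (p : R * R) s : eval_at F (mk p.1 p.2 s) = eval_at F e * \prod_(j < n) (s - rho j p).
    by case: p => a' b'; apply: rhoE.
  by near=> p; apply: H0.
move: ab; rewrite -negb_and negbK => /andP[/eqP -> /eqP ->].
(* At the origin all the roots are zero and cannot be separated. Instead, the form is nonzero at
   [mk a b 1] for small [a] and [b], and a root [s] of size at least [eps] could be scaled to such a
   point. *)
have C : {for (0, 0), continuous (fun p : R * R => eval_at F (mk p.1 p.2 1))}.
  apply: (continuous_comp (f := fun p : R * R => mk p.1 p.2 1)); last exact: meval_cont.
  by apply: mk_cont; [exact: cvg_fst|exact: cvg_snd|exact: cst_continuous].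
have F1 : eval_at F (mk 0 0 1) != 0.
  have -> : mk 0 0 1 = e by apply: row3P; rewrite !mxE /=; ring.
  exact: eval_center_neq0.
have /nbhs_ballP[u /= u0 H] : \forall p \near (0 : R, 0 : R), eval_at F (mk p.1 p.2 1) != 0.
  exact: (cvgr_neq0 _ C F1).
rewrite /prop_for /continuous_at rho0 //; apply/cvgrPdist_lt => eps eps0.
have : \forall p \near (0 : R, 0 : R), ball (0 : R, 0 : R) (u * eps) p.
  by apply: nbhsx_ballx; rewrite mulr_gt0.
apply: filterS => -[a' b'] [/= ha hb]; rewrite sub0r normrN ltNge; apply/negP => hs.
set s := rho j (a', b') in hs.
have s0 : s != 0 by rewrite -normr_gt0 (lt_le_trans eps0).
have : eval_at F (mk a' b' s) = 0.
  by rewrite rhoE (bigD1 (Ordinal jn)) //= subrr mul0r mulr0.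
have -> : mk a' b' s = s *: mk (a' / s) (b' / s) 1.
  by rewrite -mkZ !(mulrCA s) !divff // !mulr1.
rewrite eval_atZ => /eqP; rewrite mulf_eq0 expf_eq0 (negbTE s0) andbF /=.
apply/negP; apply: (H (a' / s, b' / s)).
move: ha hb; rewrite /ball /= !sub0r !normrN => ha hb.
have sn : 0 < `|s| by rewrite normr_gt0.
split; rewrite /ball /= sub0r normrN normf_div ltr_pdivrMr //.
  by apply: (lt_le_trans ha); rewrite ler_pM2l.
by apply: (lt_le_trans hb); rewrite ler_pM2l.
Unshelve. all: by end_near. Qed.

End Rho.

(** * Hyperbolicity *)

Section ComplexNorm.
Variable R : realType.
Implicit Types (z : R[i]) (r : R).

Definition nsq z : R := complex.Re z ^+ 2 + complex.Im z ^+ 2.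

Lemma nsqM z z' : nsq (z * z') = nsq z * nsq z'.
Proof. by case: z z' => a b [c d]; rewrite /nsq /=; ring. Qed.

Lemma nsq_prod (n : nat) (f : 'I_n -> R[i]) : nsq (\prod_i f i) = \prod_i nsq (f i).
Proof.
elim: (index_enum _) => [|i s IHs]; last by rewrite !big_cons nsqM IHs.
by rewrite !big_nil /nsq /= expr1n expr0n addr0.
Qed.

Lemma ReM_real z r : complex.Re (z * (real_complex R r)) = complex.Re z * r.
Proof. by case: z => a b /=; rewrite mulr0 subr0. Qed.

Lemma ImM_real z r : complex.Im (z * (real_complex R r)) = complex.Im z * r.
Proof. by case: z => a b /=; rewrite mulr0 add0r. Qed.

Lemma horner_real (q : {poly R[i]}) : exists A B : {poly R}, forall t : R,
  complex.Re q.[real_complex R t] = A.[t] /\ complex.Im q.[real_complex R t] = B.[t].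
Proof.
exists (\poly_(i < size q) complex.Re q`_i), (\poly_(i < size q) complex.Im q`_i) => t.
rewrite !horner_poly horner_coef; split.
  rewrite (raddf_sum (@complex.Re R)); apply: eq_bigr => i _.
  by rewrite -rmorphXn /= ReM_real.
rewrite (raddf_sum (@complex.Im R)); apply: eq_bigr => i _.
by rewrite -rmorphXn /= ImM_real.
Qed.

End ComplexNorm.

Section Hyperbolicity.
Variables (R : realType) (k : nat) (v : 'I_k -> 'rV[R]_2) (F : dhomog 3 R (k - 3)).
Hypotheses (k4 : (4 <= k)%N) (aF : adjoint_curve v F).
Variables (sg : R) (N : 'I_k -> 'rV[R]_3) (e : 'rV[R]_3).
Hypothesis G : gon sg N (fun i => homogenize (v i)).
Local Notation l i x := (dot (N i) x).
Hypothesis e0 : forall h, 0 < l h e.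
Implicit Types (x d : 'rV[R]_3) (z : R[i]).
Local Notation rc := (real_complex R).
Local Notation cx x := (map_mx rc x).

Lemma evalC_line d x z : evalC_at F (cx d + z *: cx x) = (map_poly rc (line_poly F d x)).[z].
Proof. by rewrite map_line_poly horner_line_poly. Qed.

(* All the roots of z |-> F (d + z x) are real, and each contributes at least
   |Im z|.  This bound, unlike the location of the roots, passes to the limit when
   x tends to the boundary of the polygon. *)
Lemma evalC_lower d x z : (forall h, 0 < l h x) ->
  eval_at F x ^+ 2 * complex.Im z ^+ 2 ^+ (k - 3) <= nsq (evalC_at F (cx d + z *: cx x)).
Proof.
move=> x0.
have [r rE] : exists r : nat -> R, forall s, eval_at F (d + s *: x) = eval_at F x * \prod_(a < k - 3) (s - r a).
  case: (pselect (exists s, d + s *: x = 0)) => [[s ds]|nds].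
    exists (fun=> s) => t; have -> : d + t *: x = (t - s) *: x.
      by have /eqP := ds; rewrite addr_eq0 => /eqP ->; rewrite scalerBl addrC.
    by rewrite (eval_atZ F) mulrC prodr_const card_ord.
  have [|_ [r [_ rE _ _]]] := adjoint_roots k4 aF G (d := d) x0 _; last by exists r.
  by move=> s; apply/eqP => ds; apply: nds; exists s.
have PE : line_poly F d x = eval_at F x *: \prod_(a < k - 3) ('X - (r a)%:P).
  apply/eqP; rewrite -subr_eq0; apply/eqP; apply: poly_eq0_of_horner => s.
  rewrite hornerD hornerN horner_line_poly -/(eval_at F _) rE hornerZ horner_prod.
  under [X in _ - _ * X]eq_bigr do rewrite hornerXsubC.
  by rewrite subrr.
rewrite evalC_line PE map_polyZ /= rmorph_prod hornerZ horner_prod nsqM nsq_prod.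
have -> : nsq (rc (eval_at F x)) = eval_at F x ^+ 2 by rewrite /nsq /= expr0n addr0.
rewrite ler_wpM2l ?sqr_ge0 //.
have -> : complex.Im z ^+ 2 ^+ (k - 3) = \prod_(i < k - 3) complex.Im z ^+ 2.
  by rewrite prodr_const card_ord.
apply: ler_prod => i _; rewrite sqr_ge0 /= rmorphB /= map_polyX map_polyC hornerXsubC /nsq.
by case: z => a b /=; rewrite subr0 lerDr sqr_ge0.
Qed.

(** [W] compares the two sides of [evalC_lower] along the segment from [x] to [e]. It is a
    polynomial in [t], nonnegative for $0 < t \le 1$, where all the edge forms are positive, hence
    also at $t = 0$, where only the term in the imaginary part of [z] remains. *)
Lemma evalC_real_root d x z : eval_at F x != 0 -> (forall h, 0 <= l h x) ->
  evalC_at F (cx d + z *: cx x) = 0 -> complex.Im z = 0.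
Proof.
move=> Fx lx Fz; set y := complex.Im z.
have [A [B AB]] := horner_real (line_poly (map_mpoly rc F) (cx d + z *: cx x) (z *: cx (e - x))).
pose Q := line_poly F x (e - x).
pose W := A ^+ 2 + B ^+ 2 - (y ^+ 2 ^+ (k - 3)) *: Q ^+ 2.
have WE t : W.[t] = nsq (evalC_at F (cx d + z *: cx (x + t *: (e - x)))) -
    eval_at F (x + t *: (e - x)) ^+ 2 * y ^+ 2 ^+ (k - 3).
  rewrite /W !hornerE /= /nsq; have [<- <-] := AB t.
  rewrite horner_line_poly -/(evalC_at F _) !horner_line_poly -!/(eval_at F _).
  rewrite (_ : cx d + z *: cx x + rc t *: (z *: cx (e - x)) = cx d + z *: cx (x + t *: (e - x))).
    by congr (_ - _); rewrite -mulrA -expr2 mulrC.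
  by rewrite (map_mxD rc x) map_mxZ scalerDr addrA !scalerA (mulrC z).
have W_ge0 t : 0 < t -> t <= 1 -> 0 <= W.[t].
  move=> t0 t1; rewrite WE subr_ge0; apply: evalC_lower => h.
  rewrite (_ : x + t *: (e - x) = (1 - t) *: x + t *: e); last first.
    by rewrite scalerBr scalerBl scale1r addrA addrAC.
  by rewrite dotDr !dotZr ltr_wpDl ?mulr_gt0 ?mulr_ge0 // subr_ge0.
have : 0 <= W.[0].
  rewrite leNgt; apply/negP => W0.
  have : \forall t \near (0 : R), W.[t] < 0.
    by have /cvgr_lt/(_ _ W0) := @continuous_horner R W 0.
  move=> /nbhs_ballP[u /= u0 H].
  pose t := Num.min (u / 2) 1.
  have t0 : 0 < t by rewrite lt_min divr_gt0 ?ltr01.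
  have t1 : t <= 1 by rewrite ge_min lexx orbT.
  have tu : t < u by rewrite (le_lt_trans (y := u / 2)) ?ge_min ?lexx //; lra.
  have := W_ge0 t t0 t1; rewrite leNgt => /negP; apply; apply: H.
  by rewrite /ball /= sub0r normrN gtr0_norm.
rewrite WE scale0r addr0 Fz /nsq /= !expr0n /= addr0 add0r oppr_ge0 pmulr_rle0; last first.
  by rewrite exprn_even_gt0.
move=> h; apply/eqP/negPn/negP => y0; move: h; rewrite leNgt => /negP; apply.
by rewrite exprn_gt0 // exprn_even_gt0.
Qed.

Lemma evalC_atZ (a : R[i]) (w : 'rV[R[i]]_3) :
  evalC_at F (a *: w) = a ^+ (k - 3) * evalC_at F w.
Proof.
apply: meval_homog; apply/dhomogP => m; rewrite mcoeff_msupp mcoeff_map_mpoly => h.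
have /dhomogP := dhomog_is_dhomog F; apply; rewrite mcoeff_msupp.
by apply: contra_neq h => ->.
Qed.

Lemma hyperbolic_at x : x != 0 -> eval_at F x != 0 -> (forall h, 0 <= l h x) -> hyperbolic F (toP x).
Proof.
move=> x0 Fx lx; split; first by move=> /(real_locus_toP F x0) /eqP; rewrite (negbTE Fx).
move=> lam lam0; have [c c0 ->] := hc_toP x0; rewrite -scalemxAl => /eqP.
rewrite scaler_eq0 (negbTE c0) /= => /eqP xl z z0 zl Fz.
pose m := lam^T; have m0 : m != 0 by rewrite trmx_eq0.
have dotE (S : comNzRingType) (a : 'rV[S]_3) (b : 'cV[S]_3) : (a *m b) 0 0 = dot a b^T.
  rewrite !mxE !big_ord_recl big_ord0 addr0 addrA.
  by rewrite /dot !mxE; congr (_ * _ + _ * _ + _ * _); congr (fun_of_matrix _ _ _); apply: val_inj.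
have xm : dot x m = 0 by rewrite -dotE xl mxE.
have zm : dot z (cx m) = 0 by rewrite /m -map_trmx -dotE zl mxE.
(* [x], [d] and [m] are pairwise orthogonal, so [x] and [d] span the line with normal [m]. Its
   complex points other than [x] are multiples of some [d + ze x], and only [ze] has to be shown
   real. *)
pose d := cross x m.
have map_dot (a b : 'rV[R]_3) : dot (cx a) (cx b) = rc (dot a b).
  by rewrite /dot !mxE !rmorphD !rmorphM.
have cxd : cx d = cross (cx x) (cx m).
  by apply: row3P; rewrite !mxE /= ?mxE rmorphB !rmorphM.
have D : det3 (cx x) (cx d) (cx m) = rc (- (dot x x * dot m m)).
  have -> : rc (- (dot x x * dot m m)) = rc (dot x m) * rc (dot x m) - rc (dot x x) * rc (dot m m).
    by rewrite xm rmorphN rmorphM rmorph0 mulr0 sub0r.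
  by rewrite cxd -!map_dot /det3 /dot /cross !row3E; ring.
have Dz : det3 (cx x) (cx d) z = 0.
  have -> : det3 (cx x) (cx d) z = dot (cx x) (cx m) * dot (cx x) z - dot (cx x) (cx x) * dot z (cx m).
    by rewrite cxd /det3 /dot /cross !row3E; ring.
  by rewrite zm map_dot xm rmorph0 mul0r mulr0 subrr.
have D0 : det3 (cx x) (cx d) (cx m) != 0.
  by rewrite D fmorph_eq0 oppr_eq0 mulf_neq0 // gt_eqF // dot_gt0.
have := cramer3 (cx x) (cx d) (cx m) z; rewrite Dz scale0r addr0.
set ka := det3 (cx x) (cx d) (cx m) in D0 *; set al := det3 z _ _; set be := det3 _ z _ => E.
have span (a : R[i]) (w : 'rV[R]_3) : w != 0 -> a != 0 -> z = a *: cx w ->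
    exists2 w : 'rV[R]_3, w != 0 & (z == cx w)%MS.
  move=> w0 a0 zE; exists w => //; apply/andP; split; first by rewrite zE scalemx_sub.
  by rewrite -{1}[cx w]scale1r -(mulVf a0) -scalerA -zE scalemx_sub.
have zE : z = ka^-1 *: (al *: cx x + be *: cx d) by rewrite -E scalerA mulVf // scale1r.
case: (eqVneq be 0) => [b0|b0].
  apply: (span (al / ka) x x0); last by rewrite zE b0 scale0r addr0 scalerA mulrC.
  apply: contra_neq z0 => a0; rewrite zE b0 scale0r addr0 scalerA mulrC a0.
  by rewrite scale0r.
pose ze := al / be.
have {}zE : z = (be / ka) *: (cx d + ze *: cx x).
  rewrite zE scalerDr !scalerA [RHS]scalerDr !scalerA addrC; congr (_ *: _ + _ *: _).
    by rewrite mulrC.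
  by rewrite /ze; field; rewrite b0 D0.
have bk0 : be / ka != 0 by rewrite mulf_neq0 // invr_eq0.
have Fze : evalC_at F (cx d + ze *: cx x) = 0.
  by apply/eqP; move/eqP: Fz; rewrite zE evalC_atZ mulf_eq0 expf_eq0 (negbTE bk0) andbF.
have im0 := evalC_real_root Fx lx Fze.
have zeE : ze = rc (complex.Re ze) by case: (ze) im0 => a b /= ->.
apply: (span (be / ka) (d + complex.Re ze *: x)) => //; last first.
  by rewrite zE map_mxD map_mxZ /= -zeE.
apply: contra_neq z0 => w0; rewrite zE zeE -map_mxZ -map_mxD w0.
by rewrite map_mx0 scaler0.
Qed.

End Hyperbolicity.

(** * The ovals and the pseudoline *)

Lemma card_between k a b : (a <= b)%N -> (b <= k)%N ->
  #|[pred h : 'I_k | (a <= h)%N && (h < b)%N]| = (b - a)%N.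
Proof.
move=> ab bk; rewrite -sum1_card.
rewrite -(big_mkord (fun h => (a <= h)%N && (h < b)%N) (fun=> 1%N)).
rewrite (@big_cat_nat _ _ _ b) //= [X in (_ + X)%N]big_nat_cond [X in (_ + X)%N]big1 ?addn0; last first.
  by move=> i /andP[/andP[h1 h2] /andP[h3 h4]]; lia.
rewrite (@big_cat_nat _ _ _ a) //= [X in (X + _)%N]big_nat_cond [X in (X + _)%N]big1 ?add0n; last first.
  by move=> i /andP[/andP[h1 h2] /andP[h3 h4]]; lia.
rewrite big_nat_cond (eq_bigl (fun i => (a <= i < b)%N && true)); last first.
  by move=> i; case: (a <= i)%N; case: (i < b)%N.
by rewrite -big_nat_cond sum_nat_const_nat muln1.
Qed.

(** With the [r] below the gauge is the last coordinate plus the absolute values of the other two,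
    positive at [v] or at [- v]: the whole plane is a star region. It stands for the complement of
    the ovals when there are none. *)
Lemma setT_connected (R : realType) : connected [set: P2 R].
Proof.
pose r (p : R * R) := - (`|p.1| + `|p.2|).
have rc : continuous r.
  move=> p; apply: (@cvgN _ _ _ (nbhs p)); apply: (@cvgD _ _ _ (nbhs p)).
    by apply: (continuous_comp (f := fst)); [exact: cvg_fst|exact: norm_continuous].
  by apply: (continuous_comp (f := snd)); [exact: cvg_snd|exact: norm_continuous].
have rh (c a b : R) : 0 < c -> r (c * a, c * b) = c * r (a, b).
  by move=> c0; rewrite /r /= !normrM gtr0_norm // -mulrDr mulrN.
have -> : [set: P2 R] = star_in (gauge 0 0 r).
  rewrite predeqE => x; split=> // _; rewrite /star_in /=.
  have := hc_neq0 x; move: (hc x) => u u0.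
  suff H (w : 'rV[R]_3) : w != 0 -> 0 <= w 0 ord_max -> 0 < gauge 0 0 r w.
    case: (lerP 0 (u 0 ord_max)) => us; first by left; apply: H.
    by right; apply: H; rewrite ?oppr_eq0 // mxE oppr_ge0 ltW.
  move=> w0 ws; rewrite /gauge /r /da /db /= !mul0r !subr0 opprK lt_neqAle.
  rewrite !addr_ge0 ?andbT // eq_sym; apply: contra_neq w0 => /eqP.
  rewrite !paddr_eq0 ?addr_ge0 // !normr_eq0 => /andP[/eqP h2 /andP[/eqP h0 /eqP h1]].
  by apply: row3P; rewrite mxE.
exact: (star_in_connected (gauge_hom 0 0 rh) (gauge_e 0 0 r)).
Qed.

Lemma homogenize_n0 (R : realType) (p : 'rV[R]_2) : homogenize p != 0.
Proof. by have := homogenize_neq0 p; rewrite inE. Qed.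

Lemma homogenize_last (R : realType) (p : 'rV[R]_2) : homogenize p 0 ord_max = 1.
Proof.
rewrite (_ : ord_max = rshift 2 (0 : 'I_1)); last exact: val_inj.
by rewrite (row_mxEr p (1%:M : 'M_1)) mxE.
Qed.

Section Final.
Variables (R : realType) (k : nat) (v : 'I_k -> 'rV[R]_2) (F : dhomog 3 R (k - 3)).
Hypotheses (k4 : (4 <= k)%N) (aF : adjoint_curve v F).
Variables (sg : R) (N : 'I_k -> 'rV[R]_3) (c1 c2 : R).
Hypothesis G : gon sg N (fun i => homogenize (v i)).
Local Notation l i x := (dot (N i) x).
Local Notation e := (center c1 c2).
Local Notation mk := (mk c1 c2).
Local Notation da := (da c1).
Local Notation db := (db c2).
Hypothesis e0 : forall h, 0 < l h e.
Let n := (k - 3)%N.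
Variable rho : nat -> R * R -> R.
Hypothesis rhoP : rho_spec F N c1 c2 rho.
Implicit Types (u : 'rV[R]_3) (x : P2 R).
Local Notation g j := (gauge c1 c2 (rho j)).
Local Notation ds u := (u 0 ord_max).
Local Notation curve j := (star_bd (g j)).

Let rho_inc a b : (a != 0) || (b != 0) -> increasing n (rho^~ (a, b)).
Proof. by have [h _ _ _] := rhoP; apply: h. Qed.
Let rhoE a b s : eval_at F (mk a b s) = eval_at F e * \prod_(j < n) (s - rho j (a, b)).
Proof. by have [_ h _ _] := rhoP; apply: h. Qed.
Let rcont j : (j < n)%N -> continuous (rho j). Proof. exact: (rho_cont k4 aF G e0 rhoP). Qed.
Let rhom j : (j < n)%N -> forall c a b, 0 < c -> rho j (c * a, c * b) = c * rho j (a, b).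
Proof. by move=> jn c a b; apply: (rho_hom k4 aF G e0 rhoP). Qed.
Let gcont j : (j < n)%N -> continuous (g j).
Proof. by move=> jn; apply: gauge_cont; apply: rcont. Qed.
Let ghom j : (j < n)%N -> forall c u, 0 < c -> g j (c *: u) = c * g j u.
Proof. by move=> jn c u; apply: gauge_hom; apply: rhom. Qed.
Let ge j : forall u t, g j (u + t *: e) = g j u + t.
Proof. by move=> u t; apply: gauge_e. Qed.

Let gN j u : (j < n)%N -> g j (- u) = - g (n - j.+1)%N u.
Proof.
by move=> jn; rewrite /gauge daN dbN (rho_opp k4 aF G e0 rhoP) // mxE; ring.
Qed.

Let gdir j u : (j < n)%N -> u != 0 -> g j u = 0 -> (da u != 0) || (db u != 0).
Proof. by move=> jn; apply: gauge0_dir; apply: rhom. Qed.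

Let g_lt i j u : (da u != 0) || (db u != 0) -> (i < j)%N -> (j < n)%N -> g j u < g i u.
Proof. by move=> du ij jn; rewrite /gauge ltrD2l ltrN2; apply: rho_inc. Qed.

Let g_center_dir j u : (j < n)%N -> ~~ ((da u != 0) || (db u != 0)) -> g j u = ds u.
Proof.
rewrite -negb_and negbK => jn /andP[/eqP a0 /eqP b0].
by rewrite /gauge a0 b0 (rho0 k4 aF G e0 rhoP) // subr0.
Qed.

Let g_le i j u : (i <= j)%N -> (j < n)%N -> g j u <= g i u.
Proof.
rewrite leq_eqVlt => /orP[/eqP -> //|ij] jn.
case: (boolP ((da u != 0) || (db u != 0))) => du; first exact/ltW/g_lt.
by rewrite !g_center_dir // (ltn_trans ij).
Qed.

Let curveP j x : (j < n)%N -> curve j x <-> g j (hc x) = 0 \/ g (n - j.+1)%N (hc x) = 0.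
Proof.
move=> jn; rewrite /star_bd /= gN //; split=> -[h|h]; [by left|right|by left|right].
  by apply: oppr_inj; rewrite oppr0.
by rewrite h oppr0.
Qed.

Let curve_opp j : (j < n)%N -> curve (n - j.+1)%N = curve j.
Proof.
move=> jn; rewrite predeqE => x; rewrite !curveP //; last by lia.
by rewrite (_ : n - (n - j.+1).+1 = j)%N; [split=> -[]; [right|left|right|left]|lia].
Qed.

Let real_locusE x : real_locus F x <-> exists2 j, (j < n)%N & g j (hc x) = 0.
Proof.
rewrite /real_locus /= -(mk_eta c1 c2 (hc x)) rhoE mk_eta.
have ev0 := eval_center_neq0 k4 aF G e0; split=> [/eqP|[j jn gj]].
  rewrite mulf_eq0 (negbTE ev0) /= => /prodf_eq0[j _ /eqP h].
  by exists j.
by rewrite (bigD1 (Ordinal jn)) //= -/(gauge c1 c2 (rho j) (hc x)) gj mul0r mulr0.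
Qed.

Let curve_real j : (j < n)%N -> curve j `<=` real_locus F.
Proof.
move=> jn x /(curveP _ jn)[h|h]; apply/real_locusE; first by exists j.
by exists (n - j.+1)%N => //; lia.
Qed.

Let real_curve x : real_locus F x -> exists2 j, (j < n)%N & curve j x.
Proof. by move=> /real_locusE[j jn h]; exists j => //; apply/(curveP _ jn); left. Qed.

Let curve_disj i j : (i < n)%N -> (j < n)%N -> i != j -> (n - i.+1)%N != j ->
  curve i `&` curve j = set0.
Proof.
move=> ln jn ij nij; rewrite predeqE => x; split=> // -[/(curveP _ ln) hi /(curveP _ jn) hj].
have x0 := hc_neq0 x.
have sep a b : (a < n)%N -> (b < n)%N -> a != b -> g a (hc x) = 0 -> g b (hc x) = 0 -> False.
  move=> an bn ab ga gb; have du := gdir an x0 ga.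
  case: (ltngtP a b) ab => // ab _.
    by have := g_lt du ab bn; rewrite ga gb ltxx.
  by have := g_lt du ab an; rewrite ga gb ltxx.
case: hi => hi; case: hj => hj.
- exact: (sep i j).
- by apply: (sep i (n - j.+1)%N) => //; lia.
- by apply: (sep (n - i.+1)%N j) => //; lia.
- by apply: (sep (n - i.+1)%N (n - j.+1)%N) => //; lia.
Qed.

Let curve_closed j : (j < n)%N -> closed (curve j).
Proof. by move=> jn; apply: star_bd_closed; [apply: gcont|apply: ghom]. Qed.

Let curve_connected j : (j < n)%N -> connected (curve j).
Proof. by move=> jn; apply: star_bd_connected; [apply: rcont|apply: rhom]. Qed.

(** The remaining curves are finitely many, closed and disjoint from this one, so their union and
    this curve separate the real locus. *)
Let curve_max j B : (j < n)%N -> connected B -> B `<=` real_locus F -> B `&` curve j !=set0 ->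
  B `<=` curve j.
Proof.
move=> jn cB BF Bj.
pose W := \bigcup_(i in [set i | [&& (i < n)%N, i != j & (n - i.+1)%N != j]]) curve i.
apply: (@connected_sub_closed _ (curve j) W) => //.
- exact: curve_closed.
- apply: closed_bigcup => [|i /and3P[ln _ _]]; last exact: curve_closed.
  by apply: (@sub_finite_set _ _ `I_n); [move=> i /= /and3P[]|exact: finite_II].
- rewrite setIC predeqE => x; split=> // -[[i /= /and3P[ln ij nij] xi] xj].
  by have : set0 x by rewrite -(curve_disj ln jn ij nij).
move=> x /BF /real_curve[i ln xi].
case: (eqVneq i j) => [<-|ij]; first by left.
case: (eqVneq (n - i.+1)%N j) => [E|nij]; first by left; rewrite -E curve_opp.
by right; exists i => //=; rewrite ln ij nij.
Qed.

Let curve_component j : (j < n)%N -> component (real_locus F) (curve j).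
Proof.
move=> jn; apply: component_eqP.
- by apply: star_bd_neq0; apply: rhom.
- exact: curve_connected.
- exact: curve_real.
- by move=> B; apply: curve_max.
Qed.

Let component_curve S : component (real_locus F) S -> exists2 j, (j < n)%N & S = curve j.
Proof.
move=> [x Fx ->]; have [j jn xj] := real_curve Fx; exists j => //.
apply: connected_component_eq => //; [exact: curve_connected|exact: curve_real|].
by move=> B; apply: curve_max.
Qed.

(* The m-th oval is given by the m-th largest and the m-th smallest root functions. *)
Let oval_index m := (1 <= m <= n./2)%N.
Let O m : set (P2 R) := curve (n - m)%N.

Let oi m : oval_index m -> [/\ (0 < m)%N, (n - m < n)%N, (m.-1 < n - m)%N & (n - (n - m).+1 = m.-1)%N].
Proof. by rewrite /oval_index => /andP[h1 h2]; split; lia. Qed.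

(** The larger of the two indices of the oval is used because positivity of its gauge then describes
    the side of the centre, which sits at infinite [s]. The sum is the gap between the two roots. *)
Let rpos m : oval_index m -> forall a b, (a != 0) || (b != 0) ->
  0 < rho (n - m)%N (a, b) + rho (n - m)%N (- a, - b).
Proof.
move=> /oi[m0 mn mm E] a b ab; rewrite (rho_opp k4 aF G e0 rhoP) // -/n E subr_gt0.
exact: rho_inc.
Qed.

Let gopp m : oval_index m -> forall u, u != 0 -> 0 <= g (n - m)%N u -> g (n - m)%N (- u) < 0.
Proof. by move=> mo u; have [m0 mn mm E] := oi mo; apply: gauge_opp; [apply: rhom|apply: rpos]. Qed.

Let in_neq0 j : (j < n)%N -> star_in (g j) (toP e).
Proof.
move=> jn; have ge1 : g j e = 1 := g_center (ghom jn) (ge j).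
have en : e != 0 by apply: (g_neq0 (ghom jn)); rewrite ge1 ltr01.
by apply/(star_inP (ghom jn) en); left; rewrite ge1 ltr01.
Qed.

Let out_homeo m : oval_index m -> homeomorphic (star_out (g (n - m)%N)) [set: mobius R].
Proof.
by move=> mo; have [m0 mn mm E] := oi mo; apply: star_out_mobius; [apply: rcont|apply: rhom|apply: rpos].
Qed.

Let out_connected m : oval_index m -> connected (star_out (g (n - m)%N)).
Proof.
by move=> mo; have [m0 mn mm E] := oi mo; apply: star_out_connected; [apply: rcont|apply: rhom|apply: rpos].
Qed.

Let out_neq0 m : oval_index m -> star_out (g (n - m)%N) !=set0.
Proof.
move=> mo; have [f [h [_ _ _ H]]] := out_homeo mo; exists (h (toM (0, 0))).
by have [] := H (toM (0, 0)) I.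
Qed.

Let in_contractible m : oval_index m -> contractible R (star_in (g (n - m)%N)).
Proof.
by move=> mo; have [m0 mn mm E] := oi mo;
  apply: (star_in_contractible (gcont mn) (ghom mn) (ge _) (gopp mo)).
Qed.

Let compl_components m S : oval_index m ->
  component (~` O m) S <-> S = star_in (g (n - m)%N) \/ S = star_out (g (n - m)%N).
Proof.
move=> mo; have [m0 mn mm E] := oi mo; apply: component_setU_open.
- exact: (star_bd_compl (gopp mo)).
- exact: (star_in_open (gcont mn) (ghom mn)).
- exact: (star_out_open (gcont mn) (ghom mn)).
- exact: star_in_out.
- by exists (toP e); apply: in_neq0.
- exact: out_neq0.
- exact: (star_in_connected (ghom mn) (ge _)).
- exact: out_connected.
Qed.

Let in_out_neq m : oval_index m -> star_in (g (n - m)%N) <> star_out (g (n - m)%N).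
Proof.
move=> mo E; have [x xo] := out_neq0 mo.
by have : set0 x by rewrite -(star_in_out (g (n - m)%N)); split=> //; rewrite E.
Qed.

Let oval_O m : oval_index m -> oval F (O m).
Proof.
move=> mo; have [m0 mn mm E] := oi mo; split; first exact: curve_component.
exists (star_in (g (n - m)%N)), (star_out (g (n - m)%N)); split.
- exact: in_out_neq.
- by move=> S; apply: compl_components.
- exact: in_contractible.
- exact: out_homeo.
Qed.

Let mid_opp : odd n -> (n./2 < n)%N /\ (n - (n./2).+1 = n./2)%N.
Proof. by move=> on; have := odd_double_half n; rewrite on; lia. Qed.

(** The middle gauge is odd, so off the curve it is positive at exactly one of a vector and its
    opposite. As a star region, the complement is then connected. *)
Let mid_compl : odd n -> ~` curve n./2 = star_in (g n./2).
Proof.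
move=> /mid_opp[mn mo]; rewrite predeqE => x; rewrite /star_bd /star_in /= gN // mo.
split=> [nx|]; last first.
  by case=> h [] /eqP; rewrite ?oppr_eq0 ?(gt_eqF h) //; move: h; rewrite oppr_gt0 => h; rewrite lt_eqF.
case: (ltrgtP (g n./2 (hc x)) 0) => h; [right|left|] => //; first by rewrite oppr_gt0.
by case: nx; left.
Qed.

Let mid_compl_connected : odd n -> connected (~` curve n./2).
Proof.
move=> on; rewrite mid_compl //; have [mn _] := mid_opp on.
exact: (star_in_connected (ghom mn) (ge _)).
Qed.

Let curve_cases j : (j < n)%N -> (exists2 m, oval_index m & curve j = O m) \/ (odd n /\ j = n./2).
Proof.
move=> jn; have := odd_double_half n; rewrite -mul2n => E.
case: (ltnP j.+1 (n - j)) => h1.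
  left; exists j.+1; first by rewrite /oval_index; lia.
  by rewrite /O curve_opp.
case: (ltnP (n - j) j.+1) => h2.
  left; exists (n - j)%N; first by rewrite /oval_index; lia.
  by rewrite /O subKn // ltnW.
by right; split; [lia|lia].
Qed.

(** The middle curve is excluded because its complement is connected, whereas that of an oval has
    two distinct components. *)
Lemma oval_iff S : oval F S <-> exists2 m, oval_index m & S = O m.
Proof.
split=> [[cS [D [M [DM cDM _ _]]]]|[m mo ->]]; last exact: oval_O.
have [j jn SE] := component_curve cS.
have [[m mo E]|[on jE]] := curve_cases jn; first by exists m => //; rewrite SE.
exfalso; apply: DM; apply: (@connected_component_unique _ (~` S)).
- by rewrite SE jE; apply: mid_compl_connected.
- by apply/cDM; left.
- by apply/cDM; right.
Qed.

Let curve_rep j x : curve j x -> exists u, [/\ u != 0, x = toP u & g j u = 0].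
Proof.
case=> h; first by exists (hc x); rewrite hcK hc_neq0.
exists (- hc x); rewrite oppr_eq0 hc_neq0; split=> //.
by rewrite -scaleN1r toPZ ?oppr_eq0 ?oner_eq0 // hcK.
Qed.

Lemma O_nested m m' : oval_index m -> oval_index m' -> (m < m')%N ->
  O m `&` O m' = set0 /\ inside (O m) (O m').
Proof.
move=> mo mo' mm; have [m0 mn m1 E] := oi mo; have [m0' mn' m1' E'] := oi mo'; split.
  by apply: curve_disj => //; rewrite ?E; lia.
exists (star_in (g (n - m')%N)); split.
- by apply/(compl_components _ mo'); left.
- exact: in_contractible.
- move=> x /curve_rep[u [u0 -> gu]]; apply/(star_inP (ghom mn') u0); left.
  by rewrite -gu; apply: g_lt => //; [exact: gdir gu|lia].
Qed.

Let homogenize_polygon p : polygon v p -> forall h, 0 <= l h (homogenize p).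
Proof.
move=> [w [w0 w1 pE]] h.
have -> : homogenize p = \sum_i w i *: homogenize (v i).
  apply/rowP => j; rewrite summxE; under eq_bigr do rewrite mxE mxE.
  rewrite mxE; case: (@fintype.split 2 1 j) => j'; first by rewrite pE summxE; apply: eq_bigr => i _; rewrite mxE.
  by rewrite mxE !ord1 eqxx -mulr_suml w1 mul1r.
elim/big_rec: _ => [|i y _ y0]; first by rewrite dot0r.
by rewrite dotDr dotZr addr_ge0 // mulr_ge0 // (gon_nneg G).
Qed.


Let polygon_gauge j p : (j < n)%N -> polygon v p -> 0 < g j (homogenize p).
Proof.
move=> jn /homogenize_polygon lp.
case: (boolP ((da (homogenize p) != 0) || (db (homogenize p) != 0))) => du.
  have [_ _ h _] := rhoP; rewrite /gauge subr_gt0; apply: h => // i.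
  by rewrite mk_eta.
by rewrite g_center_dir // homogenize_last.
Qed.

Lemma polygon_inside m : oval_index m -> inside (@affine R @` polygon v) (O m).
Proof.
move=> mo; have [m0 mn mm E] := oi mo; exists (star_in (g (n - m)%N)); split.
- by apply/(compl_components _ mo); left.
- exact: in_contractible.
- move=> _ [p pp <-]; rewrite affineE; apply/(star_inP (ghom mn)); first exact: homogenize_n0.
  by left; apply: polygon_gauge.
Qed.

Lemma polygon_hyperbolic p : polygon v p -> hyperbolic F (affine p).
Proof.
move=> pp; rewrite affineE; apply: (hyperbolic_at k4 aF G e0).
- exact: homogenize_n0.
- rewrite -(mk_eta c1 c2 (homogenize p)) rhoE mulf_neq0 ?(eval_center_neq0 k4 aF G e0) //.
  by apply/prodf_neq0 => j _; have := polygon_gauge (ltn_ord j) pp => /lt0r_neq0.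
- exact: homogenize_polygon.
Qed.

(** A singular point would be a multiple root on the line joining it to the centre, where all the
    roots are simple. *)
Lemma no_real_singularity x : ~ real_singularity F x.
Proof.
move=> [/real_locusE[j jn gj] dF].
have := gdir jn (hc_neq0 x) gj; have := mk_eta c1 c2 (hc x).
move: gj; rewrite /gauge; move: (da (hc x)) (db (hc x)) (ds (hc x)) => a b s /eqP.
rewrite subr_eq0 => /eqP sE xE ab.
pose Q := eval_at F e *: \prod_(i < n | i != Ordinal jn) ('X - (rho i (a, b))%:P).
have PE : line_poly F (mk a b 0) e = ('X - s%:P) * Q.
  rewrite sE /Q -scalerAr -(bigD1 (Ordinal jn) (P := predT) (F := fun i : 'I_n => 'X - (rho i (a, b))%:P)) //=.
  apply/eqP; rewrite -subr_eq0; apply/eqP; apply: poly_eq0_of_horner => t.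
  rewrite hornerD hornerN horner_line_poly -(mkE c1 c2 a b t) -/(eval_at F _) rhoE hornerZ horner_prod.
  by under [X in _ - _ * X]eq_bigr do rewrite hornerXsubC; rewrite subrr.
have : (line_poly F (mk a b 0) e)^`().[s] = 0.
  by rewrite deriv_line_poly -(mkE c1 c2 a b s) xE big1 // => i _; rewrite dF mulr0.
rewrite PE derivM derivXsubC mul1r hornerD hornerM hornerXsubC subrr mul0r addr0.
rewrite hornerZ horner_prod => /eqP; apply/negP; rewrite mulf_neq0 ?(eval_center_neq0 k4 aF G e0) //.
apply/prodf_neq0 => i ij; rewrite hornerXsubC subr_eq0 sE.
have {}ij : nat_of_ord i != j by apply: contra_neq ij => ij; apply: val_inj.
case: (ltngtP i j) ij => // ij _.
  by rewrite gt_eqF //; apply: (rho_inc ab).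
by rewrite lt_eqF //; apply: (rho_inc ab).
Qed.

(** By [gon_sign] the positive forms are those of the edges strictly between [a] and [b], or those
    of the edges strictly outside, according to the sign of the representative. *)
Let npos_between (a b : 'I_k) u : (a < b)%N -> u != 0 -> l a u = 0 -> l b u = 0 ->
  npos N u = (b - a.+1)%N \/ npos N u = (k - (b.+1 - a))%N.
Proof.
move=> ab u0 la lb; have [c c0 H] := gon_sign k4 G ab u0 la lb.
have bk := ltn_ord b.
have S (h : 'I_k) : [\/ (a < h < b)%N /\ c * l h u < 0, ((h < a) || (b < h))%N /\ 0 < c * l h u
    | ((h == a) || (h == b)) /\ l h u = 0].
  have [H1 H2] := H h.
  case: (ltngtP h a) => ha; [by constructor 2; rewrite H1 ?ha| |]; last first.
    by constructor 3; rewrite -la (val_inj ha) eqxx.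
  case: (ltngtP h b) => hb; [by constructor 1; rewrite H2 // ha hb|by constructor 2; rewrite H1 ?hb ?orbT|].
  by constructor 3; rewrite -lb (val_inj hb) eqxx orbT.
case: (ltrgtP c 0) c0 => // cs _; [left|right].
  rewrite -(card_between ab (ltnW bk)); apply: eq_card => h; rewrite !inE.
  case: (S h) => -[h1 h2].
  - by rewrite h1; move: h2; rewrite nmulr_rlt0.
  - move: h2; rewrite nmulr_rgt0 // => h2; rewrite ltNge ltW //=.
    by apply/esym/negP; clear -h1; lia.
  - rewrite h2 ltxx; apply/esym/negP; case/orP: h1 => /eqP ->; lia.
have := cardC [pred h : 'I_k | (a <= h)%N && (h < b.+1)%N].
rewrite card_between ?card_ord //; last exact/ltnW/(ltn_trans ab).
move=> kE.
apply/esym; rewrite -[X in (X - _)%N]kE addKn; apply: eq_card => h; rewrite !inE.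
apply/esym; case: (S h) => -[h1 h2].
- move: h2; rewrite pmulr_rlt0 // => h2; rewrite ltNge ltW //=.
  by apply/esym/negP/negP; clear -h1; lia.
- move: h2; rewrite pmulr_rgt0 // => ->; clear -h1 ab; lia.
- rewrite h2 ltxx; apply/esym/negP/negP; case/orP: h1 => /eqP ->; lia.
Qed.

(** There are [q] edges on one side of the pair and [n.+1 - q] on the other, so the point has root
    index [q.-1] or [n - q], the two indices of the same curve. This serves both the ovals and the
    pseudoline. *)
Lemma residual_curve q (i : 'I_k) : (0 < q <= n)%N ->
  edge_line v i `&` edge_line v (iter q.+1 (@ordS k) i) `<=` curve (n - q)%N.
Proof.
move=> qn x [/(edge_lineP k4 G) li /(edge_lineP k4 G)]; set j := iter _ _ _ => lj.
have u0 := hc_neq0 x; have ik := ltn_ord i.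
have jE : nat_of_ord j = if (i + q.+1 < k)%N then (i + q.+1)%N else (i + q.+1 - k)%N.
  by rewrite /j val_iter_ordS //; move: qn; rewrite /n; lia.
clearbody j; have ijn : nonadjacent i j.
  by apply/and3P; split; apply/eqP => /(congr1 (@nat_of_ord k));
    rewrite ?val_ordS jE; move: qn; rewrite /n; clear -ik; do ?[case: ifP]; lia.
have nE : npos N (hc x) = q \/ npos N (hc x) = (n.+1 - q)%N.
  case: (ltnP (i + q.+1) k) => h; rewrite ?h in jE.
    have ij : (i < j)%N by lia.
    by case: (npos_between ij u0 li lj) => ->; [left|right]; rewrite jE /n; lia.
  rewrite ltnNge h /= in jE.
  have ij : (j < i)%N by move: qn; rewrite /n; lia.
  by case: (npos_between ij u0 lj li) => ->; [right|left]; rewrite jE; move: qn; rewrite /n; lia.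
have du : (da (hc x) != 0) || (db (hc x) != 0).
  apply: contraNT u0; rewrite -negb_and negbK => /andP[/eqP a0 /eqP b0].
  have E : hc x = ds (hc x) *: e.
    by rewrite -[LHS](mk_eta c1 c2) a0 b0; apply: row3P; rewrite !mxE /=; ring.
  move: li; rewrite E dotZr => /eqP; rewrite mulf_eq0 (gt_eqF (e0 i)) orbF => /eqP ->.
  by rewrite scale0r.
have [_ _ _ h] := rhoP.
have := h _ _ (ds (hc x)) du i j ijn; rewrite mk_eta => /(_ li lj)[_ sE].
apply/curveP; first by lia.
case: nE sE => -> sE; [right|left]; apply/eqP; rewrite subr_eq0 {1}sE; apply/eqP; congr (rho _ _).
  by clear -qn; lia.
by clear -qn; lia.
Qed.

(** Half a turn along the pseudoline is a loop whose lift [w] ends at the opposite of its starting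
    vector, since the middle index is fixed by the reversal in [rho_opp]. *)
Let mid_not_simply_connected (M : set (P2 R)) : odd n -> curve n./2 `<=` M ->
  ~ simply_connected R M.
Proof.
move=> on LM; have [mn me] := mid_opp on.
pose w t := mk (cos (pi * t)) (sin (pi * t)) (rho n./2 (cos (pi * t), sin (pi * t))).
apply: (not_simply_connected (w := w)).
- move=> t; apply: mk_cont; [apply: cos_pi_cont|apply: sin_pi_cont|
    apply: (r_ray_cont (rcont mn) (fx := id))]; exact: cvg_id.
- by move=> t; apply: mk_neq0; apply: cos_sin_neq0.
- rewrite /w mulr1 mulr0 cospi sinpi cos0 sin0 -[RHS]scaleN1r -mkZ mulr1 mulr0 mulN1r.
  by have := rho_opp k4 aF G e0 rhoP 1 0 mn; rewrite me oppr0 => ->.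
- by move=> t; apply/LM/ray_bd/rhom.
Qed.

Lemma pseudoline_curve : odd n -> pseudoline F (curve n./2).
Proof.
move=> on; have [mn _] := mid_opp on; split; first exact: curve_component.
exact: mid_compl_connected.
Qed.

(** The exterior of the outermost oval: its gauge is the largest among those of the ovals, so where
    it is negative at both representatives the others are too. The middle index is lower still, and
    its gauge larger, so the middle curve falls in this exterior. *)
Let outer_region : (0 < n./2)%N -> odd n -> let M := star_out (g (n - n./2)%N) in
  [/\ component (~` \bigcup_(m in [set m | oval_index m]) O m) M,
     forall m, oval_index m -> outside M (O m) & curve n./2 `<=` M].
Proof.
move=> h0 on; have [mn me] := mid_opp on; set q := n./2 in h0 mn me *.
have qo : oval_index q by rewrite /oval_index h0 leqnn.
have [q0 qn q1 E] := oi qo.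
split.
- apply: component_eqP; [exact: out_neq0|exact: out_connected| |].
    move=> x Mx [m /= mo Om]; have [u [u0 xu gu]] := curve_rep Om.
    move: Mx; rewrite xu => /(star_outP (ghom qn) u0)[h _].
    have [m0 mn' m1 _] := oi mo.
    have : g (n - m)%N u <= g (n - q)%N u by apply: g_le => //; move: mo; rewrite /oval_index -/q; lia.
    by rewrite gu leNgt h.
  move=> B cB BO BM; apply: (@connected_sub_open _ _ (star_in (g (n - q)%N))) => //.
  + exact: (star_out_open (gcont qn) (ghom qn)).
  + exact: (star_in_open (gcont qn) (ghom qn)).
  + by rewrite classical_sets.setIC star_in_out.
  + rewrite classical_sets.setUC -(star_bd_compl (gopp qo)) => x Bx Ox.
    by apply: (BO x Bx); exists q.
- move=> m mo; have [m0 mn' m1 Em] := oi mo.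
  exists (star_out (g (n - m)%N)); split.
  + by apply/(compl_components _ mo); right.
  + exact: out_homeo.
  + have mq : (n - q <= n - m)%N by move: mo; rewrite /oval_index -/q; lia.
    by move=> x [h1 h2]; split; [apply: le_lt_trans h1|apply: le_lt_trans h2]; apply: g_le.
- move=> x /curve_rep[u [u0 -> gu]]; have du := gdir mn u0 gu.
  apply/(star_outP (ghom qn) u0); rewrite gN // E oppr_lt0 -gu; split; apply: g_lt => //; lia.
Qed.

Lemma pseudoline_region : odd n -> exists M : set (P2 R),
  [/\ component (~` \bigcup_(m in [set m | oval_index m]) O m) M,
     forall m, oval_index m -> outside M (O m), ~ simply_connected R M & curve n./2 `<=` M].
Proof.
move=> on; case: (posnP n./2) => [h0|h0]; last first.
  have [h1 h2 h3] := outer_region h0 on.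
  by exists (star_out (g (n - n./2)%N)); split=> //; apply: mid_not_simply_connected.
(* This is the case [k = 4]: there are no ovals, and their complement is the whole plane. *)
have no m : ~ oval_index m by rewrite /oval_index h0; case: m.
exists setT; split=> //.
- apply: component_eqP => //; [by exists (toP e)|exact: setT_connected|by move=> x _ [m /= /no]].
- by move=> m /no.
- exact: mid_not_simply_connected.
Qed.

End Final.

Theorem theorem3p8 (R : realType) (k : nat) (v : 'I_k -> 'rV[R]_2)
    (F : dhomog 3 R (k - 3)) :
  (4 <= k)%N -> convex_gon v -> adjoint_curve v F ->
  [/\ forall p, polygon v p -> hyperbolic F (affine p),
      forall x, ~ real_singularity F x
    & exists O : nat -> set (P2 R),
      [/\ forall S, oval F S <-> exists2 m, (1 <= m <= (k - 3)./2)%N & S = O m,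
          forall m n, (1 <= m)%N -> (m < n)%N -> (n <= (k - 3)./2)%N ->
            O m `&` O n = set0 /\ inside (O m) (O n),
          forall m, (1 <= m <= (k - 3)./2)%N ->
            inside (@affine R @` polygon v) (O m),
          ~~ odd k -> exists L : set (P2 R),
            [/\ pseudoline F L,
                exists M : set (P2 R),
                  [/\ component
                        (~` \bigcup_(m in [set m | (1 <= m <= (k - 3)./2)%N]) O m) M,
                      forall m, (1 <= m <= (k - 3)./2)%N -> outside M (O m),
                      ~ simply_connected R M
                    & L `<=` M]
              & forall i : 'I_k,
                  edge_line v i `&` edge_line v (iter k./2 (@ordS k) i) `<=` L]
        & forall m, (1 <= m)%N -> (m.*2 + 2 < k)%N -> forall i : 'I_k,
            edge_line v i `&` edge_line v (iter m.+1 (@ordS k) i) `<=` O m]].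
Proof.
move=> k4 vc aF; have [sg [N G]] := convex_gonP k4 vc.
(* The centre is the centroid of the vertices: its edge forms are positive because each edge misses
   some vertex. *)
pose s := \sum_i homogenize (v i).
have s2 : s 0 ord_max = k%:R.
  rewrite summxE (eq_bigr (fun=> 1)) ?sumr_const ?card_ord // => i _.
  exact: homogenize_last.
have e0 h : 0 < dot (N h) (center (s 0 0 / k%:R) (s 0 1 / k%:R)).
  have k0 : 0 < k%:R :> R by rewrite ltr0n; apply: leq_trans k4.
  rewrite (_ : center _ _ = k%:R^-1 *: s); last first.
    by apply: row3P; rewrite !mxE ?s2 //= ?mulVf ?gt_eqF // mulrC.
  rewrite dotZr mulr_gt0 ?invr_gt0 // /s.
  have [j [jh jS]] := exists_third k4 h (ordS h).
  rewrite (bigD1 j) //= dotDr ltr_pwDl ?(gon_pos G) 1?eq_sym //.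
  elim/big_rec: _ => [|i y _ y0]; first by rewrite dot0r.
  by rewrite dotDr addr_ge0 // (gon_nneg G).
have [rho rhoP] := rho_exists k4 aF G e0.
split; [exact: (polygon_hyperbolic k4 aF G e0 rhoP)|exact: (no_real_singularity k4 aF G e0 rhoP)|].
exists (fun m => star_bd (gauge (s 0 0 / k%:R) (s 0 1 / k%:R) (rho (k - 3 - m)%N))); split.
- exact: (oval_iff k4 aF G e0 rhoP).
- move=> m n m0 mn nk; apply: (O_nested k4 aF G e0 rhoP) => //; rewrite ?m0 /=.
    exact: ltnW (leq_trans mn nk).
  by rewrite (leq_trans m0 (ltnW mn)).
- exact: (polygon_inside k4 aF G e0 rhoP).
- move=> ek; have on : odd (k - 3) by rewrite oddB ?(ltnW k4) // (negbTE ek).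
  exists (star_bd (gauge (s 0 0 / k%:R) (s 0 1 / k%:R) (rho (k - 3)./2))); split.
  + exact: (pseudoline_curve k4 aF G e0 rhoP).
  + exact: (pseudoline_region k4 aF G e0 rhoP).
  + move=> i; have kE := odd_double_half k; have nE := odd_double_half (k - 3).
    rewrite (negbTE ek) in kE; rewrite on in nE.
    (* Edges [k./2] apart correspond to [q = k./2 - 1] in [residual_curve], and [k - 3 - q] is then
       the middle index. *)
    rewrite (_ : k./2 = (k - 3 - (k - 3)./2).+1); last by lia.
    rewrite [X in rho X](_ : _ = k - 3 - (k - 3 - (k - 3)./2))%N; last by lia.
    by apply: (residual_curve k4 aF G e0 rhoP); lia.
- move=> m m0 mk i; apply: (residual_curve k4 aF G e0 rhoP); move: mk; rewrite -mul2n; lia.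
Qed.
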